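(* Let $(l_i)_{i\ge1}$ be a strictly decreasing sequence of positive real numbers tending to $0$ and $(m_i)_{i\ge1}$ a sequence of positive integers (the distinct lengths and multiplicities of a fractal string, i.e. of a disjoint union of bounded open intervals containing exactly $m_i$ intervals of length $l_i$). Then there is a Barlow–Evans sequence with $F_0=[0,l_1]$ (Lebesgue measure), base Dirichlet form $\mathcal{E}_0(u,v)=\int_0^{l_1}u'v'\,dx$ with $\mathcal{F}_0=H^{1,2}([0,l_1])$, and finite spaces $G_i$, such that the projective limit $F_\infty$ is connected and the Laplacian on $F_\infty$ with zero boundary conditions at the endpoints is isospectral to the fractal string: its spectrum, counted with multiplicity, is that of the Dirichlet Laplacian on the fractal string, namely the eigenvalues $\pi^2k^2/l_i^2$, $i,k\ge1$, where each pair $(i,k)$ contributes multiplicity $m_i$.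
   Context: Spaces. $C_0[X]$ denotes the space of continuous real-valued functions on $X$ with compact support. A Barlow–Evans sequence consists of the following. $F_0$ is a locally compact, second-countable, Hausdorff space with a $\sigma$-finite Borel measure $\mu_{F_0}$; for each $i\ge1$, $G_i$ is a compact, second-countable, Hausdorff space with a Borel probability measure $\mu_{G_i}$; all these measures are Radon with full support. Inductively, for $i\ge 1$, $B_i\subset F_{i-1}$ is a closed subset, $F_i=((F_{i-1}\setminus B_i)\times G_i)\cup B_i$ (disjoint union), and $\pi_i:F_{i-1}\times G_i\to F_i$ is the map $\pi_i(x,g)=(x,g)$ if $x\in F_{i-1}\setminus B_i$ and $\pi_i(x,g)=x$ if $x\in B_i$. $F_i$ has the quotient topology from $\pi_i$. The map $\phi_i:F_i\to F_{i-1}$ is $\phi_i(x,g)=x$ for $x\in F_{i-1}\setminus B_i$, and $\phi_i(x)=x$ for $x\in B_i$. The Borel measure $\mu_{F_i}$ is $\mu_{F_i}(A)=(\mu_{F_{i-1}}\times\mu_{G_i})(\pi_i^{-1}(A))$. For a map $p$, $p^*f=f\circ p$. Projective limit. $F_\infty=\{(x_i)_{i\ge0}\in\prod_i F_i:\phi_i(x_i)=x_{i-1}\ \forall i\ge1\}$ with the subspace topology of the product topology, with coordinate projections $\Phi_j:F_\infty\to F_j$. $\mu_{F_\infty}$ is the unique Borel measure on $F_\infty$ with $\mu_{F_\infty}(\Phi_i^{-1}(A))=\mu_{F_i}(A)$ for all $i\ge 0$ and all Borel $A\subset F_i$. Dirichlet forms. Let $\mathfrak{F}_0=\mathcal{F}_0\cap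 C_0[F_0]$. For $i\ge1$, $\mathfrak{F}_i$ is the set of $f\in C_0[F_i]$ such that $\pi_i^*f(x,g)=\sum_{k=1}^n f_k(x)h_k(g)$ for some $n$, $f_k\in\mathfrak{F}_{i-1}$, $h_k\in C(G_i)$; for $f,h\in\mathfrak{F}_i$, $\mathcal{E}_i(f,h)=\int_{G_i}\mathcal{E}_{i-1}(\pi_i^*f(\cdot,g),\pi_i^*h(\cdot,g))\,d\mu_{G_i}(g)$. On $\bigcup_i\Phi_i^*\mathfrak{F}_i$ set $\mathcal{E}_\infty(\Phi_i^*u,\Phi_i^*u)=\mathcal{E}_i(u,u)$; this is a well-defined closable form on $L^2(F_\infty,\mu_{F_\infty})$. Zero boundary conditions. The Laplacian on $F_\infty$ with zero boundary conditions at the endpoints is the nonnegative self-adjoint operator on $L^2(F_\infty,\mu_{F_\infty})$ associated with the closure of the restriction of $\mathcal{E}_\infty$ to those $f\in\bigcup_i\Phi_i^*\mathfrak{F}_i$ that vanish on $\Phi_0^{-1}(\{0,l_1\})$. The Dirichlet Laplacian on the fractal string is the direct sum of $-d^2/dx^2$ with Dirichlet boundary conditions over all the intervals. *)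

(* Defs.v *)
From HB Require Import structures.
From mathcomp Require Import all_boot all_order all_algebra.
From mathcomp Require Import all_classical all_reals all_analysis.
Set Implicit Arguments.
Unset Strict Implicit.
Unset Printing Implicit Defensive.
Import Order.TTheory GRing.Theory Num.Theory.
Import numFieldNormedType.Exports.
Local Open Scope classical_set_scope.
Local Open Scope ring_scope.

Notation borel X := (g_sigma_algebraType (@open X)).

(* ((X \ B) x G) u B, as a disjoint union; base points are carried along because
   measurable types are pointed. *)
Definition glue (X : ptopologicalType) (B : set X) (G : ptopologicalType) : Type :=
  ((~` B) * G + B)%type.

Section glue.
Variables (X : ptopologicalType) (B : set X) (G : ptopologicalType).

Definition glue_pi (p : X * G) : glue B G :=
  match pselect (B p.1) with
  | left Bx => inr (SigSub (mem_set Bx))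
  | right nBx => inl (SigSub (mem_set (nBx : (~` B) p.1)), p.2)
  end.

Definition glue_phi (y : glue B G) : X :=
  match y with inl p => set_val p.1 | inr b => set_val b end.

Lemma glue_piK p : glue_phi (glue_pi p) = p.1.
Proof. by rewrite /glue_pi; case: pselect. Qed.

Definition glue_open (U : set (glue B G)) : Prop := open (glue_pi @^-1` U).

Let glue_openT : glue_open setT.
Proof. by rewrite /glue_open preimage_setT; exact: openT. Qed.

Let glue_openI : setI_closed glue_open.
Proof. by move=> U V oU oV; rewrite /glue_open preimage_setI; exact: openI. Qed.

Let glue_open_bigU (I : Type) (f : I -> set (glue B G)) :
  (forall i, glue_open (f i)) -> glue_open (\bigcup_i f i).
Proof.
by move=> of_; rewrite /glue_open preimage_bigcup; apply: bigcup_open => i _; exact: of_.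
Qed.

HB.instance Definition _ := gen_eqMixin (glue B G).
HB.instance Definition _ := gen_choiceMixin (glue B G).
HB.instance Definition _ := isPointed.Build (glue B G) (glue_pi (point, point)).
HB.instance Definition _ :=
  isOpenTopological.Build (glue B G) glue_openT glue_openI glue_open_bigU.

End glue.

(* The topological data (B_1, G_1), (B_2, G_2), ... over F_0 = X: the second pair
   lives over F_1 = glue B_1 G_1, and so on.  The coinductive presentation makes
   F_(i+1) convertible to glue B_(i+1) G_(i+1). *)
Set Primitive Projections.
CoInductive tower (X : ptopologicalType) : Type := Tower {
  tower_B : set X ;
  tower_G : ptopologicalType ;
  tower_tail : tower (glue tower_B tower_G) }.
Unset Primitive Projections.

Definition tower_next (s : {X : ptopologicalType & tower X}) :
    {X : ptopologicalType & tower X} :=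
  existT tower (glue (tower_B (projT2 s)) (tower_G (projT2 s)) : ptopologicalType)
    (tower_tail (projT2 s)).

Section tower_spaces.
Variables (X : ptopologicalType) (s : tower X).

Definition stage (i : nat) := iter i tower_next (existT tower X s).

Definition FF (i : nat) : ptopologicalType := projT1 (stage i).

(* BB i and GG i are the closed set and the fibre space of step i.+1 *)
Definition BB (i : nat) : set (FF i) := tower_B (projT2 (stage i)).
Definition GG (i : nat) : ptopologicalType := tower_G (projT2 (stage i)).

Arguments BB : clear implicits.

Definition ppi (i : nat) (p : FF i * GG i) : FF i.+1 := @glue_pi _ (BB i) (GG i) p.
Definition phi (i : nat) (y : FF i.+1) : FF i := @glue_phi _ (BB i) (GG i) y.

Definition coherent : set (prod_topology FF) :=
  [set x : forall i, FF i | forall i, @phi i (x i.+1) = x i].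

Definition projlim : Type := set_type coherent.

HB.instance Definition _ := Topological.copy projlim (set_type coherent).

Let coherent_point : coherent (fun i => point : FF i).
Proof. by move=> i; exact: glue_piK. Qed.

HB.instance Definition _ := isPointed.Build projlim (SigSub (mem_set coherent_point)).

Definition Phi (i : nat) (x : projlim) : FF i := set_val x i.

End tower_spaces.

Arguments BB {X} s i.
Arguments ppi {X} s i p.
Arguments phi {X} s i y.
Arguments Phi {X} s i x.

Section radon.
Context {R : realType} {X : ptopologicalType}.
Variable mu : {measure set (borel X) -> \bar R}.

Definition radon : Prop :=
  [/\ forall K : set X, compact K -> (mu K < +oo)%E,
      forall A : set (borel X), measurable A ->
        mu A = ereal_inf [set mu U | U in [set U : set X | open U /\ A `<=` U]]
    & forall U : set X, open U ->
        mu U = ereal_sup [set mu K | K in [set K : set X | compact K /\ K `<=` U]]].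

Definition full_support : Prop :=
  forall U : set X, open U -> U !=set0 -> (0 < mu U)%E.

End radon.

(* A Barlow-Evans sequence over F_0 = X; be_muG i is the measure on G_(i+1). *)
Record barlow_evans (R : realType) (X : ptopologicalType) := BarlowEvans {
  be_tower : tower X ;
  be_muF : forall i, {measure set (borel (FF be_tower i)) -> \bar R} ;
  be_muG : forall i, probability (borel (GG be_tower i)) R ;
  be_F0 : [/\ locally_compact [set: X], @second_countable X & hausdorff_space X] ;
  be_muF0 : [/\ sigma_finite setT (be_muF 0), radon (be_muF 0)
              & full_support (be_muF 0)] ;
  be_G : forall i, [/\ compact [set: GG be_tower i],
                       @second_countable (GG be_tower i)
                     & hausdorff_space (GG be_tower i)] ;
  be_muG_radon : forall i, radon (be_muG i) /\ full_support (be_muG i) ;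
  be_B : forall i, closed (BB be_tower i) ;
  be_muFS : forall i (A : set (borel (FF be_tower i.+1))), measurable A ->
    be_muF i.+1 A = (be_muF i \x be_muG i)%E (ppi be_tower i @^-1` A) }.

Definition projlim_measure (R : realType) (X : ptopologicalType)
    (be : barlow_evans R X)
    (mu : {measure set (borel (projlim (be_tower be))) -> \bar R}) : Prop :=
  forall i (A : set (borel (FF (be_tower be) i))), measurable A ->
    mu (Phi (be_tower be) i @^-1` A) = be_muF be i A.

Arguments projlim_measure {R X} be mu.

(* Elements of an L^2 space are represented by functions.  The graphs of operators
   below are stable under equality almost everywhere, and the notions of the
   spectrum section see functions only up to distance 0. *)

Record bform (R : realType) (T : Type) := BForm {
  fdom : set (T -> R) ;
  fval : (T -> R) -> (T -> R) -> R }.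

(* An operator on a Hilbert space of (classes of) functions, given by the
   elements and the norm of the space and the graph of the operator. *)
Record operator (R : realType) (T : Type) := Operator {
  op_mem : set (T -> R) ;
  op_norm : (T -> R) -> R ;
  op_graph : (T -> R) -> (T -> R) -> Prop }.

Section spectrum.
Context {R : realType} {T : Type}.
Variable A : operator R T.

(* A - lambda is onto and has a bounded inverse *)
Definition resolvent_set : set R :=
  [set lambda |
    (forall g, op_mem A g ->
       exists f, op_graph A f (fun x => g x + lambda * f x)) /\
    (exists C : R, forall f g, op_graph A f g ->
       op_norm A f <= C * op_norm A (fun x => g x - lambda * f x))].

Definition spectrum : set R := ~` resolvent_set.

Definition eigenspace (lambda : R) : set (T -> R) :=
  [set f | op_graph A f (fun x => lambda * f x)].

(* the eigenspace has dimension n (n = 0 if lambda is not an eigenvalue) *)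
Definition has_multiplicity (lambda : R) (n : nat) : Prop :=
  exists e : 'I_n -> T -> R,
    (forall k, eigenspace lambda (e k)) /\
    (forall f, eigenspace lambda f ->
       exists! c : 'rV[R]_n,
         op_norm A (fun x => f x - \sum_(k < n) c 0 k * e k x) = 0).

End spectrum.

Definition isospectral (R : realType) (T T' : Type)
    (A : operator R T) (A' : operator R T') : Prop :=
  spectrum A = spectrum A' /\
  forall lambda n, has_multiplicity A lambda n <-> has_multiplicity A' lambda n.

Definition direct_sum (R : realType) (J : choiceType) (T : Type)
    (A : J -> operator R T) : operator R (J * T) :=
  let comp (f : J * T -> R) j := fun x => f (j, x) in
  let norm2 f := (\esum_(j in [set: J]) ((op_norm (A j) (comp f j)) ^+ 2)%:E)%E in
  let mem := [set f | (forall j, op_mem (A j) (comp f j)) /\ (norm2 f < +oo)%E] in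
  {| op_mem := mem ;
     op_norm := fun f => Num.sqrt (fine (norm2 f)) ;
     op_graph := fun f g =>
       [/\ mem f, mem g & forall j, op_graph (A j) (comp f j) (comp g j)] |}.

Section closure.
Context {R : realType} d (T : measurableType d).
Variable mu : {measure set T -> \bar R}.

Definition L2 : set (T -> R) := [set f | f \in Lfun mu 2%:E].

Definition L2norm (f : T -> R) : R := fine ('N[mu]_2%:E[EFin \o f])%E.

Definition approximates (E : bform R T) (u : nat -> T -> R) (f : T -> R) : Prop :=
  [/\ forall n, fdom E (u n),
      (fun n => L2norm (fun x => u n x - f x)) @ \oo --> (0 : R)
    & forall e : R, 0 < e -> \forall m & n \near \oo,
        fval E (fun x => u m x - u n x) (fun x => u m x - u n x) < e].

(* the value does not depend on the choice made by get when E is closable *)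
Definition form_closure (E : bform R T) : bform R T :=
  {| fdom := [set f | L2 f /\ exists u, approximates E u f] ;
     fval := fun f h => get [set c : R | exists u v,
       [/\ approximates E u f, approximates E v h
         & (fun n => fval E (u n) (v n)) @ \oo --> c]] |}.

(* f is in the domain and g is its image iff E(f, h) = <g, h> for all h in the
   domain of the form *)
Definition form_operator (E : bform R T) : operator R T :=
  {| op_mem := L2 ;
     op_norm := L2norm ;
     op_graph := fun f g =>
       [/\ fdom E f, L2 g
         & forall h, fdom E h -> fval E f h = \int[mu]_x (g x * h x)] |}.

End closure.

Definition form_restrict (R : realType) (T : Type) (E : bform R T) (Z : set T) :
    bform R T :=
  {| fdom := [set f | fdom E f /\ forall x, Z x -> f x = 0] ; fval := fval E |}.

Definition C0 (R : realType) (X : topologicalType) : set (X -> R) :=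
  [set f | continuous f /\ compact (closure [set x | f x != 0])].

Section forms.
Context {R : realType} {X : ptopologicalType}.
Variables (be : barlow_evans R X) (E0 : bform R X).
Let s := be_tower be.

Fixpoint stage_form (i : nat) : bform R (FF s i) :=
  match i return bform R (FF s i) with
  | 0%N => {| fdom := fdom E0 `&` @C0 R X ; fval := fval E0 |}
  | j.+1 =>
    {| fdom := [set f | C0 f /\
         exists n (u : 'I_n -> FF s j -> R) (h : 'I_n -> GG s j -> R),
           [/\ forall k, fdom (stage_form j) (u k), forall k, continuous (h k)
             & forall x g, f (ppi s j (x, g)) = \sum_(k < n) u k x * h k g]] ;
       fval := fun f h => \int[be_muG be j]_g
         fval (stage_form j) (fun x => f (ppi s j (x, g))) (fun x => h (ppi s j (x, g))) |}
  end.

(* bilinear version of E_oo(Phi_i^* u, Phi_i^* u) = E_i(u, u); the value depends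
   neither on i nor on u, v *)
Definition limit_form : bform R (projlim s) :=
  {| fdom := [set f | exists i u, fdom (stage_form i) u /\ f = u \o Phi s i] ;
     fval := fun f h => get [set c : R | exists i u v,
       [/\ fdom (stage_form i) u, fdom (stage_form i) v,
           f = u \o Phi s i, h = v \o Phi s i
         & c = fval (stage_form i) u v]] |}.

Definition zero_bc_laplacian (mu : {measure set (borel (projlim s)) -> \bar R})
    (Z : set X) : operator R (borel (projlim s)) :=
  form_operator mu
    (form_closure mu (form_restrict limit_form (Phi s 0 @^-1` Z))).

End forms.

Arguments stage_form {R X} be E0 i.
Arguments limit_form {R X} be E0.
Arguments zero_bc_laplacian {R X} be E0 mu Z.

(* [0, l]; the proof of positivity provides the base point *)
Definition itv0 (R : realType) (l : R) (l0 : 0 < l) : Type :=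
  set_type [set` `[0, l]].

Section intervals.
Context {R : realType} (l : R).

HB.instance Definition _ (l0 : 0 < l) :=
  Topological.copy (itv0 l0) (set_type [set` `[0, l]]).

Let itv0_point (l0 : 0 < l) : [set` `[0, l]] (0 : R).
Proof. by rewrite /= in_itv /= lexx ltW. Qed.

HB.instance Definition _ (l0 : 0 < l) :=
  isPointed.Build (itv0 l0) (SigSub (mem_set (itv0_point l0))).

Definition itv0_ends (l0 : 0 < l) : set (itv0 l0) :=
  [set x | set_val x = 0 \/ set_val x = l].

(* Lebesgue measure on ]0, l[, as a measure on R *)
Definition leb : {measure set (measurableTypeR R) -> \bar R} :=
  mrestr (@lebesgue_measure R) (measurable_itv `]0, l[).

(* C^1 functions with compact support in ]0, l[ *)
Definition test_function (h : R -> R) : Prop :=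
  [/\ forall x, derivable h x 1, continuous (derive1 h)
    & closure [set x | h x != 0] `<=` [set` `]0, l[]].

Definition weak_deriv (u v : R -> R) : Prop :=
  forall h, test_function h ->
    \int[leb]_x (u x * derive1 h x) = - \int[leb]_x (v x * h x).

Definition itv0_wderiv (l0 : 0 < l) (u : itv0 l0 -> R) : set (R -> R) :=
  [set v | L2 leb v /\
     exists U : R -> R, [/\ U \o set_val = u, L2 leb U & weak_deriv U v]].

(* int_0^l u' v' dx on H^{1,2}([0, l]); weak derivatives are unique up to a null
   set, so that the choice made by get is irrelevant *)
Definition itv0_form (l0 : 0 < l) : bform R (itv0 l0) :=
  {| fdom := [set u | itv0_wderiv u !=set0] ;
     fval := fun u v =>
       \int[leb]_x (get (itv0_wderiv u) x * get (itv0_wderiv v) x) |}.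

(* -d^2/dx^2 on L^2(]0, l[), with domain H^2 n H^1_0 *)
Definition dirichlet_laplacian : operator R R :=
  {| op_mem := L2 leb ;
     op_norm := L2norm leb ;
     op_graph := fun f g =>
       [/\ L2 leb f, L2 leb g,
           exists u : R -> R, [/\ {within [set` `[0, l]], continuous u},
             u 0 = 0, u l = 0 & ae_eq leb setT f u]
         & exists v : R -> R, [/\ L2 leb v, weak_deriv f v
             & weak_deriv v (fun x => - g x)]] |}.

End intervals.

Arguments itv0_form {R l} l0.
Arguments itv0_ends {R l} l0.

Section fractal_string.
Context {R : realType} (l : nat -> R) (m : nat -> nat).

(* one summand for each of the m i intervals of length l i *)
Definition string_laplacian : operator R ({i : nat & 'I_(m i)} * R) :=
  direct_sum (fun j : {i : nat & 'I_(m i)} => dirichlet_laplacian (l (tag j))).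

Definition string_eigenvalue (p : nat * nat) : R :=
  pi ^+ 2 * p.2.+1%:R ^+ 2 / l p.1 ^+ 2.

Definition string_multiplicity (lambda : R) : nat :=
  \big[addn/0%N]_(p \in [set p | string_eigenvalue p = lambda]) m p.1.

End fractal_string.

(* Main.v *)
Require Import Defs.
From HB Require Import structures.
From mathcomp Require Import all_boot all_order all_algebra finmap.
From mathcomp Require Import all_classical all_reals all_analysis.
From mathcomp Require Import measurable_realfun ring lra zify.
Set Implicit Arguments.
Unset Strict Implicit.
Unset Printing Implicit Defensive.
Import Order.TTheory GRing.Theory Num.Theory.
Import numFieldNormedType.Exports.
Local Open Scope classical_set_scope.
Local Open Scope ring_scope.

(** List the intervals of the string by nonincreasing length: L 0 = l 0, L 1,
    L 2, and so on. The tower starts with [0, L 0], the base branch. Its step k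
    doubles the window ]0, L k.+1[ of the base branch and collapses everything
    else: the fibre has two points, between which a fair coin chooses. The new
    copy of the window together with the rest of the base branch is the k-th
    branch; later steps do not alter it. The limit space is the union of
    the branches, which are curves over [0, L 0], and all of them start at the
    same point; hence it is connected ([projlim_Curve], [projlim_connected]).
    Its measure is the sum of the images of Lebesgue measure on the branches,
    the j-th one with the weight 2^-(j+1) ([tower_measure],
    [stage_measureS]).

    Above a point x, a function on the limit space is a sequence y, with y j its
    value on the j-th branch, which is eventually constant as the windows
    shrink. Expand y in a Haar-like orthonormal system for the weights 2^-(j+1):
    the coefficient 0 is the mean, and the coefficient k.+1 compares the k-th
    branch with the later ones, all of which grow out of the base branch. For x
    outside the window of step k these branches agree and the coefficient
    vanishes, so that the k-th coefficient is a function on ]0, L k[. By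
    Parseval's identity the coefficients form a unitary map from the square
    integrable functions on the limit space onto the direct sum of those on the
    intervals ]0, L k[ ([coef_parseval], [coef_synth]).

    The Haar vectors do not depend on x, so that taking coefficients commutes with
    differentiation along the branches: the energy of a function of the core is
    the sum of the Dirichlet energies of its coefficients ([core_val]), which
    vanish at the ends of their intervals, by the boundary conditions and
    because the branches meet at the ends of the windows.
    Conversely, every finite family of functions of H^1_0(]0, L k[) comes from
    the core ([core_synth]). The closure of such a diagonal form has the direct
    sum of the Dirichlet Laplacians as its operator ([diagonal_graph],
    [limit_laplacian_graph]), and a unitary equivalence preserves spectra and
    multiplicities ([transfer_isospectral]).

    The spectrum of the string itself follows from Duhamel's formula on each
    interval, in terms of the solution s of s'' = - lambda s with s(0) = 0 and
    s'(0) = 1: lambda is an eigenvalue on ]0, L[ exactly when s(L) = 0, and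
    otherwise in the resolvent set. The bounds on the inverses are uniform
    because all but finitely many intervals are short
    ([string_resolvent], [string_multiplicity_card]). *)

(** * Square integrable functions *)

Section almost_everywhere.
Context {R : realType} d (T : measurableType d).
Variable mu : {measure set T -> \bar R}.

(** Instances of the filter lemmas with explicit predicates, which unify without
    unfolding the measure. *)
Lemma ae_imp (P Q : T -> Prop) : (forall x, P x -> Q x) ->
  (\forall x \ae mu, P x) -> \forall x \ae mu, Q x.
Proof. exact: filterS. Qed.

Lemma ae_imp2 (P Q S : T -> Prop) : (forall x, P x -> Q x -> S x) ->
  (\forall x \ae mu, P x) -> (\forall x \ae mu, Q x) -> \forall x \ae mu, S x.
Proof. exact: filterS2. Qed.

End almost_everywhere.

Section square_integrable.
Context {R : realType} d (T : measurableType d).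
Variable mu : {measure set T -> \bar R}.
Implicit Types f g h : T -> R.

Definition inner f g : R := \int[mu]_x (f x * g x).

Lemma L2_measurable f : L2 mu f -> measurable_fun setT f.
Proof. by rewrite /L2 /= inE => /andP[]; rewrite inE. Qed.

Lemma L2_sqr_integrable f : L2 mu f ->
  mu.-integrable setT (EFin \o (fun x => f x ^+ 2)).
Proof. exact: Lfun2_integrable_sqr. Qed.

Let Lnorm2E f : ('N[mu]_2%:E[EFin \o f] `^ 2 = \int[mu]_x (f x ^+ 2)%:E)%E.
Proof.
rewrite powR_Lnorm ?pnatr_eq0//; apply: eq_integral => x _ /=.
by rewrite powR_mulrn// real_normK// num_real.
Qed.

Lemma L2P f : measurable_fun setT f ->
  (\int[mu]_x (f x ^+ 2)%:E < +oo)%E -> L2 mu f.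
Proof.
move=> mf fi; rewrite /L2 /= inE; apply/andP; split; rewrite inE //=.
by rewrite /finite_norm (@lty_poweRy _ _ 2) ?pnatr_eq0// Lnorm2E.
Qed.

(** If the integral is infinite, both sides are 0, as [fine] maps +oo to 0. *)
Lemma L2norm_sqr f : L2norm mu f ^+ 2 = \int[mu]_x (f x ^+ 2).
Proof.
rewrite /L2norm /Rintegral -Lnorm2E.
case: ('N[mu]_2%:E[_])%E (Lnorm_ge0 mu 2%:E (EFin \o f)) => [r| |] //=.
- by rewrite lee_fin => r0; rewrite powR_mulrn.
- by rewrite pnatr_eq0 /= expr0n.
Qed.

Lemma L2norm_ge0 f : 0 <= L2norm mu f.
Proof. by rewrite /L2norm fine_ge0// Lnorm_ge0. Qed.

Lemma inner_sqr f : inner f f = L2norm mu f ^+ 2.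
Proof. by rewrite L2norm_sqr /inner; apply: eq_Rintegral => x _; rewrite expr2. Qed.


Lemma L2_0 : L2 mu (cst 0).
Proof. by apply: L2P => //=; under eq_integral do rewrite expr0n /=; rewrite integral0. Qed.

Lemma inner_integrable f g : L2 mu f -> L2 mu g ->
  mu.-integrable setT (EFin \o (fun x => f x * g x)).
Proof. by move=> f2 g2; apply/Lfun1_integrable; exact: Lfun2_mul_Lfun1. Qed.

Lemma L2P_integrable f : measurable_fun setT f ->
  mu.-integrable setT (EFin \o (fun x => f x ^+ 2)) -> L2 mu f.
Proof.
move=> mf /integrableP[_ fi]; apply: L2P => //.
by under eq_integral do rewrite -[_%:E]gee0_abs ?lee_fin ?sqr_ge0//.
Qed.

Lemma L2D f g : L2 mu f -> L2 mu g -> L2 mu (fun x => f x + g x).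
Proof.
move=> f2 g2; apply: L2P_integrable.
  by apply: measurable_funD; exact: L2_measurable.
rewrite (_ : _ \o _ = (fun x => (f x ^+ 2)%:E + ((2 * (f x * g x))%:E + (g x ^+ 2)%:E))%E).
  apply: integrableD => //; first exact: L2_sqr_integrable.
  apply: integrableD => //; last exact: L2_sqr_integrable.
  under eq_fun do rewrite EFinM.
  by apply: integrableZl => //; exact: inner_integrable.
by apply/funext => x /=; rewrite -!EFinD; congr EFin; ring.
Qed.

Lemma L2Z c f : L2 mu f -> L2 mu (fun x => c * f x).
Proof.
move=> f2; apply: L2P_integrable.
  by apply: measurable_funM => //; exact: L2_measurable.
rewrite (_ : _ \o _ = (fun x => (c ^+ 2)%:E * (f x ^+ 2)%:E)%E).
  by apply: integrableZl => //; exact: L2_sqr_integrable.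
by apply/funext => x /=; rewrite exprMn EFinM.
Qed.

Lemma L2B f g : L2 mu f -> L2 mu g -> L2 mu (fun x => f x - g x).
Proof.
move=> f2 g2; under eq_fun do rewrite -mulN1r.
by apply: L2D => //; exact: L2Z.
Qed.

Lemma innerC f g : inner f g = inner g f.
Proof. by apply: eq_Rintegral => x _; rewrite mulrC. Qed.

Lemma innerDl f g h : L2 mu f -> L2 mu g -> L2 mu h ->
  inner (fun x => f x + g x) h = inner f h + inner g h.
Proof.
move=> f2 g2 h2; rewrite /inner -RintegralD//; [|exact: inner_integrable..].
by apply: eq_Rintegral => x _; rewrite mulrDl.
Qed.

Lemma innerZl c f h : L2 mu f -> L2 mu h ->
  inner (fun x => c * f x) h = c * inner f h.
Proof.
move=> f2 h2; rewrite /inner -RintegralZl//; last exact: inner_integrable.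
by apply: eq_Rintegral => x _; rewrite mulrA.
Qed.

Lemma innerDr f g h : L2 mu f -> L2 mu g -> L2 mu h ->
  inner h (fun x => f x + g x) = inner h f + inner h g.
Proof. by move=> *; rewrite innerC innerDl// !(innerC h). Qed.

Lemma innerZr c f h : L2 mu f -> L2 mu h ->
  inner h (fun x => c * f x) = c * inner h f.
Proof. by move=> *; rewrite innerC innerZl// (innerC h). Qed.

Lemma innerBl f g h : L2 mu f -> L2 mu g -> L2 mu h ->
  inner (fun x => f x - g x) h = inner f h - inner g h.
Proof.
move=> f2 g2 h2; rewrite -mulN1r -innerZl// -innerDl//; last exact: L2Z.
by apply: eq_Rintegral => x _; rewrite mulN1r.
Qed.

Lemma innerBr f g h : L2 mu f -> L2 mu g -> L2 mu h ->
  inner h (fun x => f x - g x) = inner h f - inner h g.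
Proof. by move=> *; rewrite innerC innerBl// !(innerC h). Qed.

Lemma L2normZ c f : L2 mu f -> L2norm mu (fun x => c * f x) = `|c| * L2norm mu f.
Proof.
move=> f2; apply/eqP; rewrite -(@eqrXn2 _ 2)// ?L2norm_ge0 ?mulr_ge0 ?L2norm_ge0//.
rewrite exprMn -!inner_sqr innerZl ?innerZr//; last exact: L2Z.
by rewrite real_normK ?num_real// expr2 mulrA.
Qed.

Lemma L2normN f : L2norm mu (fun x => - f x) = L2norm mu f.
Proof.
apply/eqP; rewrite -(@eqrXn2 _ 2)// ?L2norm_ge0//.
by rewrite !L2norm_sqr; apply/eqP/eq_Rintegral => x _; rewrite sqrrN.
Qed.

Lemma L2normBC f g : L2norm mu (fun x => f x - g x) = L2norm mu (fun x => g x - f x).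
Proof. by rewrite -L2normN; congr L2norm; apply/funext => x; rewrite opprB. Qed.

Lemma cauchy_schwarz f g : L2 mu f -> L2 mu g ->
  `|inner f g| <= L2norm mu f * L2norm mu g.
Proof.
move=> f2 g2; rewrite -(@ler_pXn2r _ 2) ?nnegrE ?mulr_ge0 ?L2norm_ge0//.
rewrite real_normK ?num_real// exprMn -!inner_sqr.
set a := inner f f; set b := inner f g; set c := inner g g.
have a0 : 0 <= a by rewrite /a inner_sqr sqr_ge0.
have c0 : 0 <= c by rewrite /c inner_sqr sqr_ge0.
(* the quadratic polynomial t |-> |f + t g|^2 is nonnegative *)
have q t : 0 <= a + 2 * t * b + t ^+ 2 * c.
  rewrite (_ : _ + _ = inner (fun x => f x + t * g x) (fun x => f x + t * g x)).
    by rewrite inner_sqr sqr_ge0.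
  have tg2 := L2Z t g2; have s2 := L2D f2 tg2.
  rewrite innerDl// !innerDr// !innerZl// ?innerZr// (innerC g f) -/a -/b -/c; ring.
have [c1|c1] := eqVneq c 0.
  rewrite c1 mulr0; move: (q (- (a + 1) / (2 * b))); rewrite c1 mulr0 addr0.
  have [->|b0] := eqVneq b 0; first by rewrite expr0n.
  rewrite (_ : 2 * _ * b = - (a + 1)); first by lra.
  by field.
have cp : 0 < c by rewrite lt_neqAle eq_sym c1.
move: (q (- b / c)); rewrite -(pmulr_rge0 _ cp).
rewrite (_ : c * _ = a * c - b ^+ 2) ?subr_ge0//.
by field.
Qed.

Lemma L2norm0 : L2norm mu (cst 0) = 0.
Proof.
apply/eqP; rewrite -sqrf_eq0 L2norm_sqr; apply/eqP.
by under eq_Rintegral do rewrite expr0n /=; rewrite Rintegral_cst// mul0r.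
Qed.

Lemma L2norm_triangle f g : L2 mu f -> L2 mu g ->
  L2norm mu (fun x => f x + g x) <= L2norm mu f + L2norm mu g.
Proof.
move=> f2 g2; rewrite -(@ler_pXn2r _ 2) ?nnegrE ?addr_ge0 ?L2norm_ge0//.
have fg2 := L2D f2 g2.
rewrite -inner_sqr innerDl// !innerDr// (innerC g f) !inner_sqr.
have := le_trans (ler_norm _) (cauchy_schwarz f2 g2); nra.
Qed.

Lemma L2normB_triangle f g h : L2 mu f -> L2 mu g -> L2 mu h ->
  L2norm mu (fun x => f x - h x) <=
  L2norm mu (fun x => f x - g x) + L2norm mu (fun x => g x - h x).
Proof.
move=> f2 g2 h2; rewrite (_ : (fun x => f x - h x) = (fun x => (f x - g x) + (g x - h x))).
  by apply: L2norm_triangle; exact: L2B.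
by apply/funext => x; ring.
Qed.

Lemma ae_eq_Rintegral f g : measurable_fun setT f -> measurable_fun setT g ->
  ae_eq mu setT f g -> \int[mu]_x f x = \int[mu]_x g x.
Proof.
move=> mf mg fg; rewrite /Rintegral; congr fine; apply: ae_eq_integral => //.
- exact/measurable_EFinP.
- exact/measurable_EFinP.
- by apply: filterS fg => x /[apply] /= ->.
Qed.

Lemma ae_eq_inner f f' g g' : measurable_fun setT f -> measurable_fun setT g ->
  measurable_fun setT f' -> measurable_fun setT g' ->
  ae_eq mu setT f f' -> ae_eq mu setT g g' -> inner f g = inner f' g'.
Proof.
move=> mf mg mf' mg' ff gg; apply: ae_eq_Rintegral; [exact: measurable_funM..|].
by apply: filterS2 ff gg => x + + _ => /(_ I) -> /(_ I) ->.
Qed.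

Lemma ae_eq_L2norm f g : measurable_fun setT f -> measurable_fun setT g ->
  ae_eq mu setT f g -> L2norm mu f = L2norm mu g.
Proof.
move=> mf mg fg; apply/eqP; rewrite -(@eqrXn2 _ 2)// ?L2norm_ge0//.
by rewrite -!inner_sqr (ae_eq_inner (f' := g) (g' := g)).
Qed.

Lemma ae_eq_L2 f g : measurable_fun setT g ->
  ae_eq mu setT f g -> L2 mu f -> L2 mu g.
Proof.
move=> mg fg f2; apply: L2P => //; have mf := L2_measurable f2.
rewrite (ae_eq_integral (fun x => (f x ^+ 2)%:E))//.
- have := integrableP _ _ _ (L2_sqr_integrable f2) => -[_].
  by under eq_integral do rewrite /= ger0_norm ?sqr_ge0//.
- by apply/measurable_EFinP; exact: measurable_funX.
- by apply/measurable_EFinP; exact: measurable_funX.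
- by apply: filterS fg => x /[apply] /= ->.
Qed.

Lemma L2norm_eq0 f : L2 mu f -> L2norm mu f = 0 -> ae_eq mu setT f (cst 0).
Proof.
move=> f2 f0; have mf := L2_measurable f2.
have /integrableP[mf2 fi] := L2_sqr_integrable f2.
have : (\int[mu]_x `|(f x ^+ 2)%:E| = 0)%E.
  have absE : (\int[mu]_x `|(f x ^+ 2)%:E| = \int[mu]_x (f x ^+ 2)%:E)%E.
    by apply: eq_integral => x _; rewrite gee0_abs// lee_fin sqr_ge0.
  have := L2norm_sqr f; rewrite f0 expr0n /= /Rintegral absE.
  move: fi; rewrite absE.
  have : (0 <= \int[mu]_x (f x ^+ 2)%:E)%E.
    by apply: integral_ge0 => x _; rewrite lee_fin sqr_ge0.
  by case: (\int[mu]_x _)%E => [r| |] //= _ _ <-.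
move/(ae_eq_integral_abs mu measurableT mf2).
by apply: filterS => x /[apply] -[] /eqP; rewrite sqrf_eq0 => /eqP.
Qed.

Lemma ae_eq_L2norm0 f g : measurable_fun setT f -> measurable_fun setT g ->
  ae_eq mu setT f g -> L2norm mu (fun x => f x - g x) = 0.
Proof.
move=> mf mg fg; rewrite (@ae_eq_L2norm _ (cst 0))//.
- by rewrite /L2norm (_ : _ \o _ = cst 0%E)// Lnorm0 ?pnatr_eq0 // eqe pnatr_eq0.
- exact: measurable_funB.
- by apply: filterS fg => x /[apply] ->; rewrite subrr.
Qed.

Lemma L2_dist_ae f g : L2 mu f -> L2 mu g ->
  L2norm mu (fun x => f x - g x) = 0 -> ae_eq mu setT f g.
Proof.
move=> f2 g2 /(L2norm_eq0 (L2B f2 g2)).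
by apply: filterS => x /[apply] /eqP; rewrite subr_eq0 => /eqP.
Qed.

Lemma cvg_inner (u : nat -> T -> R) f g : (forall n, L2 mu (u n)) -> L2 mu f ->
  L2 mu g -> (fun n => L2norm mu (fun x => u n x - f x)) @ \oo --> (0 : R) ->
  (fun n => inner (u n) g) @ \oo --> inner f g.
Proof.
move=> u2 f2 g2 uf; apply/cvgrPdist_le => e e0.
have g1 : 0 < L2norm mu g + 1 by rewrite ltr_pwDr ?L2norm_ge0.
have /cvgrPdist_le/(_ _ (divr_gt0 e0 g1)) := uf.
apply: filterS => n; rewrite sub0r normrN ger0_norm ?L2norm_ge0// => un.
rewrite -innerBl// (le_trans (cauchy_schwarz _ g2))//; first exact: L2B.
rewrite L2normBC; move: un; rewrite ler_pdivlMr//; apply: le_trans.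
by rewrite ler_wpM2l ?L2norm_ge0// lerDl.
Qed.

End square_integrable.

Lemma dominated_cvg_Rintegral {R : realType} d (T : measurableType d)
    (mu : {measure set T -> \bar R}) (u : nat -> T -> R) (f g : T -> R) :
  (forall n, measurable_fun setT (u n)) ->
  (forall x, u ^~ x @ \oo --> f x) ->
  mu.-integrable setT (EFin \o g) -> (forall n x, `|u n x| <= g x) ->
  (fun n => \int[mu]_x u n x) @ \oo --> \int[mu]_x f x.
Proof.
move=> mu_ uf ig ug.
have mf : measurable_fun setT f by apply: measurable_fun_cvg mu_ _ => x _; exact: uf.
have [||//|||if_ _ H] := @dominated_convergence _ _ _ mu setT measurableT
    (fun n x => (u n x)%:E) (fun x => (f x)%:E) (EFin \o g).
- by move=> n; exact/measurable_EFinP.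
- exact/measurable_EFinP.
- by apply: aeW => x _; apply: cvg_EFin; [exact: nearW|exact: uf].
- exact: ig.
- by apply: aeW => x n _ /=; rewrite lee_fin.
by apply: fine_cvg; rewrite fineK//; exact: integrable_fin_num.
Qed.

Lemma limn_einf_le {R : realType} (u : (\bar R)^nat) (c : \bar R) :
  (forall n, (u n <= c)%E) -> (limn_einf u <= c)%E.
Proof.
move=> uc; rewrite limn_einf_lim; apply: lime_le; first exact: is_cvg_einfs.
by apply: nearW => n; apply: le_trans (uc n); apply: ereal_inf_lbound; exists n => /=.
Qed.

Section completeness.
Context {R : realType} d (T : measurableType d).
Variable mu : {measure set T -> \bar R}.
Hypothesis mu_fin : (mu setT < +oo)%E.

Lemma L2_cst (c : R) : L2 mu (cst c).
Proof.
apply: L2P => //; rewrite (integral_cst mu measurableT (c ^+ 2)%:E).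
by rewrite lte_mul_pinfty// lee_fin sqr_ge0.
Qed.

Lemma L2_integrable f : L2 mu f -> mu.-integrable setT (EFin \o f).
Proof.
move=> f2; have := inner_integrable f2 (L2_cst 1).
by apply: eq_integrable => // x _ /=; rewrite mulr1.
Qed.

(** The Cauchy-Schwarz inequality against the constant 1. *)
Lemma L2_norm_integral f : L2 mu f ->
  \int[mu]_x `|f x| <= L2norm mu f * L2norm mu (cst 1).
Proof.
move=> f2.
have af2 : L2 mu (fun x => `|f x|).
  apply: L2P_integrable.
    by apply: measurableT_comp => //; exact: L2_measurable f2.
  apply: eq_integrable (L2_sqr_integrable f2) => // x _ /=.
  by rewrite real_normK// num_real.
have := cauchy_schwarz af2 (L2_cst 1).
rewrite (_ : L2norm mu (fun x => `|f x|) = L2norm mu f); last first.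
  apply/eqP; rewrite -(@eqrXn2 _ 2)// ?L2norm_ge0// !L2norm_sqr; apply/eqP/eq_Rintegral => x _.
  by rewrite real_normK// num_real.
apply: le_trans; apply: le_trans (ler_norm _).
by rewrite le_eqVlt; apply/orP; left; apply/eqP/eq_Rintegral => x _; rewrite mulr1.
Qed.

(** Riesz-Fischer: along a subsequence with summable increments the sequence
    converges almost everywhere, and the pointwise limit is the limit in norm
    by Fatou's lemma. *)
Lemma L2_complete (u : nat -> T -> R) : (forall n, L2 mu (u n)) ->
  (forall e : R, 0 < e -> exists N, forall m n, (N <= m)%N -> (N <= n)%N ->
     L2norm mu (fun x => u m x - u n x) <= e) ->
  exists2 f, L2 mu f & (fun n => L2norm mu (fun x => u n x - f x)) @ \oo --> (0 : R).
Proof.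
move=> u2 uC.
have /choice[nu nuP] : forall k : nat, exists N, forall m n, (N <= m)%N -> (N <= n)%N ->
    L2norm mu (fun x => u m x - u n x) <= (2^-1) ^+ k.
  by move=> k; apply: uC; rewrite exprn_gt0.
pose nn k := (\sum_(i < k.+1) nu i)%N.
have nu_nn k : (nu k <= nn k)%N by rewrite /nn big_ord_recr /= leq_addl.
have nn_nn k : (nn k <= nn k.+1)%N by rewrite /nn [leqRHS]big_ord_recr /= leq_addr.
pose v k := u (nn k).
have v2 k : L2 mu (v k) by exact: u2.
(* v is a subsequence whose increments have norm at most 2^-k; g is their sum *)
pose D (k : nat) (x : T) : R := `|v k.+1 x - v k x|.
have mD k : measurable_fun setT (D k).
  apply: measurableT_comp => //.
  by apply: measurable_funB; exact: L2_measurable (v2 _).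
have D0 k x : (0 <= (D k x)%:E)%E by rewrite lee_fin normr_ge0.
pose g (x : T) : \bar R := (\sum_(0 <= k <oo) (D k x)%:E)%E.
have mg : measurable_fun setT g.
  by apply: ge0_emeasurable_sum => // k _; exact/measurable_EFinP.
pose C := L2norm mu (cst 1).
have C0 : 0 <= C by exact: L2norm_ge0.
have intD k : (\int[mu]_x (D k x)%:E <= ((2^-1) ^+ k * C)%:E)%E.
  have vv2 := L2B (v2 k.+1) (v2 k).
  have iD : mu.-integrable setT (fun x => (D k x)%:E).
    by have := integrable_abse (L2_integrable vv2).
  have -> : (\int[mu]_x (D k x)%:E = (\int[mu]_x D k x)%:E)%E.
    by rewrite /Rintegral fineK// integrable_fin_num.
  rewrite lee_fin (le_trans (L2_norm_integral vv2))// ler_wpM2r//.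
  by apply: nuP; [exact: leq_trans (nn_nn _)|].
have intg : (\int[mu]_x g x < +oo)%E.
  rewrite /g integral_nneseries//; last by move=> k; exact/measurable_EFinP.
  have geo : cvgn (series (geometric C (2^-1 : R))).
    by apply: is_cvg_geometric_series; rewrite gtr0_norm ?invf_lt1 ?ltr1n.
  apply: (@le_lt_trans _ _ (\sum_(0 <= k <oo) (C * (2^-1) ^+ k)%:E)%E).
    apply: lee_nneseries => k *; last by rewrite mulrC.
    by apply: integral_ge0 => x _; exact: D0.
  rewrite (_ : (\sum_(0 <= k <oo) _)%E = (limn (series (geometric C (2^-1 : R))))%:E) ?ltry//.
  rewrite -EFin_lim//; congr (limn _); apply/funext => n /=.
  by rewrite sumEFin.
pose A := [set x | (g x < +oo)%E].
have mA : measurable A.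
  by have := emeasurable_fun_infty_o measurableT mg +oo%E; rewrite setTI.
have g0 x : (0 <= g x)%E by exact: nneseries_ge0.
have aeA : \forall x \ae mu, A x.
  have ig : mu.-integrable setT g.
    apply/integrableP; split => //.
    by under eq_integral do rewrite gee0_abs//.
  apply: filterS (integrable_ae measurableT ig) => x /(_ I).
  by rewrite ge0_fin_numE.
pose h k x := v k x * \1_A x.
have mh k : measurable_fun setT (h k).
  by apply: measurable_funM => //; exact: L2_measurable (v2 k).
have hcvg x : cvgn (h ^~ x).
  have [Ax|nAx] := pselect (A x); last first.
    rewrite (_ : h ^~ x = cst 0); first exact: is_cvg_cst.
    by apply/funext => k; rewrite /h indicE memNset// mulr0.
  have hE : h ^~ x = (fun n => h 0%N x + series (fun k => v k.+1 x - v k x) n).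
    apply/funext => n; rewrite /h indicE mem_set// !mulr1 /series /= telescope_sumr//.
    by rewrite addrC subrK.
  rewrite hE; apply: is_cvgD; first exact: is_cvg_cst.
  apply: normed_cvg.
  by apply: nnseries_is_cvg => // i; exact: normr_ge0.
pose V (x : T) : R := limn (h ^~ x).
have hV x : h ^~ x @ \oo --> V x by exact: hcvg.
have mV : measurable_fun setT V by apply: measurable_fun_cvg mh _ => x _; exact: hV.
(* Fatou along the subsequence: the distance from u n to V is at most 2^-K *)
have key n K : (forall k, (K <= k)%N -> (nu K <= n)%N ->
    (\int[mu]_x ((u n x - h k x) ^+ 2)%:E <= (((2^-1) ^+ K) ^+ 2)%:E)%E).
  move=> k Kk nKn.
  have unv2 := L2B (u2 n) (v2 k).
  rewrite (ae_eq_integral (fun x => ((u n x - v k x) ^+ 2)%:E))//.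
  - rewrite -[leLHS]fineK; last by apply: integrable_fin_num => //; exact: L2_sqr_integrable unv2.
    rewrite lee_fin -/(Rintegral _ _ _) -L2norm_sqr lerXn2r ?nnegrE ?L2norm_ge0 ?exprn_ge0//.
    apply: nuP => //; apply: leq_trans (nu_nn K) _.
    elim: k Kk {unv2} => [|k IH]; first by rewrite leqn0 => /eqP ->.
    by rewrite leq_eqVlt ltnS => /predU1P[->//|/IH /leq_trans]; apply.
  - apply/measurable_EFinP; apply: measurable_funX; apply: measurable_funB => //.
    exact: L2_measurable (u2 _).
  - apply/measurable_EFinP; apply: measurable_funX; apply: measurable_funB; [exact: L2_measurable (u2 _)|exact: L2_measurable (v2 k)].
  - by apply: filterS aeA => x Ax _; rewrite /h indicE mem_set// mulr1.
have keyV n K : (nu K <= n)%N ->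
    (\int[mu]_x ((u n x - V x) ^+ 2)%:E <= (((2^-1) ^+ K) ^+ 2)%:E)%E.
  move=> Kn.
  rewrite (_ : (\int[mu]_x _)%E = \int[mu]_x limn_einf (fun k => ((u n x - h (k + K)%N x) ^+ 2)%:E))%E.
    apply: le_trans (fatou mu measurableT _ _) _.
    - move=> k; apply/measurable_EFinP; apply: measurable_funX; apply: measurable_funB => //.
      exact: L2_measurable (u2 _).
    - by move=> k x _; rewrite lee_fin sqr_ge0.
    - by apply: limn_einf_le => k; apply: key => //; exact: leq_addl.
  apply: eq_integral => x _.
  have cx : ((u n x - h (k + K)%N x) ^+ 2)%:E @[k --> \oo] --> ((u n x - V x) ^+ 2)%:E.
    apply: cvg_EFin; first exact: nearW.
    have c1 : (fun k => u n x - h (k + K)%N x) @ \oo --> u n x - V x.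
      apply: cvgB; first exact: cvg_cst.
      by have := hV x; rewrite -(cvg_shiftn K).
    exact: (cvg_comp _ _ c1 (@exprn_continuous _ 2%N _)).
  by have [-> _] := cvg_limn_einf_sup cx.
have V2 : L2 mu V.
  pose n0 := nu 0%N.
  have unV2 : L2 mu (fun x => u n0 x - V x).
    apply: L2P; first by apply: measurable_funB => //; exact: L2_measurable (u2 _).
    by apply: le_lt_trans (keyV n0 0%N _) _; rewrite ?ltry.
  rewrite (_ : V = fun x => u n0 x - (u n0 x - V x)); first exact: L2B.
  by apply/funext => x; rewrite opprB addrC subrK.
exists V => //; apply/cvgrPdist_le => e e0.
have [K Ke] : exists K, (2^-1 : R) ^+ K <= e.
  have /cvgrPdist_le/(_ e e0) : geometric 1 (2^-1 : R) @ \oo --> (0 : R).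
    by apply: cvg_geometric; rewrite gtr0_norm ?invf_lt1 ?ltr1n.
  move=> -[K _ /(_ K)] /=; rewrite sub0r normrN mul1r ger0_norm ?exprn_ge0// => KK.
  by exists K; exact: KK.
exists (nu K) => // n /= Kn; rewrite sub0r normrN ger0_norm ?L2norm_ge0//.
apply: le_trans Ke; rewrite -(@ler_pXn2r _ 2) ?nnegrE ?L2norm_ge0 ?exprn_ge0//.
rewrite -lee_fin L2norm_sqr /Rintegral fineK; first exact: keyV.
by apply: integrable_fin_num => //; exact: L2_sqr_integrable (L2B (u2 n) V2).
Qed.

End completeness.

(** * Absolutely continuous functions on an interval *)

Lemma measurable_bool_natr {R : realType} d (T : measurableType d) (b : T -> bool) :
  measurable_fun setT b -> measurable_fun setT (fun x => (b x)%:R : R).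
Proof. by move=> mb; apply: (@measurableT_comp _ _ _ _ _ _ (fun b : bool => b%:R : R)). Qed.

Lemma measurable_ler_natr {R : realType} d (T : measurableType d) (f g : T -> R) :
  measurable_fun setT f -> measurable_fun setT g ->
  measurable_fun setT (fun x => (f x <= g x)%R%:R : R).
Proof. by move=> mf mg; apply: measurable_bool_natr; exact: measurable_fun_ler. Qed.

(** The restriction of v to t <= x, by multiplication: this keeps all the integrals
    over the whole line, whatever x is. *)
Definition cut {R : realType} (v : R -> R) (x t : R) : R := v t * (t <= x)%R%:R.

Definition prim {R : realType} (mu : {measure set (measurableTypeR R) -> \bar R})
  (v : R -> R) (x : R) : R := \int[mu]_t cut v x t.

Lemma measurable_cut {R : realType} (v : R -> R) x :
  measurable_fun setT v -> measurable_fun setT (cut v x).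
Proof. by move=> mv; apply: measurable_funM => //; exact: measurable_ler_natr. Qed.

Lemma cut_norm_le {R : realType} (v : R -> R) x t : `|cut v x t| <= `|v t|.
Proof. by rewrite /cut; case: (t <= x)%R; rewrite ?mulr1// mulr0 normr0. Qed.

Section triangle.
Context {R : realType}.
Variable mu : {finite_measure set (measurableTypeR R) -> \bar R}.
Hypothesis mu1 : forall x, mu [set x] = 0%E.
Implicit Types v w : R -> R.

Lemma finite_measure_lty : (mu setT < +oo)%E.
Proof. by rewrite -ge0_fin_numE// fin_num_measure. Qed.
Let mu_fin := finite_measure_lty.

Lemma L2_cut v x : L2 mu v -> L2 mu (cut v x).
Proof.
move=> v2; have mv := L2_measurable v2; apply: L2P; first exact: measurable_cut.
apply: le_lt_trans (integrable_lty measurableT (L2_sqr_integrable v2)).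
apply: ge0_le_integral => //.
- by move=> t _; rewrite lee_fin sqr_ge0.
- by apply/measurable_EFinP; apply: measurable_funX; exact: measurable_cut.
- by apply/measurable_EFinP; exact: measurable_funX.
- move=> t _; rewrite lee_fin -[leLHS]real_normK ?num_real// -[leRHS]real_normK ?num_real//.
  by rewrite lerXn2r ?nnegrE// cut_norm_le.
Qed.

Lemma triangle_integrable v w : L2 mu v -> L2 mu w ->
  (mu \x mu)%E.-integrable setT (fun z : R * R => (v z.1 * cut w z.1 z.2)%:E).
Proof.
move=> v2 w2.
have mv := L2_measurable v2; have mw := L2_measurable w2.
have iv := L2_integrable mu_fin v2; have iw := L2_integrable mu_fin w2.
have mF : measurable_fun setT (fun z : R * R => (v z.1 * cut w z.1 z.2)%:E).
  apply/measurable_EFinP; apply: measurable_funM; first exact: measurableT_comp.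
  by apply: measurable_funM; [exact: measurableT_comp|exact: measurable_ler_natr].
apply/(integrable12ltyP mu mu) => //.
apply: (@le_lt_trans _ _ (\int[mu]_x (`|v x|%:E * \int[mu]_y `|w y|%:E))%E).
  apply: ge0_le_integral => //.
  - by move=> x _; apply: integral_ge0.
  - apply: (@measurable_fun_fubini_tonelli_F _ _ _ _ _ mu
      (fun z : R * R => `|(v z.1 * cut w z.1 z.2)%:E|%E)) => //.
    by apply: measurableT_comp => //; exact/measurable_EFinP.
  - by apply/emeasurable_funM => //; apply/measurable_EFinP; exact: measurableT_comp.
  - move=> x _ /=; rewrite -ge0_integralZl//; last first.
      by apply/measurable_EFinP; exact: measurableT_comp.
    apply: ge0_le_integral => //.
    + apply/measurable_EFinP; apply: measurableT_comp => //.
      by apply: measurable_funM => //; exact: measurable_cut.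
    + apply: emeasurable_funM => //; apply/measurable_EFinP; exact: measurableT_comp.
    + by move=> y _; rewrite /= normrM lee_fin ler_wpM2l// cut_norm_le.
have fw : (\int[mu]_y `|w y|%:E < +oo)%E by have /integrableP[_] := iw.
have fw0 : (0 <= \int[mu]_y `|w y|%:E)%E by exact: integral_ge0.
rewrite ge0_integralZr//; last by apply/measurable_EFinP; exact: measurableT_comp.
apply: lte_mul_pinfty => //; first exact: integral_ge0.
by rewrite ge0_fin_numE ?integral_ge0//; have /integrableP[_] := iv.
Qed.

Let fE f : mu.-integrable setT (fun t => (f t)%:E) ->
  (\int[mu]_t (f t)%:E = (\int[mu]_t f t)%:E)%E.
Proof. by move=> fi; rewrite /Rintegral fineK// integrable_fin_num. Qed.

Let cutI v s : L2 mu v -> mu.-integrable setT (fun t => (cut v s t)%:E).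
Proof. by move=> v2; exact: L2_integrable (L2_cut s v2). Qed.

Lemma mul_prim_integrable v w : L2 mu v -> L2 mu w ->
  mu.-integrable setT (EFin \o (fun s => v s * prim mu w s)).
Proof.
move=> v2 w2; apply: eq_integrable (integrable_fubini_F (triangle_integrable v2 w2)) => // s _.
rewrite /fubini_F /=; under eq_integral do rewrite EFinM.
by rewrite integralZl ?fE// ?EFinM//; exact: cutI.
Qed.

(** Integration by parts for two primitives: Fubini on the triangle t <= s, whose
    sides are null sets as the measure has no atoms. *)
Lemma triangle_by_parts v w : L2 mu v -> L2 mu w ->
  \int[mu]_s (v s * prim mu w s) =
  (\int[mu]_s v s) * (\int[mu]_t w t) - \int[mu]_t (w t * prim mu v t).
Proof.
move=> v2 w2.
have mv := L2_measurable v2; have mw := L2_measurable w2.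
have iv := L2_integrable mu_fin v2; have iw := L2_integrable mu_fin w2.
have iwV : mu.-integrable setT (EFin \o (fun t => w t * \int[mu]_s v s)).
  by rewrite /comp; under eq_fun do rewrite EFinM; exact: integrableZr.
rewrite [X in _ = X - _]mulrC -RintegralZr// -RintegralB//; last exact: mul_prim_integrable.
apply: (@congr1 _ _ fine (\int[mu]_s (v s * prim mu w s)%:E)%E
  (\int[mu]_t (w t * \int[mu]_s v s - w t * prim mu v t)%:E)%E).
have := Fubini (triangle_integrable v2 w2).
rewrite /=; under eq_integral => s _.
  under eq_integral do rewrite EFinM.
  rewrite integralZl//; last exact: cutI.
  rewrite fE; last exact: cutI.
  rewrite -EFinM; over.
move=> ->; apply: eq_integral => t _.
have iB : mu.-integrable setT (fun s => (v s - cut v t s)%:E).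
  by under eq_fun do rewrite EFinB; apply: integrableB => //; exact: cutI.
rewrite -mulrBr EFinM -RintegralB//; last exact: cutI.
rewrite -fE// -integralZl//.
apply: ae_eq_integral => //.
- apply/measurable_EFinP; apply: measurable_funM => //.
  by apply: measurable_funM => //; exact: measurable_ler_natr.
- apply/measurable_EFinP; apply: measurable_funM => //; apply: measurable_funB => //.
  exact: measurable_cut.
- exists [set t]; split => // [|x /=]; first exact: mu1.
  apply: contra_notP => xt _; rewrite /cut /= -EFinM; congr EFin.
  have [tx|xt'|/esym//] := ltrgtP t x.
  + by rewrite mulr1 mulr0 subr0 mulrC.
  + by rewrite mulr0 mulr1 subrr !mulr0.
Qed.

End triangle.

Section leb_measure.
Context {R : realType}.
Implicit Types (l : R) (v w : R -> R).

Lemma lebE l A : leb l A = lebesgue_measure (A `&` `]0, l[).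
Proof. by []. Qed.

Lemma leb_le l A : measurable A -> (leb l A <= lebesgue_measure A)%E.
Proof. by move=> mA; rewrite lebE le_measure ?inE//; exact: measurableI. Qed.

Lemma leb_setT l : 0 < l -> leb l setT = l%:E.
Proof.
by move=> l0; rewrite lebE setTI lebesgue_measure_itv /= lte_fin l0 sube0.
Qed.

Lemma leb_fin l : fin_num_fun (leb l).
Proof.
move=> A mA; rewrite ge0_fin_numE//.
apply: (@le_lt_trans _ _ (lebesgue_measure (`]0, l[%classic : set R))).
  by rewrite lebE le_measure ?inE//; exact: measurableI.
by rewrite lebesgue_measure_itv /=; case: ifP => _; rewrite ?ltry// -EFinB ltry.
Qed.

(** The measure [leb l] packed with its finiteness, as Fubini's theorem requires. *)
Definition lebF l : {finite_measure set (measurableTypeR R) -> \bar R} :=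
  HB.pack (Measure.sort (leb l)) (Measure.class (leb l))
    (Measure_isFinite.Build _ _ _ (leb l) (@leb_fin l)).

Lemma leb_lty l : (leb l setT < +oo)%E.
Proof. exact: finite_measure_lty (lebF l). Qed.

Lemma leb_L2_cst l (c : R) : L2 (leb l) (cst c).
Proof. exact: L2_cst (leb_lty l) c. Qed.

Lemma leb_Rintegral_cst l (c : R) : 0 < l -> \int[leb l]_x c = c * l.
Proof.
by move=> l0; have := @Rintegral_cst _ _ _ (leb l) setT measurableT c; rewrite leb_setT.
Qed.

Lemma leb_set1 l x : leb l [set x] = 0%E.
Proof.
apply/eqP; rewrite eq_le measure_ge0 andbT.
by rewrite -(@lebesgue_measure_set1 R x) leb_le.
Qed.

Lemma leb_ae l (P : R -> Prop) :
  (\forall x \ae (@lebesgue_measure R), 0 < x < l -> P x) -> \forall x \ae leb l, P x.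
Proof.
move=> -[A [mA A0 PA]]; exists (A `|` ~` `]0, l[); split.
- by apply: measurableU => //; exact: measurableC.
- apply/eqP; rewrite eq_le measure_ge0 andbT -A0 lebE le_measure ?inE//.
    by apply: measurableI => //; apply: measurableU => //; exact: measurableC.
  by move=> x [[//|nx]] /= xl; exfalso; apply: nx.
- move=> x /= nP; have [x0|x0] := boolP (0 < x < l); last first.
    by right => /=; rewrite in_itv /=; exact/negP.
  by left; apply: PA => /= /(_ x0).
Qed.

Lemma leb_ae_itv l : \forall x \ae leb l, 0 < x < l.
Proof. by apply: leb_ae; exact: aeW. Qed.

Lemma integral_leb l (f : R -> \bar R) : measurable_fun setT f ->
  (\int[leb l]_x f x = \int[lebesgue_measure]_(x in `]0%R, l[) f x)%E.
Proof.
move=> mf; have mD : measurable (`]0%R, l[%classic : set R) by [].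
rewrite -(@eq_measure_integral _ _ _ _ lebesgue_measure (leb l)); last first.
  by move=> A mA Al; rewrite lebE; congr lebesgue_measure; apply/setIidPl.
rewrite [RHS]integral_mkcond; apply: ae_eq_integral => //.
  exact/(measurable_restrictT _ mD)/measurable_funTS.
apply: ae_imp (leb_ae_itv l) => x xl _.
by rewrite patchE mem_set.
Qed.

Lemma Rintegral_leb l (f : R -> R) : measurable_fun setT f ->
  \int[leb l]_x f x = \int[lebesgue_measure]_(x in `]0%R, l[) f x.
Proof. by move=> mf; rewrite /Rintegral integral_leb//; exact/measurable_EFinP. Qed.

End leb_measure.

Section primitive.
Context {R : realType}.
Variable l : R.
Hypothesis l0 : 0 < l.
Implicit Types (f g v w : R -> R).

Local Notation mu := (leb l).
Local Notation P := (prim mu).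

Lemma leb_integrable v : L2 mu v -> mu.-integrable setT (EFin \o v).
Proof. by move=> v2; exact: (@L2_integrable R _ _ mu (leb_lty l) v v2). Qed.

Lemma leb_cut v x : L2 mu v -> L2 mu (cut v x).
Proof. exact: (@L2_cut R (lebF l)). Qed.

Lemma prim_ge v x : measurable_fun setT v -> l <= x -> P v x = \int[mu]_t v t.
Proof.
move=> mv lx; apply: ae_eq_Rintegral => //; first exact: measurable_cut.
apply: ae_imp (leb_ae_itv l) => t /andP[_ tl] _.
by rewrite /cut (le_trans (ltW tl) lx) mulr1.
Qed.

Lemma prim_le0 v x : measurable_fun setT v -> x <= 0 -> P v x = 0.
Proof.
move=> mv x0; transitivity (\int[mu]_t (cst (0 : R) t)); last by rewrite Rintegral_cst// mul0r.
  apply: ae_eq_Rintegral => //; first exact: measurable_cut.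
  apply: ae_imp (leb_ae_itv l) => t /andP[t0 _] _.
  by rewrite /cut leNgt (le_lt_trans x0 t0) mulr0.
Qed.

Lemma primD v w x : L2 mu v -> L2 mu w ->
  P (fun t => v t + w t) x = P v x + P w x.
Proof.
move=> v2 w2; rewrite /prim -RintegralD//; [|exact: leb_integrable (leb_cut _ _)..].
by apply: eq_Rintegral => t _; rewrite /cut mulrDl.
Qed.

Lemma primZ c v x : L2 mu v -> P (fun t => c * v t) x = c * P v x.
Proof.
move=> v2; rewrite /prim -RintegralZl//; last exact: leb_integrable (leb_cut _ _).
by apply: eq_Rintegral => t _; rewrite /cut mulrA.
Qed.

Lemma primB v w x : L2 mu v -> L2 mu w ->
  P (fun t => v t - w t) x = P v x - P w x.
Proof.
move=> v2 w2; rewrite -mulN1r -primZ// -primD//; last exact: L2Z.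
by congr (P _ x); apply/funext => t; rewrite mulN1r.
Qed.

Lemma ae_eq_prim v w x : measurable_fun setT v -> measurable_fun setT w ->
  ae_eq mu setT v w -> P v x = P w x.
Proof.
move=> mv mw vw; apply: ae_eq_Rintegral; [exact: measurable_cut..|].
by apply: ae_imp vw => t /[apply]; rewrite /cut => ->.
Qed.

(** The Cauchy-Schwarz inequality against the indicator function of ]x, y]. *)
Lemma prim_holder v x y : L2 mu v -> (P v y - P v x) ^+ 2 <= L2norm mu v ^+ 2 * `|y - x|.
Proof.
wlog xy : x y / x <= y.
  move=> H v2; have [xy|/ltW yx] := leP x y; first exact: H.
  by rewrite -sqrrN opprB distrC; exact: H.
move=> v2; pose e (t : R) : R := (t <= y)%R%:R - (t <= x)%R%:R.
have me : measurable_fun setT e.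
  by apply: measurable_funB; exact: measurable_ler_natr.
have eE : e = \1_(`]x, y]%classic).
  apply/funext => t; rewrite /e indicE.
  have [tx|xt] := leP t x; first by rewrite (le_trans tx xy) subrr memNset// => /=; rewrite in_itv /= ltNge tx.
  have [ty|yt] := leP t y; first by rewrite mem_set /= ?in_itv /= ?xt ?subr0.
  by rewrite memNset ?subr0//= in_itv /= xt /= leNgt yt.
have e_sq : \int[mu]_t (e t ^+ 2) <= y - x.
  rewrite (_ : \int[mu]_t _ = fine (mu (`]x, y]%classic))); last first.
    rewrite -(setIT (`]x, y]%classic)) -integral_indic// /Rintegral; congr fine.
    by apply: eq_integral => t _; rewrite eE indicE; case: (_ \in _); rewrite ?expr1n ?expr0n.
  rewrite -lee_fin fineK; last exact: leb_fin.
  apply: le_trans (leb_le l (measurable_itv `]x, y])) _.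
  rewrite lebesgue_measure_itv /= lte_fin; case: ifP => _; first by rewrite -EFinD.
  by rewrite lee_fin subr_ge0.
have e2 : L2 mu e.
  apply: L2P => //.
  have := leb_integrable (@L2_cst _ _ _ mu (leb_lty l) 1) => i1.
  apply: le_lt_trans (integrable_lty measurableT i1).
  apply: ge0_le_integral => //.
  - by move=> t _; rewrite lee_fin sqr_ge0.
  - by apply/measurable_EFinP; exact: measurable_funX.
  - by apply/measurable_EFinP; exact: measurable_cst.
  - by move=> t _; rewrite lee_fin eE indicE; case: (_ \in _); rewrite ?expr1n ?expr0n.
have -> : P v y - P v x = inner mu v e.
  rewrite /prim -RintegralB//; [|exact: leb_integrable (leb_cut _ _)..].
  by apply: eq_Rintegral => t _; rewrite /cut /e mulrBr.
rewrite -[leLHS]real_normK ?num_real//.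
apply: (@le_trans _ _ ((L2norm mu v * L2norm mu e) ^+ 2)).
  by rewrite lerXn2r ?nnegrE ?mulr_ge0 ?L2norm_ge0//; exact: cauchy_schwarz.
by rewrite exprMn ler_wpM2l ?sqr_ge0// L2norm_sqr ger0_norm ?subr_ge0.
Qed.

Lemma prim_continuous v : L2 mu v -> continuous (P v).
Proof.
move=> v2 x; apply/cvgrPdist_lt => e e0.
pose C := L2norm mu v ^+ 2 + 1.
have C0 : 0 < C by rewrite ltr_pwDr// sqr_ge0.
have d0 : 0 < e ^+ 2 / C by rewrite divr_gt0// exprn_gt0.
exists (e ^+ 2 / C) => //= y xy.
rewrite -(@ltr_pXn2r _ 2) ?nnegrE ?(ltW e0)// real_normK ?num_real//.
apply: le_lt_trans (prim_holder y x v2) _.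
move: xy; rewrite /ball_ /= ltr_pdivlMr// => xy; apply: le_lt_trans xy.
by rewrite mulrC ler_wpM2l// /C lerDl.
Qed.

Lemma prim_measurable v : L2 mu v -> measurable_fun setT (P v).
Proof. by move=> v2; apply: continuous_measurable_fun; exact: prim_continuous. Qed.

Lemma prim_bound v x : L2 mu v -> `|P v x| <= Num.sqrt l * L2norm mu v.
Proof.
move=> v2; have mv := L2_measurable v2.
wlog xl : x / 0 <= x <= l.
  move=> H; have [x0|x0] := leP 0 x; last first.
    by rewrite (prim_le0 mv (ltW x0)) normr0 mulr_ge0 ?sqrtr_ge0 ?L2norm_ge0.
  have [xl|lx] := leP x l; first by apply: H; rewrite x0.
  by rewrite (prim_ge mv (ltW lx)) -(prim_ge mv (lexx l)); apply: H; rewrite lexx (ltW l0).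
rewrite -(@ler_pXn2r _ 2) ?nnegrE ?mulr_ge0 ?sqrtr_ge0 ?L2norm_ge0//.
rewrite real_normK ?num_real// -[P v x]subr0 -(prim_le0 mv (lexx 0)).
apply: le_trans (prim_holder 0 x v2) _; rewrite exprMn sqr_sqrtr ?(ltW l0)// mulrC.
rewrite ler_wpM2r ?sqr_ge0// subr0 ger0_norm; by case/andP: xl.
Qed.

(** Integration by parts for v and w cut at x. *)
Lemma prim_mul v w x : L2 mu v -> L2 mu w ->
  P v x * P w x = P (fun t => v t * P w t + w t * P v t) x.
Proof.
move=> v2 w2; have vx2 := leb_cut x v2; have wx2 := leb_cut x w2.
have := @triangle_by_parts R (lebF l) (leb_set1 l) _ _ vx2 wx2.
move=> /eqP; rewrite -subr_eq opprK => /eqP.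
have cutE u u' t : cut u x t * P (cut u' x) t = cut (fun t => u t * P u' t) x t.
  rewrite /cut; have [tx|_] := leP t x; rewrite ?mulr1 ?mulr0 ?mul0r//.
  congr (_ * _); apply: eq_Rintegral => s _; rewrite /cut.
  by have [st|] := leP s t; rewrite ?mulr0// (le_trans st tx) !mulr1.
have I u u' : L2 mu u -> L2 mu u' -> mu.-integrable setT (EFin \o cut (fun t => u t * P u' t) x).
  move=> u2 u2'.
  have := mul_prim_integrable (mu := lebF l) (leb_cut x u2) (leb_cut x u2').
  by apply: eq_integrable => // t _ /=; rewrite cutE.
rewrite -[X in _ = X]/(P v x * P w x) => <-.
rewrite -RintegralD//.
- by apply: eq_Rintegral => t _; rewrite /cut !cutE /cut mulrDl.
- by apply: eq_integrable (I _ _ v2 w2) => // t _ /=; rewrite cutE.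
- by apply: eq_integrable (I _ _ w2 v2) => // t _ /=; rewrite cutE.
Qed.

End primitive.

Section absolutely_continuous.
Context {R : realType}.
Variable l : R.
Hypothesis l0 : 0 < l.
Implicit Types (f g v w : R -> R).

Local Notation mu := (leb l).
Local Notation P := (prim mu).

(** On [0, l], f is a primitive of the square integrable v; outside [0, l], nothing
    but measurability is asked of f. *)
Definition ac f v : Prop :=
  [/\ measurable_fun setT f, L2 mu v & forall x, 0 <= x <= l -> f x = f 0 + P v x].

Let in0 : 0 <= (0 : R) <= l. Proof. by rewrite lexx ltW. Qed.
Let inl : 0 <= l <= l. Proof. by rewrite lexx ltW. Qed.

Lemma ac_prim v c : L2 mu v -> ac (fun x => c + P v x) v.
Proof.
move=> v2; split => //; first by apply: measurable_funD => //; exact: prim_measurable.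
by move=> x _; rewrite (@prim_le0 _ _ _ 0) ?addr0//; exact: L2_measurable v2.
Qed.

Lemma ac_end f v : ac f v -> f l = f 0 + \int[mu]_t v t.
Proof. by case=> mf v2 fE; rewrite fE// prim_ge//; exact: L2_measurable v2. Qed.

Lemma ac_bound f v : ac f v ->
  exists2 M, 0 <= M & forall x, 0 <= x <= l -> `|f x| <= M.
Proof.
case=> mf v2 fE; exists (`|f 0| + Num.sqrt l * L2norm mu v).
  by rewrite addr_ge0// mulr_ge0 ?sqrtr_ge0 ?L2norm_ge0.
move=> x xl; rewrite fE//; apply: le_trans (ler_normD _ _) _.
by rewrite lerD2l prim_bound.
Qed.

Lemma ae_bounded_L2 f M : measurable_fun setT f -> (forall x, 0 < x < l -> `|f x| <= M) ->
  L2 mu f.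
Proof.
move=> mf fM; apply: L2P => //.
apply: (@le_lt_trans _ _ (\int[mu]_x cst (M ^+ 2)%:E x)%E); last first.
  by rewrite integral_cst// lte_mul_pinfty ?lee_fin ?sqr_ge0//; exact: leb_lty.
apply: ae_ge0_le_integral => //.
- by move=> t _; rewrite lee_fin sqr_ge0.
- by apply/measurable_EFinP; exact: measurable_funX.
- by move=> t _; rewrite lee_fin sqr_ge0.
- apply: ae_imp (leb_ae_itv l) => x xl _; rewrite lee_fin -[leLHS]real_normK ?num_real//.
  by rewrite lerXn2r ?nnegrE// ?fM// (le_trans _ (fM x xl)).
Qed.

Lemma L2_bounded_mul f v M : measurable_fun setT f ->
  (forall x, 0 < x < l -> `|f x| <= M) -> L2 mu v -> L2 mu (fun x => v x * f x).
Proof.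
move=> mf fM v2; have mv := L2_measurable v2.
apply: L2P; first exact: measurable_funM.
have M2 := L2_sqr_integrable (L2Z M v2).
apply: le_lt_trans (integrable_lty measurableT M2).
apply: ae_ge0_le_integral => //.
- by move=> t _; rewrite lee_fin sqr_ge0.
- by apply/measurable_EFinP; apply: measurable_funX; exact: measurable_funM.
- by move=> t _; rewrite lee_fin sqr_ge0.
- by apply/measurable_EFinP; apply: measurable_funX; exact: measurable_funM.
- apply: ae_imp (leb_ae_itv l) => x xl _; rewrite lee_fin !exprMn mulrC.
  rewrite ler_wpM2r ?sqr_ge0// -[leLHS]real_normK ?num_real//.
  by rewrite lerXn2r ?nnegrE// ?fM// (le_trans _ (fM x xl)).
Qed.

Lemma ac_L2_mul f v w : ac f v -> L2 mu w -> L2 mu (fun x => w x * f x).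
Proof.
move=> fv w2; have [M _ fM] := ac_bound fv; case: fv => mf _ _.
by apply: L2_bounded_mul mf _ w2 => x /andP[x0 xl]; apply: fM; rewrite !ltW.
Qed.

Lemma ac_L2 f v : ac f v -> L2 mu f.
Proof.
move=> fv; have [M _ fM] := ac_bound fv; case: fv => mf _ _.
by apply: ae_bounded_L2 mf _ => x /andP[x0 xl]; apply: fM; rewrite !ltW.
Qed.

Lemma ac_cst c : ac (cst c) (cst 0).
Proof.
split => //; first exact: L2_0.
move=> x _; rewrite (_ : P _ x = 0) ?addr0//.
rewrite /prim -[RHS](mul0r (fine (mu setT))) -[RHS](@Rintegral_cst _ _ _ mu setT measurableT 0).
by apply: eq_Rintegral => t _; rewrite /cut /cst mul0r.
Qed.

Lemma acD f v g w : ac f v -> ac g w -> ac (fun x => f x + g x) (fun x => v x + w x).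
Proof.
move=> [mf v2 fE] [mg w2 gE]; split; [exact: measurable_funD|exact: L2D|].
by move=> x xl; rewrite primD// fE// gE//; ring.
Qed.

Lemma acZ c f v : ac f v -> ac (fun x => c * f x) (fun x => c * v x).
Proof.
move=> [mf v2 fE]; split; [exact: measurable_funM|exact: L2Z|].
by move=> x xl; rewrite primZ// fE//; ring.
Qed.

Lemma acB f v g w : ac f v -> ac g w -> ac (fun x => f x - g x) (fun x => v x - w x).
Proof.
move=> fv gw; have := acD fv (acZ (-1) gw).
by under eq_fun do rewrite mulN1r; under [X in ac _ X -> _]eq_fun do rewrite mulN1r.
Qed.

Lemma ac_ext f g v w : (forall x, 0 <= x <= l -> f x = g x) -> measurable_fun setT g ->
  ae_eq mu setT v w -> measurable_fun setT w -> ac f v -> ac g w.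
Proof.
move=> fg mg vw mw [mf v2 fE]; split => //; first exact: ae_eq_L2 vw v2.
move=> x xl; rewrite -!fg// fE//; congr (_ + _).
exact: ae_eq_prim (L2_measurable v2) mw vw.
Qed.

(** The product rule comes from integration by parts for primitives. *)
Lemma acM f v g w : ac f v -> ac g w ->
  ac (fun x => f x * g x) (fun x => v x * g x + w x * f x).
Proof.
move=> fv gw; have vg2 := ac_L2_mul gw (let: And3 _ v2 _ := fv in v2).
have wf2 := ac_L2_mul fv (let: And3 _ w2 _ := gw in w2).
case: fv gw => mf v2 fE [mg w2 gE].
split; [exact: measurable_funM|exact: L2D|].
move=> x xl; have mv := L2_measurable v2; have mw := L2_measurable w2.
have PwL : L2 mu (fun t => v t * P w t).
  by apply: L2_bounded_mul (prim_measurable w2) _ v2 => t _; exact: prim_bound.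
have PvL : L2 mu (fun t => w t * P v t).
  by apply: L2_bounded_mul (prim_measurable v2) _ w2 => t _; exact: prim_bound.
rewrite (@ae_eq_prim _ l _ (fun t => (g 0 * v t + f 0 * w t) + (v t * P w t + w t * P v t))).
- rewrite primD//; [|by apply: L2D; exact: L2Z|exact: L2D].
  by rewrite primD ?primZ//; [|exact: L2Z..]; rewrite -prim_mul// fE// gE//; ring.
- by apply: measurable_funD; exact: measurable_funM.
- apply: measurable_funD; first by apply: measurable_funD; exact: measurable_funM.
  by apply: measurable_funD; apply: measurable_funM => //; exact: prim_measurable.
- apply: ae_imp (leb_ae_itv l) => t /andP[t0 tl] _.
  rewrite (fE t) ?(gE t) ?(ltW t0) ?(ltW tl)//.
  have alg (a b c d p q : R) : a * (c + q) + b * (d + p) = c * a + d * b + (a * q + b * p) by ring.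
  exact: alg.
Qed.

Lemma ac_by_parts f v g w : ac f v -> ac g w ->
  inner mu v g = f l * g l - f 0 * g 0 - inner mu f w.
Proof.
move=> fv gw; have := ac_end (acM fv gw); rewrite RintegralD//.
- by move=> ->; rewrite /inner (@eq_Rintegral _ _ _ mu setT (fun x => f x * w x) (fun x => w x * f x))
    => [|x _]; [ring|rewrite mulrC].
- by apply: leb_integrable; apply: ac_L2_mul gw _; case: fv.
- by apply: leb_integrable; apply: ac_L2_mul fv _; case: gw.
Qed.

(** A null set does not contain an interval. *)
Lemma ae_leb_meets (Q : R -> Prop) a b : (\forall x \ae mu, Q x) ->
  0 <= a -> a < b -> b <= l -> exists2 x, a < x < b & Q x.
Proof.
move=> [A [mA A0 QA]] a0 ab bl; apply: contrapT => nex.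
have abA : (`]a, b[%classic : set R) `<=` A.
  move=> x /=; rewrite in_itv /= => xab; apply: QA => /= Qx.
  by apply: nex; exists x.
have : (mu (`]a, b[%classic : set R) <= mu A)%E by rewrite le_measure ?inE.
rewrite A0 lebE setIidl; last first.
  move=> x /=; rewrite !in_itv /= => /andP[ax xb].
  by rewrite (le_lt_trans a0 ax) (lt_le_trans xb bl).
by rewrite lebesgue_measure_itv /= lte_fin ab -EFinD lee_fin subr_le0 leNgt ab.
Qed.

(** A primitive is 1/2-Holder continuous, and this one vanishes at points
    arbitrarily close to x. *)
Lemma prim_ae0 v : L2 mu v -> ae_eq mu setT (P v) (cst 0) ->
  forall x, 0 <= x <= l -> P v x = 0.
Proof.
move=> v2 Pv0 x /andP[x0 xl]; apply/eqP; rewrite -sqrf_eq0 -normr_eq0.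
apply/eqP/le_anti; rewrite normr_ge0 andbT; apply/ler_addgt0Pl => e e0.
rewrite addr0 normrX; pose C := L2norm mu v ^+ 2 + 1.
have C0 : 0 < C by rewrite ltr_pwDr// sqr_ge0.
pose d := e / C; have d0 : 0 < d by rewrite divr_gt0.
have [y yx Py] : exists2 y, `|y - x| <= d & P v y = 0.
  have [xl'|lx] := ltP x l.
    have [||y /andP[xy yd] Py] := ae_leb_meets (a := x) (b := Num.min l (x + d)) Pv0 x0.
    - by rewrite lt_min xl' ltrDl.
    - by rewrite ge_min lexx.
    exists y; last exact: Py.
    rewrite ger0_norm ?subr_ge0 ?(ltW xy)// lerBlDl ltW//.
    by apply: lt_le_trans yd _; rewrite ge_min lexx orbT.
  have [|||y /andP[xy yd] Py] := ae_leb_meets (a := Num.max 0 (x - d)) (b := x) Pv0.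
  - by rewrite le_max lexx.
  - by rewrite gt_max (lt_le_trans l0 lx) ltrBlDr ltrDl.
  - exact: xl.
  exists y; last exact: Py.
  rewrite distrC ger0_norm ?subr_ge0 ?(ltW yd)// lerBlDl -lerBlDr ltW//.
  by apply: le_lt_trans xy; rewrite le_max lexx orbT.
rewrite -normrX ger0_norm ?sqr_ge0// -[P v x]subr0 -Py.
apply: le_trans (prim_holder y x v2) _.
apply: (@le_trans _ _ (C * d)); last by rewrite /d mulrC divfK// gt_eqF.
by rewrite distrC; apply: ler_pM => //; rewrite ?sqr_ge0// /C lerDl.
Qed.

(** Lebesgue differentiation, for the extension of v - w by 0 to the whole line. *)
Lemma prim_inj v w : L2 mu v -> L2 mu w ->
  (forall x, 0 <= x <= l -> P v x = P w x) -> ae_eq mu setT v w.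
Proof.
move=> v2 w2 vw.
pose z x := v x - w x; have z2 : L2 mu z by exact: L2B.
have Pz x : 0 <= x <= l -> P z x = 0 by move=> xl; rewrite primB// vw// subrr.
suff : ae_eq mu setT z (cst 0).
  by apply: ae_imp => x /[apply] /eqP; rewrite subr_eq0 => /eqP.
have mz := L2_measurable z2.
pose D : set R := `]0, l[%classic.
pose f := z \_ D.
have mf : measurable_fun setT f.
  by apply/(measurable_restrictT _ (measurable_itv _)); exact: measurable_funTS.
have if0 : lebesgue_measure.-integrable setT (EFin \o f).
  have := leb_integrable z2.
  move=> /integrableP[_]; rewrite integral_leb; last first.
    by apply: measurableT_comp => //; exact/measurable_EFinP.
  move=> fi; apply/integrableP; split; first exact/measurable_EFinP.
  move: fi; rewrite [X in (X < _)%E -> _]integral_mkcond; congr (_ < _)%E.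
  by apply: eq_integral => x _; rewrite /f /= !patchE; case: ifP; rewrite ?normr0.
have F0 x : \int[lebesgue_measure]_(t in `]-oo, x]) f t = 0.
  rewrite (_ : \int[_]_(t in _) _ = P z x).
    have [x0|x0] := leP x 0; first by rewrite prim_le0.
    have [xl|lx] := leP x l; first by rewrite Pz// ltW.
    by rewrite prim_ge ?ltW// -(prim_ge mz (lexx l)) Pz.
  rewrite /prim Rintegral_leb; last exact: measurable_cut.
  rewrite Rintegral_mkcond [RHS]Rintegral_mkcond; apply: eq_Rintegral => t _.
  rewrite /f /cut !patchE /=; have [tx|xt] := leP t x.
    by rewrite mulr1 mem_set//= in_itv /= tx.
  by rewrite mulr0 memNset ?if_same//= in_itv /= leNgt xt.
have lf : locally_integrable [set: R] f.
  by apply: open_integrable_locally => //; exact: openT.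
apply: leb_ae.
have iy y : lebesgue_measure.-integrable (`]-oo, y]%classic : set R) (EFin \o f).
  by apply: integrableS if0.
have H := FTC1Ny iy lf.
apply: ae_imp H => x [_ fx] xl _ /=.
move: fx; under eq_fun do rewrite F0.
by rewrite derive1_cst /f patchE mem_set//= ?in_itv//= => <-.
Qed.

Lemma ac_unique f v w : ac f v -> ac f w -> ae_eq mu setT v w.
Proof.
move=> [_ v2 fv] [_ w2 fw]; apply: prim_inj => // x xl.
by apply: (addrI (f 0)); rewrite -fv// fw.
Qed.

End absolutely_continuous.

(** * Weak derivatives *)

Section weak_derivatives.
Context {R : realType}.
Variable l : R.
Hypothesis l0 : 0 < l.
Implicit Types (f g v w : R -> R).

Local Notation mu := (leb l).
Local Notation P := (prim mu).

Lemma continuous_bounded f : continuous f ->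
  exists2 M, 0 <= M & forall x, 0 <= x <= l -> `|f x| <= M.
Proof.
move=> cf; have [|c _ cP] := @EVT_max R (fun x => `|f x|) 0 l (ltW l0).
  by apply: continuous_subspaceT => x; apply: continuous_comp (cf x) _; exact: norm_continuous.
by exists `|f c| => // x xl; apply: cP; rewrite in_itv.
Qed.

Lemma continuous_L2 f : continuous f -> L2 mu f.
Proof.
move=> cf; have [M _ fM] := continuous_bounded cf.
apply: (@ae_bounded_L2 _ l f M); first exact: continuous_measurable_fun.
by move=> x /andP[x0 xl]; apply: fM; rewrite !ltW.
Qed.

Lemma ac_C1 f df : (forall x : R, is_derive x (1 : R) f (df x)) -> continuous df -> ac l f df.
Proof.
move=> fd cdf; have cf : continuous f.
  by move=> x; apply: differentiable_continuous; apply/derivable1_diffP; have [] := fd x.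
split; [exact: continuous_measurable_fun|exact: continuous_L2|].
move=> x /andP[x0 xl].
have [->|xn0] := eqVneq x 0; first by rewrite (@prim_le0 _ _ _ 0) ?addr0//; exact: continuous_measurable_fun.
have {}x0 : 0 < x by rewrite lt_neqAle eq_sym xn0.
have mdf := continuous_measurable_fun cdf.
have H : (\int[lebesgue_measure]_(x1 in `[0%R, x]) (df x1)%:E)%E = ((f x)%:E - (f 0)%:E)%E.
  apply: continuous_FTC2 => //; first exact: continuous_subspaceT cdf.
    split => [y _||]; first by have [] := fd y.
      exact/cvg_at_right_filter/cf.
    exact/cvg_at_left_filter/cf.
  by move=> y _; rewrite derive1E; have [_ ->] := fd y.
suff -> : P df x = f x - f 0 by rewrite addrC subrK.
rewrite /prim Rintegral_leb; last exact: measurable_cut.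
rewrite (_ : f x - f 0 = \int[lebesgue_measure]_(t in `[0, x]) df t); last first.
  by rewrite /Rintegral H.
rewrite -Rintegral_itv_obnd_cbnd; last first.
  apply: (@integrableS _ _ _ lebesgue_measure (`[0, x]%classic : set R));
    [exact: measurable_itv|exact: measurable_itv|exact: subset_itv_oc_cc|].
  apply: continuous_compact_integrable; first exact: segment_compact.
  exact: continuous_subspaceT.
rewrite Rintegral_mkcond [RHS]Rintegral_mkcond; apply: ae_eq_Rintegral.
- apply/(measurable_restrictT _ (measurable_itv _)); apply: measurable_funTS; exact: measurable_cut.
- by apply/(measurable_restrictT _ (measurable_itv _)); apply: measurable_funTS.
exists [set l]; split => //; first exact: lebesgue_measure_set1.
move=> t /=; apply: contra_notP => tl _.
rewrite /cut !patchE; have [tx|xt] := leP t x.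
  have [t0|t0] := ltP 0 t.
    rewrite !mem_set ?mulr1//= in_itv /= t0 //=.
    by rewrite lt_neqAle (le_trans tx xl) andbT; exact/eqP.
  by rewrite !memNset//= in_itv /= ltNge t0.
rewrite mulr0 if_same memNset//=; rewrite in_itv /= => /andP[_].
by rewrite leNgt xt.
Qed.

Lemma test_function_ac h : test_function l h ->
  [/\ ac l h (derive1 h), h 0 = 0 & h l = 0].
Proof.
move=> [hd hc hs]; split.
- apply: ac_C1 => // x; apply: DeriveDef => //; by rewrite derive1E.
- apply: contrapT => h0; have /hs : closure [set x | h x != 0] 0.
    by apply: subset_closure => /=; exact/eqP.
  by rewrite /= in_itv /= ltxx.
- apply: contrapT => hl; have /hs : closure [set x | h x != 0] l.
    by apply: subset_closure => /=; exact/eqP.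
  by rewrite /= in_itv /= ltxx andbF.
Qed.

Lemma ac_weak_deriv f v : ac l f v -> weak_deriv l f v.
Proof.
move=> fv h /test_function_ac[hh h0 hl]; have := ac_by_parts l0 fv hh.
by rewrite h0 hl !mulr0 subrr sub0r /inner => ->; rewrite opprK.
Qed.

Lemma ae_weak_deriv f g v w : measurable_fun setT g -> measurable_fun setT w ->
  L2 mu f -> L2 mu v -> ae_eq mu setT f g -> ae_eq mu setT v w ->
  weak_deriv l f v -> weak_deriv l g w.
Proof.
move=> mg mw f2 v2 fg vw fv h th; have [hh _ _] := test_function_ac th.
have mh : measurable_fun setT h by case: hh.
have mdh : measurable_fun setT (derive1 h) by case: hh => _ /L2_measurable.
have mf := L2_measurable f2; have mv := L2_measurable v2.
have := fv h th; rewrite -!/(inner _ _ _).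
rewrite (@ae_eq_inner _ _ _ mu f g (derive1 h) (derive1 h))//; last exact: ae_eq_refl.
by rewrite (@ae_eq_inner _ _ _ mu v w h h)//; exact: ae_eq_refl.
Qed.

(** Continuous functions of mean zero, supported well inside ]0, l[, are derivatives
    of test functions. *)
Lemma prim_test_function g a b : continuous g -> 0 < a -> b < l ->
  (forall t, t <= a -> g t = 0) -> (forall t, b <= t -> g t = 0) ->
  \int[mu]_t g t = 0 -> test_function l (P g) /\ derive1 (P g) = g.
Proof.
move=> cg a0 bl ga gb gI.
have mg := continuous_measurable_fun cg.
have PE x : P g x = \int[lebesgue_measure]_(t in `]-oo, x]) g t.
  rewrite /prim Rintegral_leb; last exact: measurable_cut.
  rewrite Rintegral_mkcond [RHS]Rintegral_mkcond; apply: eq_Rintegral => t _.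
  rewrite /cut !patchE; have [tx|xt] := leP t x; last first.
    by rewrite mulr0 if_same memNset//= in_itv /= leNgt xt.
  rewrite mulr1 [X in _ = if X then _ else _]mem_set//= ?in_itv//=.
  have [t0|t0] := leP t 0; first by rewrite ga ?if_same// (le_trans t0)// ltW.
  have [lt|tl] := leP l t; first by rewrite gb ?if_same// (le_trans _ lt)// ltW.
  by rewrite mem_set//= in_itv /= t0.
have ig : lebesgue_measure.-integrable setT (EFin \o g).
  have -> : EFin \o g = (EFin \o g) \_ (`[a, b]%classic : set R).
    apply/funext => x; rewrite patchE; case: ifPn => //; rewrite notin_setE /= in_itv /= => /negP.
    rewrite negb_and -!ltNge => /orP[xa|bx]; first by rewrite ga// ltW.
    by rewrite gb// ltW.
  rewrite -integrable_mkcond; last exact: measurable_itv.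
  apply: continuous_compact_integrable; first exact: segment_compact.
  exact: continuous_subspaceT.
have igs y : lebesgue_measure.-integrable (`]-oo, y]%classic : set R) (EFin \o g).
  by apply: integrableS ig.
have Pd x : derivable (P g) x 1 /\ derive1 (P g) x = g x.
  rewrite (_ : P g = fun x => \int[lebesgue_measure]_(t in `]-oo, x]) g t); last exact/funext.
  by apply: (@continuous_FTC1 R g -oo%O x (x + 1)) => //; [rewrite ltrDl|rewrite ltNyr|exact: cg].
have dE : derive1 (P g) = g by apply/funext => x; have [] := Pd x.
split => //; split; [by move=> x; have [] := Pd x|by rewrite dE|].
apply: (@subset_trans _ `[a, b]%classic); last first.
  move=> x /=; rewrite !in_itv /= => /andP[ax xb].
  by rewrite (lt_le_trans a0 ax) (le_lt_trans xb bl).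
apply: (@subset_trans _ (closure `[a, b]%classic)); last first.
  rewrite -(proj1 (closure_id _))//; apply: compact_closed; first exact: Rhausdorff.
  exact: segment_compact.
apply: closure_subset => x /=; apply: contra_neqP => nx.
have [xa|ax] := leP x a.
  rewrite /prim -[RHS](mul0r (fine (mu setT))) -[RHS](@Rintegral_cst _ _ _ mu setT measurableT 0).
  apply: eq_Rintegral => t _; rewrite /cut /cst; have [tx|_] := leP t x; last by rewrite mulr0.
  by rewrite ga ?mul0r// (le_trans tx).
rewrite -gI; apply: eq_Rintegral => t _; rewrite /cut.
have [tx|xt] := leP t x; first by rewrite mulr1.
rewrite gb ?mulr0// ltW// (le_lt_trans _ xt)// leNgt; apply/negP => xb; apply: nx.
by rewrite in_itv /= !ltW.
Qed.

(** Continuous functions that converge to the indicator function of ]0, x[ and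
    vanish near 0 and beyond x - 1/(n+1). *)
Definition trapezoid (x : R) (n : nat) (t : R) : R :=
  Num.max 0 (Num.min 1 (Num.min (n.+1%:R * t - 1) (n.+1%:R * (x - t) - 1))).

Lemma trapezoid_continuous x n : continuous (trapezoid x n).
Proof.
rewrite (_ : trapezoid x n = cst 0 \max (cst 1 \min
  ((fun t => n.+1%:R * t - 1) \min (fun t => n.+1%:R * (x - t) - 1))))//.
apply: max_fun_continuous; first exact: cst_continuous.
apply: min_fun_continuous; first exact: cst_continuous.
apply: min_fun_continuous => t.
- apply: continuousB; last exact: cst_continuous.
  by apply: continuousM; [exact: cst_continuous|exact: cvg_id].
- apply: cvgB; last exact: cvg_cst.
  by apply: cvgM; [exact: cvg_cst|apply: cvgB; [exact: cvg_cst|exact: cvg_id]].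
Qed.

Lemma trapezoid_bound x n t : 0 <= trapezoid x n t <= 1.
Proof. by rewrite /trapezoid le_max lexx /= ge_max ler01 ge_min lexx. Qed.

Lemma trapezoid0 x n t : (t <= n.+1%:R^-1) || (x - n.+1%:R^-1 <= t) -> trapezoid x n t = 0.
Proof.
have n0 : (0 : R) < n.+1%:R by rewrite ltr0n.
move=> H; apply/max_idPl; rewrite !ge_min !subr_le0; apply/orP; right.
case/orP: H => H; apply/orP; [left|right].
  by rewrite -ler_pdivlMl// mulr1.
by rewrite -ler_pdivlMl// mulr1 lerBlDl addrC -lerBlDl.
Qed.

Lemma trapezoid_cvg x t : trapezoid x n t @[n --> \oo] --> ((0 < t < x)%R%:R : R).
Proof.
have [/andP[t0 tx]|] := boolP (0 < t < x); last first.
  rewrite negb_and -!leNgt => H.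
  rewrite (_ : (fun n => _) = cst 0); first exact: cvg_cst.
  apply/funext => n; apply: trapezoid0; apply/orP.
  have i0 : 0 <= (n.+1%:R : R)^-1 by rewrite invr_ge0.
  by case/orP: H => H; [left; exact: le_trans i0|right; apply: le_trans H; rewrite lerBlDr lerDl].
pose e := Num.min t (x - t).
have e0 : 0 < e by rewrite lt_min t0 subr_gt0.
apply: cvg_near_cst; near=> n.
apply/eqP; rewrite eq_le; apply/andP; split; first by have /andP[] := trapezoid_bound x n t.
rewrite /trapezoid le_max; apply/orP; right; rewrite !le_min lexx /=.
have ne : 2 / e <= n.+1%:R.
  have : (Num.bound (2 / e) <= n)%N by near: n; exact: nbhs_infty_ge.
  rewrite -(ler_nat R) => H; apply: (@le_trans _ _ n%:R); last by rewrite ler_nat.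
  apply: le_trans H; rewrite (le_trans (ler_norm _))// ltW//.
  by have := archi_boundP (divr_ge0 (ler0n R 2) (ltW e0)); rewrite ger0_norm// divr_ge0// ltW.
move: ne; rewrite ler_pdivrMr// => ne.
have h1 : e <= t by rewrite ge_min lexx.
have h2 : e <= x - t by rewrite ge_min lexx orbT.
have k1 := ler_wpM2l (ler0n R n.+1) h1; have k2 := ler_wpM2l (ler0n R n.+1) h2.
by apply/andP; split; lra.
Unshelve. all: by end_near. Qed.

Lemma prim_cst c x : 0 <= x <= l -> P (cst c) x = c * x.
Proof.
move=> /andP[x0 xl].
have d t : is_derive (t : R) (1 : R) (fun t => c * t) c.
  by have := is_deriveZ c (is_derive_id (t : R^o) (1 : R^o)); rewrite /GRing.scale /= mulr1.
have [_ _ /(_ x)] := ac_C1 (fun t => d t) (@cst_continuous _ _ c).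
by rewrite x0 xl mulr0 add0r => /(_ isT).
Qed.

Lemma trapezoid_inner v x : L2 mu v -> x <= l ->
  inner mu v (trapezoid x n) @[n --> \oo] --> P v x.
Proof.
move=> v2 xl; have mv : measurable_fun (setT : set R) v := L2_measurable v2.
have mtr n : measurable_fun setT (trapezoid x n).
  by apply: continuous_measurable_fun; exact: trapezoid_continuous.
have -> : P v x = \int[mu]_t (v t * (0 < t < x)%R%:R).
  apply: ae_eq_Rintegral; first exact: measurable_cut.
    apply: measurable_funM => //; apply: measurable_bool_natr.
    by apply: measurable_and; exact: measurable_fun_ltr.
  exists ([set x] `|` ~` `]0, l[); split.
  - by apply: measurableU => //; exact: measurableC.
  - apply/eqP; rewrite eq_le measure_ge0 andbT -(@leb_set1 _ l x) !lebE le_measure ?inE//.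
    + by apply: measurableI => //; apply: measurableU => //; exact: measurableC.
    + exact: measurableI.
    + by move=> t [[tx tl|nt tl]]; [split|exfalso; exact: nt].
  - move=> t /= nt; have [t0|nt0] := boolP (0 < t < l); last first.
      by right => /=; rewrite in_itv; exact/negP.
    left; apply: contrapT => /= tx; apply: nt => _; rewrite /cut.
    by case/andP: t0 => -> _ /=; congr (_ * _%:R); rewrite lt_neqAle; move/eqP: tx => ->.
apply: (@dominated_cvg_Rintegral R _ _ mu (fun n t => v t * trapezoid x n t) _ (fun x => `|v x|)) => //.
- by move=> n; apply: measurable_funM; [exact: mv|exact: mtr].
- by move=> t; apply: cvgM; [exact: cvg_cst|exact: trapezoid_cvg].
- by have := integrable_abse (leb_integrable v2).
- move=> n t; rewrite normrM ler_piMr//.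
  by have /andP[t0 t1] := trapezoid_bound x n t; rewrite ger0_norm.
Qed.

(** The lemma of du Bois-Reymond. The difference z of f and the primitive of v is
    orthogonal to the derivatives of all test functions, in particular to
    combinations of two trapezoids with mean zero. In the limit, the primitive of z
    is linear, so z is constant. *)
Lemma weak_deriv_prim f v : L2 mu f -> L2 mu v -> weak_deriv l f v ->
  exists c, ae_eq mu setT f (fun x => c + P v x).
Proof.
move=> f2 v2 fv; pose z x := f x - P v x.
have Pv2 : L2 mu (P v).
  by have := ac_L2 l0 (ac_prim 0 v2); under [X in L2 _ X]eq_fun do rewrite add0r.
have z2 : L2 mu z by exact: L2B.
have zh h : test_function l h -> inner mu z (derive1 h) = 0.
  move=> th; have [hh h0 hl] := test_function_ac th.
  have h'2 : L2 mu (derive1 h) by case: hh.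
  rewrite innerBl// {1}/inner fv// -/(inner _ _ _).
  have := ac_by_parts l0 (ac_prim 0 v2) hh.
  rewrite h0 hl !mulr0 subrr sub0r => ->.
  by rewrite opprK (_ : (fun x => 0 + _) = P v) ?subrr//; apply/funext => x; rewrite add0r.
suff Pz x : 0 <= x <= l -> P z x = P (cst (P z l / l)) x.
  exists (P z l / l).
  have := prim_inj l0 z2 (@L2_cst _ _ _ mu (leb_lty l) (P z l / l)) Pz.
  by apply: ae_imp => x /[apply] /= <-; rewrite /z subrK.
move=> xl; rewrite prim_cst//.
have [->|xn0] := eqVneq x 0; first by rewrite mulr0 prim_le0//; exact: L2_measurable z2.
have x0 : 0 < x by rewrite lt_neqAle eq_sym xn0; case/andP: xl.
pose I y n := \int[mu]_t trapezoid y n t.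
have tr2 y n : L2 mu (trapezoid y n) by exact/continuous_L2/trapezoid_continuous.
(* I l n times the trapezoid at x, minus I x n times the trapezoid at l, has mean zero *)
have key n : I l n * inner mu z (trapezoid x n) = I x n * inner mu z (trapezoid l n).
  have g2 : L2 mu (fun t => I l n * trapezoid x n t - I x n * trapezoid l n t).
    by apply: L2B; exact: L2Z.
  have [||||||th dE] := @prim_test_function
      (fun t => I l n * trapezoid x n t - I x n * trapezoid l n t)
      (n.+1%:R^-1) (l - n.+1%:R^-1).
  - by move=> t; apply: cvgB; apply: cvgM; [exact: cvg_cst|exact: trapezoid_continuous..|
      exact: cvg_cst|exact: trapezoid_continuous].
  - by rewrite invr_gt0.
  - by rewrite ltrBlDr ltrDl invr_gt0.
  - by move=> t tn; rewrite !trapezoid0 ?tn// !mulr0 subrr.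
  - move=> t tn; rewrite !trapezoid0 ?tn ?orbT// ?mulr0 ?subrr//.
    by apply/orP; right; apply: le_trans tn; rewrite lerB//; case/andP: xl.
  - rewrite RintegralB//; [|exact: leb_integrable (L2Z _ _)..].
    by rewrite !RintegralZl//; [rewrite mulrC subrr|exact: leb_integrable..].
  have := zh _ th; rewrite dE innerBr ?innerZr//; [|exact: L2Z..].
  by move/eqP; rewrite subr_eq0 => /eqP.
have c2 := @L2_cst _ _ _ mu (leb_lty l) 1.
have Icvg y : 0 <= y <= l -> I y n @[n --> \oo] --> y.
  move=> /[dup] yl /andP[_ yl']; have := trapezoid_inner c2 yl'; rewrite prim_cst// mul1r.
  apply: cvg_trans; apply: near_eq_cvg; apply: nearW => n.
  by apply: eq_Rintegral => t _; rewrite mul1r.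
have L1 : I l n * inner mu z (trapezoid x n) @[n --> \oo] --> l * P z x.
  apply: cvgM; first by apply: Icvg; rewrite lexx ltW.
  by apply: trapezoid_inner => //; case/andP: xl.
have L2' : I x n * inner mu z (trapezoid l n) @[n --> \oo] --> x * P z l.
  by apply: cvgM; [exact: Icvg|exact: trapezoid_inner].
have : l * P z x = x * P z l.
  have L2'' : I l n * inner mu z (trapezoid x n) @[n --> \oo] --> x * P z l.
    by under eq_fun do rewrite key.
  exact: (cvg_unique _ L1 L2'').
by move=> H; apply: (mulfI (lt0r_neq0 l0)); rewrite H; field; rewrite gt_eqF.
Qed.

End weak_derivatives.

(** * The Dirichlet problem on an interval *)

Section dirichlet_problem.
Context {R : realType}.
Variable l : R.
Hypothesis l0 : 0 < l.
Implicit Types (f g u v w : R -> R).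

Local Notation mu := (leb l).
Local Notation P := (prim mu).

(** f belongs to the Sobolev space H^1_0(]0, l[), and v is its derivative. *)
Definition h10 f v : Prop := [/\ ac l f v, f 0 = 0 & f l = 0].

(** - u'' = g with u(0) = u(l) = 0, and v = u'. *)
Definition solves u v g : Prop := h10 u v /\ ac l v (fun x => - g x).

Lemma h10_prim f v x : h10 f v -> 0 <= x <= l -> f x = P v x.
Proof. by move=> [[_ _ fE] f0 _] xl; rewrite fE// f0 add0r. Qed.

Lemma h10D f v g w : h10 f v -> h10 g w ->
  h10 (fun x => f x + g x) (fun x => v x + w x).
Proof.
move=> [fv f0 fl] [gw g0 gl].
by split; [exact: acD|rewrite f0 g0 addr0|rewrite fl gl addr0].
Qed.

Lemma h10Z c f v : h10 f v -> h10 (fun x => c * f x) (fun x => c * v x).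
Proof. by move=> [fv f0 fl]; split; [exact: acZ|rewrite f0 mulr0|rewrite fl mulr0]. Qed.

Lemma h10B f v g w : h10 f v -> h10 g w ->
  h10 (fun x => f x - g x) (fun x => v x - w x).
Proof.
move=> [fv f0 fl] [gw g0 gl].
by split; [exact: acB|rewrite f0 g0 subr0|rewrite fl gl subr0].
Qed.

(** A set of full measure accumulates at both ends of the interval. *)
Lemma within_ae_eq (u0 w : R -> R) : {within `[0, l], continuous u0} -> continuous w ->
  ae_eq mu setT u0 w -> u0 0 = w 0 /\ u0 l = w l.
Proof.
move=> cu cw uw.
have key x : 0 <= x <= l -> (forall d, 0 < d -> exists a b,
    [/\ 0 <= a, a < b, b <= l & forall y, a < y < b -> `|x - y| < d]) -> u0 x = w x.
  move=> xl H; apply/eqP; rewrite -subr_eq0 -normr_eq0; apply/eqP/le_anti.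
  rewrite normr_ge0 andbT; apply/ler_addgt0Pl => e e0; rewrite addr0.
  have e2 : 0 < e / 2 by rewrite divr_gt0.
  have /(_ x) := proj1 (subspace_continuousP (`[0, l]%classic) u0) cu.
  rewrite /= in_itv /= => /(_ xl) /cvgrPdist_lt/(_ _ e2).
  move=> [d1 /= d10 H1].
  have [d2 /= d20 H2] := proj1 (cvgrPdist_lt _ _) (cw x) _ e2.
  have d0 : 0 < Num.min d1 d2 by rewrite lt_min d10.
  have [a [b [a0 ab bl xy]]] := H _ d0.
  have [y yab uwy] := ae_leb_meets uw a0 ab bl.
  have := xy _ yab; rewrite lt_min => /andP[y1 y2].
  have yl : y \in `[0, l].
    by case/andP: yab => ay yb; rewrite in_itv /= (le_trans a0 (ltW ay)) (le_trans (ltW yb) bl).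
  have k1 := H1 y y1 yl; have k2 := H2 y y2.
  rewrite (uwy I) in k1.
  rewrite (_ : u0 x - w x = (u0 x - w y) - (w x - w y)); last by ring.
  by apply: le_trans (ler_normB _ _) _; rewrite ltW// [ltRHS](splitr e) ltrD.
split; apply: key; rewrite ?lexx ?ltW//= => d d0.
  exists 0, (Num.min d l); rewrite lexx lt_min d0 l0 ge_min lexx orbT; split => // y /andP[y0].
  by rewrite lt_min => /andP[yd _]; rewrite sub0r normrN gtr0_norm.
exists (Num.max 0 (l - d)), l; rewrite le_max lexx gt_max l0 ltrBlDr ltrDl d0; split => // y.
move=> /andP[]; rewrite gt_max => /andP[_ ly] yl.
by rewrite gtr0_norm ?subr_gt0// ltrBlDr addrC -ltrBlDr.
Qed.

(** By du Bois-Reymond, the weak derivatives can be replaced by honest primitives. *)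
Lemma dirichlet_graphP f g : op_graph (dirichlet_laplacian l) f g <->
  [/\ L2 mu f, L2 mu g & exists u v, solves u v g /\ ae_eq mu setT f u].
Proof.
split=> [[f2 g2 [u [cu u0 ul fu]] [v [v2 fv vg]]]|[f2 g2 [u [v [[[uv u0 ul] vg] fu]]]]].
  split=> //.
  have ng2 : L2 mu (fun x => - g x).
    by have := L2Z (-1) g2; under eq_fun do rewrite mulN1r.
  have [c fc] := weak_deriv_prim l0 f2 v2 fv.
  have [d vd] := weak_deriv_prim l0 v2 ng2 vg.
  have acf := ac_prim c v2; have acv := ac_prim d ng2.
  have mcv : measurable_fun setT (fun x => c + P v x) by case: acf.
  have mdg : measurable_fun setT (fun x => d + P (fun t => - g t) x) by case: acv.
  exists (fun x => c + P v x), (fun x => d + P (fun t => - g t) x); split=> //.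
  have cP : continuous (fun x => c + P v x).
    by move=> x; apply: cvgD; [exact: cvg_cst|exact: prim_continuous].
  have [e0 el] := within_ae_eq cu cP (ae_eq_trans (ae_eq_sym fu) fc).
  split=> //; split; [|by rewrite -e0|by rewrite -el].
  by apply: ac_ext vd _ acf.
have [mu' v2 _] := uv; have ng2 : L2 mu (fun x => - g x) by case: vg.
split=> //.
  exists (P v); split.
  - exact/continuous_subspaceT/prim_continuous.
  - by rewrite -(h10_prim (And3 uv u0 ul)) ?lexx ?ltW.
  - by rewrite -(h10_prim (And3 uv u0 ul)) ?lexx ?ltW.
  - apply: ae_imp2 fu (leb_ae_itv l) => x /[swap] /andP[x0 xl] /[apply] ->.
    by rewrite -(h10_prim (And3 uv u0 ul)) ?ltW.
exists v; split=> //; last exact: ac_weak_deriv.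
apply: (ae_weak_deriv l0 (f := u) (v := v)) => //.
- exact: L2_measurable f2.
- exact: L2_measurable v2.
- exact: ac_L2 uv.
- exact: ae_eq_sym.
- exact: ae_eq_refl.
- exact: ac_weak_deriv.
Qed.

(** Integrate - g twice; the constant of the first integration makes the second
    primitive vanish at l. *)
Lemma dirichlet_solvable g : L2 mu g -> exists u v, solves u v g.
Proof.
move=> g2; have ng2 : L2 mu (fun x => - g x).
  by have := L2Z (-1) g2; under eq_fun do rewrite mulN1r.
pose d := - (\int[mu]_x P (fun t => - g t) x) / l.
have acv := ac_prim d ng2; have v2 := ac_L2 l0 acv.
have acu := ac_prim 0 v2.
exists (fun x => 0 + P (fun x => d + P (fun t => - g t) x) x), (fun x => d + P (fun t => - g t) x).
split => //; split=> //; first by rewrite add0r (@prim_le0 _ _ _ 0)//; exact: L2_measurable v2.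
rewrite add0r prim_ge//; last exact: L2_measurable v2.
have P2 : L2 mu (P (fun t => - g t)).
  by have := ac_L2 l0 (ac_prim 0 ng2); under [X in L2 _ X]eq_fun do rewrite add0r.
rewrite RintegralD//; [|exact: leb_integrable (leb_L2_cst l d)|exact: leb_integrable].
rewrite leb_Rintegral_cst// /d.
by rewrite mulrAC -mulrA divff ?gt_eqF// mulr1 addNr.
Qed.

Lemma solvesZ c u v g : solves u v g ->
  solves (fun x => c * u x) (fun x => c * v x) (fun x => c * g x).
Proof.
move=> [uv vg]; split; first exact: h10Z.
by have := acZ c vg; under [X in ac _ _ X -> _]eq_fun do rewrite mulrN.
Qed.

Lemma ac_opp_L2 v g : ac l v (fun x => - g x) -> L2 mu g.
Proof.
by case=> _ /(L2Z (-1)) + _; under eq_fun do rewrite mulN1r opprK.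
Qed.

(** Integration by parts; the boundary terms vanish because f does. *)
Lemma solves_energy f df u v g : h10 f df -> solves u v g -> inner mu df v = inner mu f g.
Proof.
move=> [fd f0 fl] [_ vg]; rewrite (ac_by_parts l0 fd vg) f0 fl !mul0r subrr sub0r.
have g2 := ac_opp_L2 vg; have f2 := ac_L2 l0 fd.
rewrite (_ : (fun x => - g x) = fun x => -1 * g x); last by apply/funext => x; rewrite mulN1r.
by rewrite innerZr// mulN1r opprK.
Qed.

(** Both sides are the inner product of the derivatives. *)
Lemma solves_sym u v g u' v' g' : solves u v g -> solves u' v' g' ->
  inner mu u g' = inner mu g u'.
Proof.
move=> s s'; rewrite -(solves_energy s.1 s') [RHS]innerC -(solves_energy s'.1 s).
exact: innerC.
Qed.

Lemma L2norm_sup f M : 0 <= M -> measurable_fun setT f ->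
  (forall x, 0 < x < l -> `|f x| <= M) -> L2norm mu f <= M * Num.sqrt l.
Proof.
move=> M0 mf fM; rewrite -(@ler_pXn2r _ 2) ?nnegrE ?mulr_ge0 ?sqrtr_ge0 ?L2norm_ge0//.
rewrite exprMn sqr_sqrtr ?(ltW l0)// L2norm_sqr.
have f2 := ae_bounded_L2 mf fM.
rewrite -lee_fin /Rintegral fineK; last first.
  by apply: integrable_fin_num => //; exact: L2_sqr_integrable.
rewrite EFinM -(leb_setT l0) -(integral_cst mu measurableT (M ^+ 2)%:E).
apply: ae_ge0_le_integral => //.
- by move=> t _; rewrite lee_fin sqr_ge0.
- by apply/measurable_EFinP; exact: measurable_funX.
- by move=> t _; rewrite lee_fin sqr_ge0.
- apply: ae_imp (leb_ae_itv l) => x xl _; rewrite lee_fin -[leLHS]real_normK ?num_real//.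
  by rewrite lerXn2r ?nnegrE// fM.
Qed.

(** A Poincare type estimate: the primitive of - g is bounded by sqrt l |g|, its
    mean value determines v 0, and one more integration bounds u. *)
Lemma solves_bound u v g : solves u v g -> L2norm mu u <= 2 * l ^+ 2 * L2norm mu g.
Proof.
move=> [huv vg]; have [uv u0 ul] := huv.
have g2 := ac_opp_L2 vg.
pose C := Num.sqrt l * L2norm mu g.
have C0 : 0 <= C by rewrite mulr_ge0 ?sqrtr_ge0 ?L2norm_ge0.
have ng2 : L2 mu (fun x => - g x) by case: vg.
have PC x : `|P (fun t => - g t) x| <= C.
  by rewrite /C -(L2normN mu g); exact: prim_bound.
have [mv v2 vE] := vg.
have mv' := L2_measurable v2.
have P2 : L2 mu (P (fun t => - g t)).
  by have := ac_L2 l0 (ac_prim 0 ng2); under [X in L2 _ X]eq_fun do rewrite add0r.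
have [mu' vL2 _] := uv.
have v00 : v 0 * l = - \int[mu]_x P (fun t => - g t) x.
  have := ac_end l0 uv; rewrite u0 ul add0r => /esym.
  rewrite (@ae_eq_Rintegral _ _ _ mu _ (fun x => v 0 + P (fun t => - g t) x))//.
  - rewrite RintegralD//; [|exact: leb_integrable (leb_L2_cst l (v 0))|exact: leb_integrable].
    rewrite leb_Rintegral_cst//.
    by move/eqP; rewrite addr_eq0 => /eqP.
  - by apply: measurable_funD => //; exact: prim_measurable.
  - by apply: ae_imp (leb_ae_itv l) => x /andP[x0 xl] _; rewrite vE// !ltW.
have v0C : `|v 0| <= C.
  rewrite -(ler_pM2r l0) -{1}(gtr0_norm l0) -normrM v00 normrN.
  apply: le_trans (le_normr_Rintegral measurableT (leb_integrable P2)) _.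
  apply: (@le_trans _ _ (\int[mu]_x cst C x)); last by rewrite leb_Rintegral_cst.
  apply: le_Rintegral => //.
  - by have := integrable_abse (leb_integrable P2).
  - exact: leb_integrable (leb_L2_cst l C).
have vC x : 0 < x < l -> `|v x| <= 2 * C.
  move=> /andP[x0 xl]; have xl' : 0 <= x <= l by rewrite !ltW.
  rewrite (vE _ xl'); apply: le_trans (ler_normD _ _) _.
  by rewrite mulr_natl mulr2n lerD.
have vn : L2norm mu v <= 2 * C * Num.sqrt l by apply: L2norm_sup => //; rewrite mulr_ge0.
have uC x : 0 < x < l -> `|u x| <= Num.sqrt l * (2 * C * Num.sqrt l).
  move=> /andP[x0 xl]; have xl' : 0 <= x <= l by rewrite !ltW.
  rewrite (h10_prim huv xl').
  by apply: le_trans (prim_bound l0 x vL2) _; rewrite ler_wpM2l ?sqrtr_ge0.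
apply: le_trans (L2norm_sup _ mu' uC) _; first by apply: mulr_ge0; rewrite ?sqrtr_ge0// mulr_ge0 ?sqrtr_ge0// mulr_ge0.
have sl := sqr_sqrtr (ltW l0).
rewrite /C [leLHS](_ : _ = 2 * (Num.sqrt l ^+ 2) ^+ 2 * L2norm mu g); last by ring.
by rewrite sl.
Qed.

(** The derivatives converge to some V, whose primitive is the uniform limit of the
    f n and hence 0; so V = 0. *)
Lemma h10_closable (f v : nat -> R -> R) : (forall n, h10 (f n) (v n)) ->
  L2norm mu (f n) @[n --> \oo] --> (0 : R) ->
  (forall e : R, 0 < e -> exists N, forall m n, (N <= m)%N -> (N <= n)%N ->
     L2norm mu (fun x => v m x - v n x) <= e) ->
  L2norm mu (v n) @[n --> \oo] --> (0 : R).
Proof.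
move=> fv f0 vC.
have v2 n : L2 mu (v n) by have [[]] := fv n.
have f2 n : L2 mu (f n) by have [h _ _] := fv n; exact: ac_L2 h.
have [V V2 vV] := L2_complete (leb_lty l) v2 vC.
suff V0 : ae_eq mu setT V (cst 0).
  rewrite (_ : (fun n => L2norm mu (v n)) = fun n => L2norm mu (fun x => v n x - V x))//.
  apply/funext => n; apply: ae_eq_L2norm.
  - exact: L2_measurable (v2 n).
  - exact: L2_measurable (L2B (v2 n) V2).
  - by apply: ae_imp V0 => x /[apply] ->; rewrite subr0.
have PV2 : L2 mu (P V).
  by have := ac_L2 l0 (ac_prim 0 V2); under [X in L2 _ X]eq_fun do rewrite add0r.
suff PV0 : L2norm mu (P V) = 0.
  apply: (prim_inj l0) => //; first exact: L2_0.
  move=> x xl; rewrite (prim_ae0 l0 V2 (L2norm_eq0 PV2 PV0) xl).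
  by rewrite prim_cst// mul0r.
apply/le_anti; rewrite L2norm_ge0 andbT.
have Pb n : L2norm mu (P V) <=
    L2norm mu (f n) + Num.sqrt l * L2norm mu (fun x => v n x - V x) * Num.sqrt l.
  have fP2 : L2 mu (fun x => P V x - f n x) by exact: L2B.
  rewrite (_ : P V = fun x => f n x + (P V x - f n x)); last first.
    by apply/funext => x; rewrite addrC subrK.
  apply: le_trans (L2norm_triangle (f2 n) fP2) _; rewrite lerD2l.
  apply: L2norm_sup; first by rewrite mulr_ge0 ?sqrtr_ge0 ?L2norm_ge0.
    exact: L2_measurable fP2.
  move=> x /andP[x0 xl]; have xl' : 0 <= x <= l by rewrite !ltW.
  rewrite distrC (h10_prim (fv n) xl') -primB//.
  exact/prim_bound/L2B.
have : (fun n => L2norm mu (f n) + Num.sqrt l * L2norm mu (fun x => v n x - V x) * Num.sqrt l)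
    @ \oo --> (0 : R).
  rewrite -[X in _ --> X]addr0; apply: cvgD => //.
  rewrite -[X in _ --> X](mul0r (Num.sqrt l)); apply: cvgM; last exact: cvg_cst.
  by rewrite -[X in _ --> X](mulr0 (Num.sqrt l)); apply: cvgM; [exact: cvg_cst|].
by move=> /cvgr_to_ge; apply; apply: nearW => n; exact: Pb.
Qed.

End dirichlet_problem.

(** * Spectral theory on one interval *)

Section fundamental_solutions.
Context {R : realType}.
Implicit Types (l lambda : R) (s c : R -> R).

(** The solutions of y'' = - lambda y with the initial values of sin and cos; the
    last identity is the conservation of energy. *)
Definition fundamental lambda s c : Prop :=
  [/\ forall x : R, is_derive x (1 : R) s (c x),
      forall x : R, is_derive x (1 : R) c (- (lambda * s x)),
      s 0 = 0, c 0 = 1 & forall x, c x ^+ 2 + lambda * s x ^+ 2 = 1].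

Let is_derive_lin (w x : R) : is_derive x (1 : R) (fun y : R => w * y) w.
Proof. by have := is_deriveZ w (is_derive_id (x : R^o) (1 : R^o)); rewrite /GRing.scale /= mulr1. Qed.

Let sin_eq0 (x : R) : 0 < x -> sin x = 0 -> exists k, x = k.+1%:R * pi.
Proof.
move=> x0 sx; have p0 := pi_gt0 R.
have /andP[k1 k2] := truncn_itv (ltW (divr_gt0 x0 p0)).
set k := Num.trunc (x / pi) in k1 k2.
pose r := x - k%:R * pi.
have r0 : 0 <= r by rewrite subr_ge0 -ler_pdivlMr.
have rp : r < pi by move: k2; rewrite ltr_pdivrMr// -natr1 mulrDl mul1r ltrBlDl.
have xE : x = r + pi *+ k by rewrite /r -[pi *+ k]mulr_natl subrK.
have : sin r = 0.
  move: sx; rewrite xE (alternatingn (@sinDpi R)) => /eqP.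
  by rewrite mulf_eq0 signr_eq0 /= => /eqP.
have [r00 _|rn0] := eqVneq r 0; last first.
  by have := @sin_gt0_pi R r; rewrite lt_neqAle eq_sym rn0 r0 rp => /(_ isT) + sr; rewrite sr ltxx.
move: xE; rewrite r00 add0r; case: (k) => [|n] xE.
  by move: x0; rewrite xE mulr0n ltxx.
by exists n; rewrite xE mulr_natl.
Qed.

(** Hyperbolic, circular or linear functions, according to the sign of lambda. *)
Lemma fundamental_exists lambda : exists s c, fundamental lambda s c /\
  (forall l, 0 < l ->
    (s l = 0 <-> exists k : nat, lambda = pi ^+ 2 * k.+1%:R ^+ 2 / l ^+ 2)).
Proof.
have [ln|lp|->] := ltrgtP lambda 0.
- pose w := Num.sqrt (- lambda).
  have w0 : 0 < w by rewrite sqrtr_gt0 oppr_gt0.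
  have w2 : w ^+ 2 = - lambda by rewrite sqr_sqrtr// oppr_ge0 ltW.
  have wn : w != 0 by rewrite gt_eqF.
  have d1 x : is_derive x (1 : R) (fun y => expR (w * y)) (expR (w * x) * w).
    exact: (is_derive1_comp (is_derive_expR _) (is_derive_lin w x)).
  have d2 x : is_derive x (1 : R) (fun y => expR (- w * y)) (expR (- w * x) * - w).
    exact: (is_derive1_comp (is_derive_expR _) (is_derive_lin (- w) x)).
  pose E x := expR (w * x); pose F x := expR (- w * x).
  have EF x : E x * F x = 1 by rewrite /E /F -expRD mulNr subrr expR0.
  exists (fun x => (2 * w)^-1 * (E x - F x)), (fun x => 2^-1 * (E x + F x)).
  split; first split.
  + move=> x; apply: (is_derive_eq (is_deriveZ (2 * w)^-1 (is_deriveB (d1 x) (d2 x)))).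
    by rewrite /GRing.scale /= /E /F; field.
  + move=> x; apply: (is_derive_eq (is_deriveZ 2^-1 (is_deriveD (d1 x) (d2 x)))); rewrite /GRing.scale /= /E /F.
    by rewrite -[lambda]opprK -w2; field.
  + by rewrite /E /F !mulr0 subrr mulr0.
  + by rewrite /E /F !mulr0 expR0; field.
  + move=> x; rewrite -[lambda]opprK -w2; transitivity (E x * F x); last exact: EF.
    by field.
  move=> l l0; split=> [/eqP|[k lE]].
    rewrite mulf_eq0 invr_eq0 mulf_eq0 pnatr_eq0 (negbTE wn) /= subr_eq0 => /eqP /expR_inj.
    move=> /eqP; rewrite mulNr -addr_eq0 -mulr2n -mulrnAr mulf_eq0 (negbTE wn) /= mulrn_eq0 /=.
    by rewrite gt_eqF.
  have : 0 <= lambda by rewrite lE divr_ge0 ?sqr_ge0// mulr_ge0 ?sqr_ge0.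
  by rewrite leNgt ln.
- pose w := Num.sqrt lambda.
  have w0 : 0 < w by rewrite sqrtr_gt0.
  have w2 : w ^+ 2 = lambda by rewrite sqr_sqrtr// ltW.
  have wn : w != 0 by rewrite gt_eqF.
  exists (fun x => w^-1 * sin (w * x)), (fun x => cos (w * x)).
  split; first split.
  + move=> x; apply: (is_derive_eq (is_deriveZ w^-1 (is_derive1_comp (is_derive_sin _) (is_derive_lin w x)))).
    by rewrite /GRing.scale /=; field.
  + move=> x; apply: (is_derive_eq (is_derive1_comp (is_derive_cos _) (is_derive_lin w x))).
    by rewrite -w2; field.
  + by rewrite mulr0 sin0 mulr0.
  + by rewrite mulr0 cos0.
  + by move=> x; rewrite exprMn mulrA -w2 exprVn divff ?expf_neq0// mul1r cos2Dsin2.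
  move=> l l0; split=> [/eqP|[k lE]].
    rewrite mulf_eq0 invr_eq0 (negbTE wn) /= => /eqP /(sin_eq0 (mulr_gt0 w0 l0)) [k wl].
    exists k; rewrite -w2; apply: (mulIf (expf_neq0 2 (lt0r_neq0 l0))).
    rewrite -exprMn wl exprMn mulrC -[RHS]mulrA mulVf ?mulr1//.
    by rewrite expf_neq0// gt_eqF.
  have wE : w = pi * k.+1%:R / l.
    apply/eqP; rewrite -(@eqrXn2 _ 2)// ?(ltW w0)//; last first.
      by rewrite !mulr_ge0 ?pi_ge0// invr_ge0 ltW.
    by rewrite w2 lE; apply/eqP; field; rewrite gt_eqF.
  have -> : w * l = 0 + pi *+ k.+1.
    by rewrite wE add0r -mulr_natr; field; rewrite gt_eqF.
  by rewrite (alternatingn (@sinDpi R)) sin0 !mulr0.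
- exists id, (cst 1); split; first split.
  + by move=> x; exact: is_derive_id.
  + by move=> x; rewrite mul0r oppr0; exact: is_derive_cst.
  + by [].
  + by [].
  + by move=> x; rewrite mul0r addr0 expr1n.
  move=> l l0; split=> [/= l00|[k]]; first by move: l0; rewrite l00 ltxx.
  move/eqP; rewrite eq_sym gt_eqF// divr_gt0 ?mulr_gt0 ?exprn_gt0 ?pi_gt0//.
Qed.

End fundamental_solutions.

Section variation_of_constants.
Context {R : realType}.
Variables (l lambda : R) (s c : R -> R).
Hypothesis l0 : 0 < l.
Hypothesis sc : fundamental lambda s c.
Implicit Types (f g k u v : R -> R).

Local Notation mu := (leb l).
Local Notation P := (prim mu).

Let s_continuous : continuous s.
Proof.
case: sc => sd _ _ _ _ x; apply: differentiable_continuous.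
by apply/derivable1_diffP; have [] := sd x.
Qed.

Let c_continuous : continuous c.
Proof.
case: sc => _ cd _ _ _ x; apply: differentiable_continuous.
by apply/derivable1_diffP; have [] := cd x.
Qed.

Lemma fundamental_ac : ac l s c /\ ac l c (fun x => - (lambda * s x)).
Proof.
have [sd cd s0 c0 cs] := sc; split; first exact: ac_C1.
apply: ac_C1 => // x; apply: cvgN; apply: cvgM; [exact: cvg_cst|exact: s_continuous].
Qed.

Lemma fundamental_bound : exists2 M, 0 <= M &
  forall x, 0 <= x <= l -> `|s x| <= M /\ `|c x| <= M.
Proof.
have [M1 M10 sM] := continuous_bounded l0 s_continuous.
have [M2 M20 cM] := continuous_bounded l0 c_continuous.
exists (M1 + M2); first exact: addr_ge0.
by move=> x xl; split; [rewrite (le_trans (sM x xl))// lerDl|rewrite (le_trans (cM x xl))// lerDr].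
Qed.

Let ms : measurable_fun setT s. Proof. exact: continuous_measurable_fun. Qed.
Let mc : measurable_fun setT c. Proof. exact: continuous_measurable_fun. Qed.

(** If s were null, so would be its derivative c, against the conservation of
    energy. *)
Lemma fundamental_neq0 : 0 < L2norm mu s.
Proof.
have [acs acc] := fundamental_ac.
rewrite lt_neqAle eq_sym L2norm_ge0 andbT; apply/eqP => sn.
have s2 := ac_L2 l0 acs; have s_0 := L2norm_eq0 s2 sn.
have [_ c2 sE] := acs.
have [_ _ s00 c00 cs] := sc.
have Pc0 : ae_eq mu setT (P c) (cst 0).
  apply: ae_imp2 s_0 (leb_ae_itv l) => x /[swap] /andP[x0 xl] /[apply] /=.
  by rewrite sE ?s00 ?add0r// !ltW.
have c_0 : ae_eq mu setT c (cst 0).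
  apply: (prim_inj l0) => //; first exact: L2_0.
  by move=> x xl; rewrite (prim_ae0 l0 c2 Pc0 xl) prim_cst// mul0r.
have sc0 : \forall x \ae mu, s x = 0 /\ c x = 0.
  by apply: ae_imp2 s_0 c_0 => x /(_ I) sx /(_ I) cx.
have [x _ [sx cx]] := ae_leb_meets sc0 (lexx 0) l0 (lexx l).
by have := cs x; rewrite sx cx expr0n /= mulr0 addr0 => /eqP; rewrite eq_sym oner_eq0.
Qed.

Lemma L2_mul_fundamental k : L2 mu k ->
  L2 mu (fun x => k x * s x) /\ L2 mu (fun x => k x * c x).
Proof. by move=> k2; have [acs acc] := fundamental_ac; split; apply: ac_L2_mul k2 => //; [exact: acs|exact: acc]. Qed.

(** With k = g - lambda u, the functions u c - u' s and lambda u s + u' c have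
    the derivatives k s and - k c; solving for u gives Duhamel's formula. *)
Lemma duhamel u v g : solves l u v g ->
  let k := fun x => g x - lambda * u x in
  forall x, 0 <= x <= l ->
  u x = c x * P (fun t => k t * s t) x + s x * (v 0 - P (fun t => k t * c t) x).
Proof.
move=> [[uv u0 ul] vg] k x xl.
have [acs acc] := fundamental_ac; have [_ _ s0 c0 cs] := sc.
have g2 := ac_opp_L2 vg; have u2 := ac_L2 l0 uv.
have k2 : L2 mu k by apply: L2B => //; exact: L2Z.
have [ks2 kc2] := L2_mul_fundamental k2.
have [_ _ pE] : ac l (fun x => u x * c x - v x * s x) (fun x => k x * s x).
  rewrite (_ : (fun x => k x * s x) = fun x => v x * c x + - (lambda * s x) * u x -
    (- g x * s x + c x * v x)); first exact: acB (acM l0 uv acc) (acM l0 vg acs).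
  by apply/funext => t; rewrite /k; ring.
have [_ _ qE] : ac l (fun x => lambda * (u x * s x) + v x * c x) (fun x => -1 * (k x * c x)).
  rewrite (_ : (fun x => -1 * (k x * c x)) = fun x => lambda * (v x * s x + c x * u x) +
    (- g x * c x + - (lambda * s x) * v x)).
    exact: acD (acZ lambda (acM l0 uv acs)) (acM l0 vg acc).
  by apply/funext => t; rewrite /k; ring.
have := qE x xl; rewrite primZ//; have := pE x xl.
rewrite /= u0 s0 c0 !mul0r !mulr0 subrr !add0r mulr1 => <- q.
rewrite (_ : v 0 - _ = lambda * (u x * s x) + v x * c x); last by rewrite q mulN1r.
rewrite -[LHS]mulr1 -(cs x); ring.
Qed.

Lemma duhamel_eigen u v g : solves l u v g ->
  ae_eq mu setT g (fun x => lambda * u x) ->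
  forall x, 0 <= x <= l -> u x = v 0 * s x.
Proof.
move=> sol gu x xl; rewrite (duhamel sol xl).
have [[uv _ _] vg] := sol.
have g2 := ac_opp_L2 vg; have u2 := ac_L2 l0 uv.
have k2 : L2 mu (fun x => g x - lambda * u x) by apply: L2B => //; exact: L2Z.
have [ks2 kc2] := L2_mul_fundamental k2.
rewrite (@ae_eq_prim _ l _ (cst 0))//; last first.
- by apply: ae_imp gu => t /[apply] -> /=; rewrite subrr mul0r.
- exact: L2_measurable ks2.
rewrite (@ae_eq_prim _ l (fun t => (g t - lambda * u t) * c t) (cst 0))//; last first.
- by apply: ae_imp gu => t /[apply] -> /=; rewrite subrr mul0r.
- exact: L2_measurable kc2.
by rewrite prim_cst// mul0r mulr0 subr0 add0r mulrC.
Qed.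

(** As u vanishes at l and s l is not 0, Duhamel's formula at l determines v 0. *)
Lemma duhamel_bound : s l != 0 -> exists2 C, 0 <= C & forall u v g, solves l u v g ->
  L2norm mu u <= C * L2norm mu (fun x => g x - lambda * u x).
Proof.
move=> sl; have [M M0 scM] := fundamental_bound.
pose B := Num.sqrt l * M; have B0 : 0 <= B by rewrite mulr_ge0 ?sqrtr_ge0.
pose D := B + M * B / `|s l|.
have D0 : 0 <= D by rewrite addr_ge0// divr_ge0// mulr_ge0.
exists ((M * B + M * (D + B)) * Num.sqrt l).
  by rewrite mulr_ge0 ?sqrtr_ge0// addr_ge0 ?mulr_ge0// addr_ge0.
move=> u v g sol; have [[uv u0 ul] vg] := sol.
set k := fun x => g x - lambda * u x.
have g2 := ac_opp_L2 vg; have u2 := ac_L2 l0 uv.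
have k2 : L2 mu k by apply: L2B => //; exact: L2Z.
have [ks2 kc2] := L2_mul_fundamental k2.
have n0 := L2norm_ge0 mu k.
have mulb (w : R -> R) x : measurable_fun setT w -> (forall x, 0 <= x <= l -> `|w x| <= M) ->
    `|P (fun t => k t * w t) x| <= B * L2norm mu k.
  move=> mw wM; have cM t : 0 < t < l -> `|cut w x t| <= M.
    move=> /andP[t0 tl]; apply: le_trans (cut_norm_le _ _ _) _.
    by apply: wM; rewrite !ltW.
  have mcw := measurable_cut x mw.
  have cw2 : L2 mu (cut w x) := ae_bounded_L2 mcw cM.
  have -> : P (fun t => k t * w t) x = inner mu k (cut w x).
    by apply: eq_Rintegral => t _; rewrite /cut mulrA.
  apply: le_trans (cauchy_schwarz k2 cw2) _; rewrite mulrC ler_wpM2r//.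
  by rewrite /B mulrC; exact: (L2norm_sup l0).
have sb x := mulb s x ms (fun x xl => (scM x xl).1).
have cb x := mulb c x mc (fun x xl => (scM x xl).2).
have inl : 0 <= l <= l by rewrite lexx ltW.
set N := L2norm mu k in n0 sb cb *.
have v0E : v 0 = P (fun t => k t * c t) l - c l * P (fun t => k t * s t) l / s l.
  have := duhamel sol inl; rewrite ul => /eqP; rewrite eq_sym addrC addr_eq0 => /eqP H.
  apply: (mulfI sl); rewrite mulrBr; apply/eqP; rewrite -subr_eq0; apply/eqP.
  rewrite -/k in H; transitivity (s l * (v 0 - P (fun t => k t * c t) l) + c l * P (fun t => k t * s t) l).
    by field.
  by rewrite H addNr.
have v0b : `|v 0| <= D * N.
  rewrite v0E; apply: le_trans (ler_normB _ _) _; rewrite /D mulrDl; apply: lerD => //.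
  rewrite normrM normfV [leRHS]mulrAC ler_wpM2r ?invr_ge0// normrM.
  rewrite -mulrA; apply: ler_pM => //; exact: (scM l inl).2.
have ub x : 0 < x < l -> `|u x| <= (M * B + M * (D + B)) * N.
  move=> /andP[x0 xl]; have xl' : 0 <= x <= l by rewrite !ltW.
  have -> : u x = c x * P (fun t => k t * s t) x + s x * (v 0 - P (fun t => k t * c t) x).
    by have := duhamel sol xl'.
  apply: le_trans (ler_normD _ _) _.
  rewrite mulrDl -(mulrA M B) -(mulrA M (D + B)); apply: lerD; rewrite normrM; apply: ler_pM => //.
  - exact: (scM x xl').2.
  - exact: (scM x xl').1.
  - by apply: le_trans (ler_normB _ _) _; rewrite mulrDl lerD.
rewrite [leRHS]mulrAC; apply: (L2norm_sup l0) ub.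
  by rewrite mulr_ge0// addr_ge0 ?mulr_ge0// addr_ge0.
by case: uv.
Qed.

(** Duhamel's formula, with the value of v 0 for which u vanishes at l. *)
Lemma duhamel_solve k : s l != 0 -> L2 mu k ->
  exists u v, solves l u v (fun x => k x + lambda * u x).
Proof.
move=> sl k2; have [ks2 kc2] := L2_mul_fundamental k2.
have [acs acc] := fundamental_ac; have [_ _ s0 c0 cs] := sc.
pose S x := 0 + P (fun t => k t * s t) x.
pose C x := 0 + P (fun t => k t * c t) x.
have Sac : ac l S (fun x => k x * s x) by exact: ac_prim.
have Cac : ac l C (fun x => k x * c x) by exact: ac_prim.
pose a := C l - c l * S l / s l.
have [M1 M2] : measurable_fun setT S /\ measurable_fun setT C by case: Sac Cac => + _ _ [].
pose u x := c x * S x + s x * (a - C x).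
pose v x := - (lambda * s x) * S x + c x * (a - C x).
have aCac : ac l (fun x => a - C x) (fun x => 0 - k x * c x) by exact: acB (ac_cst l a) Cac.
have uv : ac l u v.
  rewrite (_ : v = fun x => (- (lambda * s x) * S x + k x * s x * c x) +
      (c x * (a - C x) + (0 - k x * c x) * s x)).
    exact: acD (acM l0 acc Sac) (acM l0 acs aCac).
  by apply/funext => x; rewrite /v; ring.
exists u, v; split.
  split=> //.
    rewrite /u s0 mul0r addr0 /S prim_le0 ?addr0 ?mulr0//; exact: L2_measurable ks2.
  by rewrite /u /a; field.
have vg : ac l v (fun x => -1 * (lambda * (c x * S x + k x * s x * s x)) +
    (- (lambda * s x) * (a - C x) + (0 - k x * c x) * c x)).
  rewrite (_ : v = fun x => -1 * (lambda * (s x * S x)) + c x * (a - C x)).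
    exact: acD (acZ (-1) (acZ lambda (acM l0 acs Sac))) (acM l0 acc aCac).
  by apply/funext => x; rewrite /v; ring.
rewrite (_ : (fun x => - _) = fun x => -1 * (lambda * (c x * S x + k x * s x * s x)) +
    (- (lambda * s x) * (a - C x) + (0 - k x * c x) * c x))//.
apply/funext => x; transitivity (- (k x * (c x ^+ 2 + lambda * s x ^+ 2) + lambda * u x)).
  by rewrite cs mulr1.
by rewrite /u; ring.
Qed.

End variation_of_constants.

Section dirichlet_spectrum.
Context {R : realType}.
Variables (l lambda : R) (s c : R -> R).
Hypothesis l0 : 0 < l.
Hypothesis sc : fundamental lambda s c.
Implicit Types (f g k u v : R -> R).

Local Notation mu := (leb l).
Local Notation D := (dirichlet_laplacian l).

Lemma dirichlet_graph_L2 f g : op_graph D f g -> L2 mu f /\ L2 mu g.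
Proof. by case. Qed.

Lemma dirichlet_graph_ae f f' g g' : op_graph D f g ->
  measurable_fun setT f' -> measurable_fun setT g' ->
  ae_eq mu setT f f' -> ae_eq mu setT g g' -> op_graph D f' g'.
Proof.
move=> /(dirichlet_graphP l0)[f2 g2 [u [v [[uv vg] fu]]]] mf' mg' ff gg.
apply/(dirichlet_graphP l0); split; [exact: ae_eq_L2 ff f2|exact: ae_eq_L2 gg g2|].
exists u, v; split; last exact: ae_eq_trans (ae_eq_sym ff) fu.
split=> //; apply: ac_ext vg => //; first by case: uv => -[] _ /L2_measurable.
- by apply: ae_imp gg => x /[apply] ->.
- exact: measurableT_comp.
Qed.

Let shift_ae f u g : ae_eq mu setT f u -> L2 mu f -> L2 mu u -> L2 mu g ->
  L2norm mu f = L2norm mu u /\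
  L2norm mu (fun x => g x - lambda * f x) = L2norm mu (fun x => g x - lambda * u x).
Proof.
move=> fu f2 u2 g2; split; apply: ae_eq_L2norm => //; try exact: L2_measurable.
- exact: L2_measurable f2.
- exact: L2_measurable u2.
- exact: L2_measurable (L2B g2 (L2Z lambda f2)).
- exact: L2_measurable (L2B g2 (L2Z lambda u2)).
- by apply: ae_imp fu => x /[apply] ->.
Qed.

Lemma dirichlet_resolvent : s l != 0 ->
  (forall g, L2 mu g -> exists f, op_graph D f (fun x => g x + lambda * f x)) /\
  exists2 C, 0 <= C & forall f g, op_graph D f g ->
    L2norm mu f <= C * L2norm mu (fun x => g x - lambda * f x).
Proof.
move=> sl; split=> [g g2|].
  have [u [v sol]] := duhamel_solve l0 sc sl g2.
  have u2 : L2 mu u by have [[h _ _] _] := sol; exact: ac_L2 h.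
  exists u; apply/(dirichlet_graphP l0); split => //; first by apply: L2D => //; exact: L2Z.
  by exists u, v; split => //; exact: ae_eq_refl.
have [C C0 CP] := duhamel_bound l0 sc sl.
exists C => // f g /(dirichlet_graphP l0)[f2 g2 [u [v [sol fu]]]].
have u2 : L2 mu u by have [[h _ _] _] := sol; exact: ac_L2 h.
by have [-> ->] := shift_ae fu f2 u2 g2; exact: CP sol.
Qed.

(** On a short interval the term lambda f is absorbed by the left-hand side of
    [solves_bound]. The factor does not involve lambda, which makes the bound
    uniform over all but finitely many intervals of a string. *)
Lemma dirichlet_small f g : 4 * `|lambda| * l ^+ 2 <= 1 -> op_graph D f g ->
  L2norm mu f <= 4 * l ^+ 2 * L2norm mu (fun x => g x - lambda * f x).
Proof.
move=> small /(dirichlet_graphP l0)[f2 g2 [u [v [sol fu]]]].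
have u2 : L2 mu u by have [[h _ _] _] := sol; exact: ac_L2 h.
have [-> ->] := shift_ae fu f2 u2 g2.
have b1 := solves_bound l0 sol.
have b2 : L2norm mu g <= L2norm mu (fun x => g x - lambda * u x) + `|lambda| * L2norm mu u.
  rewrite -L2normZ//; have := L2norm_triangle (L2B g2 (L2Z lambda u2)) (L2Z lambda u2).
  by rewrite (_ : (fun x => _ + _) = g)//; apply/funext => x; rewrite subrK.
have n1 := L2norm_ge0 mu u.
have l2 : 0 <= l ^+ 2 by rewrite sqr_ge0.
set X := L2norm mu u in b1 b2 n1 *; set Y := L2norm mu (fun x => _ - _) in b2 *.
set G := L2norm mu g in b1 b2; set A := `|lambda| in small b2.
have b3 : 2 * l ^+ 2 * G <= 2 * l ^+ 2 * (Y + A * X) by rewrite ler_wpM2l// mulr_ge0.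
have b4 : 4 * A * l ^+ 2 * X <= 1 * X by rewrite ler_wpM2r.
by lra.
Qed.

Lemma dirichlet_eigen : s l = 0 -> op_graph D s (fun x => lambda * s x).
Proof.
move=> sl; have [acs acc] := fundamental_ac l0 sc; have [_ _ s0 _ _] := sc.
have s2 := ac_L2 l0 acs.
apply/(dirichlet_graphP l0); split => //; first exact: L2Z.
by exists s, c; split => //; exact: ae_eq_refl.
Qed.

Lemma dirichlet_eigenP f : op_graph D f (fun x => lambda * f x) ->
  (exists a, ae_eq mu setT f (fun x => a * s x)) /\ (s l != 0 -> ae_eq mu setT f (cst 0)).
Proof.
move=> /(dirichlet_graphP l0)[f2 g2 [u [v [sol fu]]]].
have u2 : L2 mu u by have [[h _ _] _] := sol; exact: ac_L2 h.
have gu : ae_eq mu setT (fun x => lambda * f x) (fun x => lambda * u x).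
  by apply: ae_imp fu => x /[apply] ->.
have uE := duhamel_eigen l0 sc sol gu.
have fE : ae_eq mu setT f (fun x => v 0 * s x).
  apply: ae_imp2 fu (leb_ae_itv l) => x /[swap] /andP[x0 xl] /[apply] ->.
  by rewrite uE ?ltW.
split=> [|sl]; first by exists (v 0).
have := uE l; rewrite lexx ltW// => /(_ isT).
have [[_ _ ->] _] := sol; move/esym/eqP; rewrite mulf_eq0 (negbTE sl) orbF => /eqP v00.
by apply: ae_imp fE => x /[apply] ->; rewrite v00 mul0r.
Qed.

End dirichlet_spectrum.

(** * Spectral theory of a fractal string *)

Lemma esum_mull_le {R : realType} (J : choiceType) (k : R) (a : J -> \bar R) : 0 <= k ->
  (forall j, (0 <= a j)%E) ->
  (\esum_(j in [set: J]) (k%:E * a j) <= k%:E * \esum_(j in [set: J]) a j)%E.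
Proof.
move=> k0 a0; apply: ge_ereal_sup => _ [X [finX _] <-].
rewrite -ge0_mule_fsumr//; apply: lee_wpmul2l; first by rewrite lee_fin.
by apply: esum_ge; exists X.
Qed.

Lemma esum_term_le {R : realType} (J : choiceType) (a : J -> \bar R) j :
  (forall j, (0 <= a j)%E) -> (a j <= \esum_(j in [set: J]) a j)%E.
Proof.
move=> a0; apply: esum_ge; exists [set j]; first by split => //; exact: finite_set1.
by rewrite fsbig_set1.
Qed.

Section string_operator.
Context {R : realType} (J : choiceType) (L : J -> R).
Hypothesis L0 : forall j, 0 < L j.
Hypothesis L_small : forall e : R, 0 < e -> finite_set [set j | e < L j].
Variables (lambda : R) (s c : R -> R).
Hypothesis sc : fundamental lambda s c.

Local Notation D j := (dirichlet_laplacian (L j)).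
Local Notation A := (direct_sum (fun j : J => D j)).
Local Notation mu j := (leb (L j)).

Definition component (f : J * R -> R) (j : J) : R -> R := fun x => f (j, x).

Definition sum_norm2 (f : J * R -> R) : \bar R :=
  (\esum_(j in [set: J]) (L2norm (mu j) (component f j) ^+ 2)%:E)%E.

Implicit Types f g : J * R -> R.

Lemma sum_memP f : op_mem A f <->
  (forall j, L2 (mu j) (component f j)) /\ (sum_norm2 f < +oo)%E.
Proof. by []. Qed.

Lemma sum_normE f : op_norm A f = Num.sqrt (fine (sum_norm2 f)).
Proof. by []. Qed.

Lemma sum_graphP f g : op_graph A f g <->
  [/\ op_mem A f, op_mem A g & forall j, op_graph (D j) (component f j) (component g j)].
Proof. by []. Qed.

Lemma sum_norm2_ge0 f : (0 <= sum_norm2 f)%E.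
Proof. by apply: esum_ge0 => j _; rewrite lee_fin sqr_ge0. Qed.

Lemma sum_norm2_le f g (C : R) : 0 <= C ->
  (forall j, L2norm (mu j) (component f j) <= C * L2norm (mu j) (component g j)) ->
  (sum_norm2 f <= (C ^+ 2)%:E * sum_norm2 g)%E.
Proof.
move=> C0 fg; apply: le_trans (esum_mull_le _ _); rewrite ?sqr_ge0//.
  apply: le_esum => j _; rewrite -EFinM lee_fin -exprMn.
  by rewrite lerXn2r ?nnegrE ?mulr_ge0 ?L2norm_ge0.
by move=> j; rewrite lee_fin sqr_ge0.
Qed.

Lemma sum_norm2_eq0 f : op_mem A f ->
  op_norm A f = 0 <-> (forall j, L2norm (mu j) (component f j) = 0).
Proof.
move=> [_ f2]; rewrite sum_normE -/(sum_norm2 f); split=> [|f0].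
  move/eqP; rewrite sqrtr_eq0 => n0 j; apply/eqP; rewrite -sqrf_eq0; apply/eqP/le_anti.
  rewrite sqr_ge0 andbT; apply: le_trans n0.
  rewrite -lee_fin fineK ?ge0_fin_numE ?sum_norm2_ge0//.
  by apply: esum_term_le => i; rewrite lee_fin sqr_ge0.
rewrite /sum_norm2 esum1 ?sqrtr0//= => j _.
by rewrite f0 expr0n.
Qed.

Lemma sum_mem_lin f g (a : R) : op_mem A f -> op_mem A g ->
  op_mem A (fun p => g p + a * f p).
Proof.
move=> /sum_memP[f2 fn] /sum_memP[g2 gn]; apply/sum_memP; split=> [j|].
  by apply: (L2D (g2 j) (L2Z a (f2 j))).
apply: (@le_lt_trans _ _ (2%:E * sum_norm2 g + (2 * a ^+ 2)%:E * sum_norm2 f)%E).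
  apply: (@le_trans _ _ (\esum_(j in [set: J]) (2%:E * (L2norm (mu j) (component g j) ^+ 2)%:E) +
    \esum_(j in [set: J]) ((2 * a ^+ 2)%:E * (L2norm (mu j) (component f j) ^+ 2)%:E))%E).
    rewrite -esumD; last 2 first.
    - by move=> j _; rewrite -EFinM lee_fin mulr_ge0 ?sqr_ge0.
    - by move=> j _; rewrite -EFinM lee_fin mulr_ge0 ?sqr_ge0// mulr_ge0 ?sqr_ge0.
    apply: le_esum => j _; rewrite -!EFinM -EFinD lee_fin.
    have b : L2norm (mu j) (component (fun p => g p + a * f p) j) <=
       L2norm (mu j) (component g j) + `|a| * L2norm (mu j) (component f j).
      by rewrite -L2normZ//; exact: L2norm_triangle (g2 j) (L2Z a (f2 j)).
    apply: (@le_trans _ _ ((L2norm (mu j) (component g j) + `|a| * L2norm (mu j) (component f j)) ^+ 2)).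
      by rewrite lerXn2r ?nnegrE ?addr_ge0 ?mulr_ge0 ?L2norm_ge0.
    rewrite -[a ^+ 2]real_normK ?num_real//.
    have := sqr_ge0 (L2norm (mu j) (component g j) - `|a| * L2norm (mu j) (component f j)); lra.
  apply: leeD.
    by apply: esum_mull_le => // j; rewrite lee_fin sqr_ge0.
  apply: esum_mull_le => [|j]; first by rewrite mulr_ge0 ?sqr_ge0.
  by rewrite lee_fin sqr_ge0.
by apply: lte_add_pinfty; apply: lte_mul_pinfty => //; rewrite lee_fin mulr_ge0 ?sqr_ge0.
Qed.

Lemma sum_graph_sub f g : op_graph A f g -> op_mem A (fun p => g p - lambda * f p).
Proof.
move=> [fm gm _]; rewrite (_ : (fun p => _) = fun p => g p + (- lambda) * f p); first exact: sum_mem_lin.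
by apply/funext => p; rewrite mulNr.
Qed.

(** The inverses on the summands are bounded uniformly: the finitely many long
    intervals have bounds of their own, and [dirichlet_small] takes care of the
    short ones. *)
Lemma string_resolvent : (forall j, s (L j) != 0) -> resolvent_set A lambda.
Proof.
move=> sL.
have [C C0 CP] : exists2 C, 0 <= C & forall j (f g : R -> R), op_graph (D j) f g ->
    L2norm (mu j) f <= C * L2norm (mu j) (fun x => g x - lambda * f x).
  have /choice[Cj CjP] : forall j, exists C, 0 <= C /\ forall f g : R -> R, op_graph (D j) f g ->
      L2norm (mu j) f <= C * L2norm (mu j) (fun x => g x - lambda * f x).
    by move=> j; have [_ [C ? ?]] := dirichlet_resolvent (L0 j) sc (sL j); exists C.
  (* below the length e, [dirichlet_small] applies, with a factor at most 4 *)
  pose e := (4 * (`|lambda| + 1))^-1.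
  have e0 : 0 < e by rewrite invr_gt0 mulr_gt0// ltr_pwDr.
  have e1 : e <= 1 by rewrite invf_le1 ?mulr_gt0 ?ltr_pwDr//; have := normr_ge0 lambda; lra.
  pose F := fset_set [set j | e < L j].
  pose S := \sum_(j <- enum_fset F) Cj j.
  have S0 : 0 <= S by apply: sumr_ge0 => j _; exact: (CjP j).1.
  exists (S + 4) => [|j f g fg]; first by rewrite addr_ge0.
  have n0 := L2norm_ge0 (mu j) (fun x => g x - lambda * f x).
  have [eL|Le] := ltP e (L j).
    apply: le_trans ((CjP j).2 _ _ fg) _; rewrite ler_wpM2r//.
    have jF : j \in F by rewrite in_fset_set; [rewrite inE|exact: L_small].
    rewrite /S (big_rem j jF) /= -addrA lerDl addr_ge0// sumr_ge0// => i _.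
    exact: (CjP i).1.
  have L1 : L j <= 1 by exact: le_trans e1.
  have Lj := ltW (L0 j).
  have LL : L j ^+ 2 <= L j by rewrite expr2 ler_piMl.
  have small : 4 * `|lambda| * L j ^+ 2 <= 1.
    apply: (@le_trans _ _ (4 * `|lambda| * e)).
      by rewrite ler_wpM2l ?mulr_ge0// (le_trans LL).
    rewrite /e ler_pdivrMr ?mulr_gt0 ?ltr_pwDr//; lra.
  apply: le_trans (dirichlet_small (L0 j) small fg) _; rewrite ler_wpM2r//.
  by have := le_trans LL L1; lra.
split=> [g [g2 gn]|].
  have /choice[f fP] : forall j, exists f : R -> R, op_graph (D j) f (fun x => component g j x + lambda * f x).
    by move=> j; have [+ _] := dirichlet_resolvent (L0 j) sc (sL j); move=> /(_ _ (g2 j)).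
  have fm : op_mem A (fun p => f p.1 p.2).
    apply/sum_memP; split=> [j|]; first by have [] := fP j.
    apply: (@le_lt_trans _ _ ((C ^+ 2)%:E * sum_norm2 g)%E); last first.
      by apply: lte_mul_pinfty => //; rewrite lee_fin sqr_ge0.
    apply: sum_norm2_le => // j; have := CP _ _ _ (fP j).
    by rewrite (_ : (fun x => _ + _ - _) = component g j)//; apply/funext => x; rewrite addrK.
  exists (fun p => f p.1 p.2); apply/sum_graphP; split => //; first exact: sum_mem_lin.
exists C => f g fg; have gm := sum_graph_sub fg.
have [fm _ fgj] := fg; have [_ gn] := gm.
rewrite !sum_normE.
rewrite -[C](ger0_norm C0) -sqrtr_sqr -sqrtrM ?sqr_ge0// ler_wsqrtr//.
rewrite -lee_fin EFinM !fineK; last 2 first.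
- by rewrite ge0_fin_numE ?sum_norm2_ge0.
- by rewrite ge0_fin_numE ?sum_norm2_ge0//; case: fm.
by apply: sum_norm2_le => // j; exact: CP.
Qed.

Definition single (j : J) (h : R -> R) : J * R -> R :=
  fun p => if p.1 == j then h p.2 else 0.

Lemma component_single j h i : component (single j h) i = if i == j then h else cst 0.
Proof. by apply/funext => x; rewrite /component /single /=; case: (i == j). Qed.

Lemma single_mem j h : L2 (mu j) h -> op_mem A (single j h).
Proof.
move=> h2; apply/sum_memP; split=> [i|].
  by rewrite component_single; case: eqP => [->//|_]; exact: L2_0.
rewrite /sum_norm2 (_ : esum _ _ = \esum_(i in [set j]) (L2norm (mu i) (component (single j h) i) ^+ 2)%:E)%E.
  by rewrite esum_set1 ?ltry// lee_fin sqr_ge0.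
rewrite [RHS]esum_mkcond; apply: eq_esum => i _.
have [->|/eqP ij] := eqVneq i j; first by rewrite mem_set.
rewrite memNset// component_single; move/eqP/negbTE: ij => ->.
by rewrite L2norm0 expr0n.
Qed.

Lemma single_graph j : s (L j) = 0 ->
  op_graph A (single j s) (fun p => lambda * single j s p).
Proof.
move=> sj; have sg := dirichlet_eigen (L0 j) sc sj; have [s2 _] := dirichlet_graph_L2 sg.
have sm := single_mem s2; apply/sum_graphP; split => //.
  rewrite (_ : (fun p => _) = fun p => single j s p + (lambda - 1) * single j s p).
    exact: sum_mem_lin.
  by apply/funext => p; ring.
move=> i; have cE : component (fun p => lambda * single j s p) i =
  fun x => lambda * component (single j s) i x by [].
rewrite cE component_single; case: eqP => [->//|_].
apply/(dirichlet_graphP (L0 i)); split; [exact: L2_0|exact: L2Z (@L2_0 _ _ _ _)|].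
exists (cst 0), (cst 0); split; last exact: ae_eq_refl.
have z := ac_cst (L i) 0; split; first by split.
by rewrite (_ : (fun x => - (lambda * cst 0 x)) = cst 0)//; apply/funext => x; rewrite mulr0 oppr0.
Qed.

(** A nonzero eigenfunction contradicts the boundedness of the inverse. *)
Lemma string_eigenvalue_spectrum j : s (L j) = 0 -> ~ resolvent_set A lambda.
Proof.
move=> sj [_ [C CP]]; have sg := single_graph sj.
have := CP _ _ sg; rewrite (_ : (fun p => _ - _) = fun=> 0); last by apply/funext => p; rewrite subrr.
have sm : op_mem A (fun=> 0 : R).
  apply/sum_memP; split=> [i|]; first exact: L2_0.
  by rewrite /sum_norm2 esum1 ?ltry// => i _; rewrite L2norm0 expr0n.
rewrite [X in _ * X](proj2 (sum_norm2_eq0 sm)) ?mulr0; last by move=> i; rewrite L2norm0.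
move=> n0; have /(proj1 (sum_norm2_eq0 (let: And3 h _ _ := sg in h)))/(_ j) : op_norm A (single j s) = 0.
  by apply/le_anti; rewrite n0 sqrtr_ge0.
rewrite component_single eqxx => n.
by have := fundamental_neq0 (L0 j) sc; rewrite n ltxx.
Qed.

Definition eigen_indices : set J := [set j | s (L j) = 0].

(** On each summand the eigenfunctions for lambda are the multiples of s, if
    s vanishes at the end of the interval, and 0 otherwise. *)
Lemma string_multiplicity_card : finite_set eigen_indices ->
  has_multiplicity A lambda (size (enum_fset (fset_set eigen_indices))).
Proof.
move=> finZ; set Z := fset_set eigen_indices.
have ZP j : (j \in Z) = (s (L j) == 0).
  by rewrite in_fset_set//; apply/idP/eqP => [/set_mem//|sj]; apply/mem_set.
pose z (k : 'I_(size (enum_fset Z))) : J := tnth (in_tuple (enum_fset Z)) k.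
have zZ k : z k \in Z by exact: mem_tnth.
have z_inj : injective z by apply/tuple_uniqP; exact: fset_uniq.
have z_surj j : j \in Z -> exists k, z k = j by move=> /(tnthP (in_tuple (enum_fset Z)))[k ->]; exists k.
exists (fun k => single (z k) s); split=> [k|f].
  by apply: single_graph; apply/eqP; rewrite -ZP.
move=> fg; have [fm _ fj] := fg; have [f2 _] := fm.
have s2 j : j \in Z -> L2 (mu j) s.
  by rewrite ZP => /eqP sj; have [] := dirichlet_graph_L2 (dirichlet_eigen (L0 j) sc sj).
have /choice[a aP] : forall k, exists a, ae_eq (mu (z k)) setT (component f (z k)) (fun x => a * s x).
  by move=> k; have [] := dirichlet_eigenP (L0 (z k)) sc (fj (z k)).
pose comb (v : 'rV[R]_(size (enum_fset Z))) p := \sum_k v 0 k * single (z k) s p.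
have combE v j : component (comb v) j =
    if pselect (exists k, z k = j) is left h then fun x => v 0 (projT1 (cid h)) * s x else cst 0.
  apply/funext => x; rewrite /component /comb; case: pselect => [h|nh].
    case: (cid h) => k zk /=; rewrite (bigD1 k)//= /single /= zk eqxx big1 ?addr0// => i ik.
    by case: eqP => [ji|]; [move: ik; rewrite (z_inj i k) ?eqxx// -ji|rewrite mulr0].
  rewrite big1// => k _; rewrite /single /=; case: eqP => [jk|]; last by rewrite mulr0.
  by exfalso; apply: nh; exists k.
have comb2 v j : L2 (mu j) (component (comb v) j).
  rewrite combE; case: pselect => [h|_]; last exact: L2_0.
  by apply: L2Z; case: h => k <-; exact: s2.
have combm v : op_mem A (comb v).
  apply/sum_memP; split => //; rewrite /sum_norm2.
  rewrite (_ : esum _ _ = \esum_(i in eigen_indices) (L2norm (mu i) (component (comb v) i) ^+ 2)%:E)%E.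
    rewrite esum_fset//; last by move=> i _; rewrite lee_fin sqr_ge0.
    by rewrite fsumEFin// ltry.
  rewrite [RHS]esum_mkcond; apply: eq_esum => i _.
  case: ifPn => // /negP iZ; rewrite combE; case: pselect => [[k ki]|_]; last by rewrite L2norm0 expr0n.
  by exfalso; apply: iZ; rewrite inE /eigen_indices /= -ki; apply/eqP; rewrite -ZP.
have diffm v : op_mem A (fun p => f p - comb v p).
  rewrite (_ : (fun p => _) = fun p => f p + (-1) * comb v p); first exact: sum_mem_lin.
  by apply/funext => p; rewrite mulN1r.
exists (\row_k a k); split=> [|v].
  apply/(sum_norm2_eq0 (diffm _)) => j.
  rewrite (_ : component _ j = fun x => component f j x - component (comb (\row_k a k)) j x)//.
  apply: ae_eq_L2norm0; [exact: L2_measurable (f2 j)|exact: L2_measurable (comb2 _ j)|].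
  rewrite combE; case: pselect => [h|nh].
    by case: (cid h) => k kj /=; rewrite mxE -kj; exact: aP.
  have [_] := dirichlet_eigenP (L0 j) sc (fj j); apply.
  by rewrite -ZP; apply/negP => /z_surj.
move=> /(sum_norm2_eq0 (diffm v)) dv; apply/rowP => k; rewrite mxE.
have := dv (z k).
rewrite (_ : component _ (z k) = fun x => component f (z k) x - component (comb v) (z k) x)//.
move=> /(L2_dist_ae (f2 _) (comb2 v _)) fv.
have sz2 := s2 _ (zZ k).
have : ae_eq (mu (z k)) setT (fun x => a k * s x) (fun x => v 0 k * s x).
  apply: ae_eq_trans (ae_eq_sym (aP k)) _; apply: ae_eq_trans fv _.
  rewrite combE; case: pselect => [h|[]]; last by exists k.
  by case: (cid h) => i /= /z_inj ->; exact: ae_eq_refl.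
move=> /(ae_eq_L2norm0 (L2_measurable (L2Z (a k) sz2)) (L2_measurable (L2Z (v 0 k) sz2))).
rewrite (_ : (fun x => _ - _) = fun x => (a k - v 0 k) * s x); last first.
  by apply/funext => x; rewrite mulrBl.
rewrite L2normZ// => /eqP; rewrite mulf_eq0 normr_eq0 subr_eq0 => /orP[/eqP//|].
by rewrite gt_eqF// (fundamental_neq0 (L0 _) sc).
Qed.

(** On a short interval an eigenfunction would vanish, by [dirichlet_small]. *)
Lemma eigen_indices_finite : finite_set eigen_indices.
Proof.
have [/L_small finL|l0] := ltP 0 ((4 * (`|lambda| + 1))^-1 : R); last first.
  by move: l0; rewrite invr_le0 leNgt mulr_gt0// ltr_pwDr.
apply: sub_finite_set finL => j sj /=; rewrite ltNge; apply/negP => Le.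
have e1 : (4 * (`|lambda| + 1))^-1 <= 1 by rewrite invf_le1 ?mulr_gt0 ?ltr_pwDr//; have := normr_ge0 lambda; lra.
have Lj := ltW (L0 j).
have LL : L j ^+ 2 <= L j by rewrite expr2 ler_piMl// (le_trans Le).
have small : 4 * `|lambda| * L j ^+ 2 <= 1.
  apply: (@le_trans _ _ (4 * `|lambda| * (4 * (`|lambda| + 1))^-1)).
    by rewrite ler_wpM2l ?mulr_ge0// (le_trans LL).
  by rewrite ler_pdivrMr ?mulr_gt0 ?ltr_pwDr//; lra.
have := dirichlet_small (L0 j) small (dirichlet_eigen (L0 j) sc sj).
rewrite (_ : (fun x => _ - _) = cst 0); last by apply/funext => x; rewrite subrr.
by rewrite L2norm0 mulr0 leNgt (fundamental_neq0 (L0 j) sc).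
Qed.

End string_operator.

Section string_spectrum.
Context {R : realType} (l : nat -> R) (m : nat -> nat).
Hypothesis l_gt0 : forall i, 0 < l i.
Hypothesis l_decr : forall i j, (i < j)%N -> l j < l i.
Hypothesis l_cvg : l @ \oo --> (0 : R).
Hypothesis m_gt0 : forall i, (0 < m i)%N.

Local Notation J := {i : nat & 'I_(m i)}.
Local Notation L := (fun j : J => l (tag j)).

Let L_small (e : R) : 0 < e -> finite_set [set j : J | e < l (tag j)].
Proof.
move=> e0; have [N _ NP] := proj1 (cvgrPdist_lt _ _) l_cvg e e0.
pose t := [seq (Tagged (fun i => 'I_(m i)) r : J) | i <- iota 0 N, r <- enum 'I_(m i)].
apply: (@sub_finite_set _ _ [set` t]); last exact: finite_seq.
move=> [i r] /= ei; apply/allpairsPdep; exists i, r.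
rewrite mem_enum mem_iota /= add0n; split => //.
rewrite ltnNge; apply/negP => /NP /=; rewrite sub0r normrN gtr0_norm//.
by rewrite ltNge (ltW ei).
Qed.

Lemma string_spectrumE : spectrum (string_laplacian l m) = range (string_eigenvalue l).
Proof.
apply/seteqP; split=> lambda.
  have [s [c [sc sl]]] := fundamental_exists lambda.
  move=> nres; apply: contrapT => nr; apply: nres.
  apply: (string_resolvent (fun j : J => l_gt0 (tag j)) L_small sc) => j.
  apply/eqP => /(sl _ (l_gt0 _))[k lk]; apply: nr.
  by exists (tag j, k).
move=> [[i k] _ <-] {lambda}; set lambda := string_eigenvalue _ _.
have [s [c [sc sl]]] := fundamental_exists lambda.
pose j : J := Tagged (fun i => 'I_(m i)) (Ordinal (m_gt0 i)).
apply: (@string_eigenvalue_spectrum _ J L (fun j : J => l_gt0 (tag j)) lambda s c sc j).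
by apply/(sl _ (l_gt0 _)); exists k.
Qed.

(** On an interval at most one k gives the eigenvalue lambda. So the intervals with
    this eigenvalue are listed without repetition by the pairs (i, k) with
    eigenvalue lambda and the copies of the i-th interval. *)
Lemma string_multiplicityP lambda :
  has_multiplicity (string_laplacian l m) lambda (string_multiplicity l m lambda).
Proof.
have [s [c [sc sl]]] := fundamental_exists lambda.
have finZ := eigen_indices_finite (fun j : J => l_gt0 (tag j)) L_small sc.
have := string_multiplicity_card (fun j : J => l_gt0 (tag j)) sc finZ.
set Z := eigen_indices _ _ in finZ *.
suff -> : size (enum_fset (fset_set Z)) = string_multiplicity l m lambda by [].
have inj i k k' : string_eigenvalue l (i, k) = string_eigenvalue l (i, k') -> k = k'.
  rewrite /string_eigenvalue /= => /(mulIf (invr_neq0 (expf_neq0 2 (lt0r_neq0 (l_gt0 i))))).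
  move=> /(mulfI (expf_neq0 2 (lt0r_neq0 (pi_gt0 R)))) /eqP.
  by rewrite eqrXn2// eqr_nat eqSS => /eqP.
pose E := [set p | string_eigenvalue l p = lambda].
have ZP (j : J) : Z j <-> exists k, E (tag j, k).
  by rewrite /Z /eigen_indices /= (sl _ (l_gt0 _)); split=> -[k h]; exists k; exact: esym h.
have finE : finite_set E.
  have /choice[kk kkP] : forall j : J, exists k, Z j -> E (tag j, k).
    by move=> j; have [/ZP[k ?]|] := pselect (Z j); [exists k|exists 0%N].
  apply: (@sub_finite_set _ _ ((fun j : J => (tag j, kk j)) @` Z)); last exact: finite_image.
  move=> [i k] Eik; exists (Tagged (fun i => 'I_(m i)) (Ordinal (m_gt0 i))); first by apply/ZP; exists k.
  rewrite /=; congr pair; apply: (inj i); rewrite Eik.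
  by apply: (kkP (Tagged (fun i => 'I_(m i)) (Ordinal (m_gt0 i)))); apply/ZP; exists k.
rewrite /string_multiplicity -/E fsbig_finite//=.
pose t := [seq (Tagged (fun i => 'I_(m i)) r : J) | p <- enum_fset (fset_set E), r <- enum 'I_(m p.1)].
have tZ : perm_eq (enum_fset (fset_set Z)) t.
  apply: uniq_perm; first exact: fset_uniq.
    apply: allpairs_uniq_dep.
    - exact: fset_uniq.
    - by move=> p _; exact: enum_uniq.
    - move=> _ _ /allpairsPdep[[i k] [r [pE _ ->]]] /allpairsPdep[[i' k'] [r' [p'E _ ->]]] /=.
      move=> H; have ii : i = i' by have := congr1 tag H.
      move: pE p'E; rewrite !in_fset_set// !inE => pE p'E.
      subst i'; have kk : k = k' by apply: (inj i); rewrite pE p'E.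
      by subst k'; move/eqP: H; rewrite eq_Tagged => /eqP /= ->.
  move=> j; apply/idP/idP.
    rewrite in_fset_set// inE => /ZP[k Ek]; apply/allpairsPdep; exists (tag j, k), (tagged j).
    by rewrite mem_enum in_fset_set// inE; split => //; case: j Ek.
  move=> /allpairsPdep[[i k] [r [+ _ ->]]]; rewrite in_fset_set// inE => Eik.
  by rewrite in_fset_set// inE; apply/ZP; exists k.
rewrite (perm_size tZ) size_allpairs_dep sumnE big_map.
by apply: eq_bigr => p _; rewrite size_enum_ord.
Qed.

End string_spectrum.

(** * The tower and its projective limit *)

Section glueing.
Variables (X : ptopologicalType) (B : set X) (G : ptopologicalType).

Lemma glue_openE (U : set (Defs.glue B G)) : open U = open (@glue_pi X B G @^-1` U).
Proof. by []. Qed.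

Lemma glue_pi_continuous : continuous (@glue_pi X B G).
Proof. by apply/continuousP => U. Qed.

Lemma glue_continuous (Y : topologicalType) (f : Defs.glue B G -> Y) :
  continuous (f \o @glue_pi X B G) -> continuous f.
Proof. by move=> cf; apply/continuousP => U oU; rewrite glue_openE; move/continuousP : cf; exact. Qed.

Lemma glue_phi_continuous : continuous (@glue_phi X B G).
Proof.
apply: glue_continuous; rewrite (_ : _ \o _ = fst); last exact/funext/glue_piK.
by move=> p; exact: cvg_fst.
Qed.

Lemma glue_pi_surj (y : Defs.glue B G) : exists p, y = glue_pi B p.
Proof.
case: y => [[p g]|b].
  exists (set_val p, g); rewrite /glue_pi /=; case: pselect => [Bp|nBp].
    by have := set_valP p; rewrite /= => /(_ Bp).
  by congr (inl (_, _)); apply/val_inj.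
exists (set_val b, point); rewrite /glue_pi /=; case: pselect => [Bb|nBb].
  by congr inr; apply/val_inj.
by have := set_valP b.
Qed.

Lemma glue_pi_collapse p g g' : B p -> glue_pi B (p, g) = glue_pi B (p, g') :> Defs.glue B G.
Proof. by move=> Bp; rewrite /glue_pi /=; case: pselect. Qed.

Lemma glue_pi_inj p p' g g' : glue_pi B (p, g) = glue_pi B (p', g') :> Defs.glue B G ->
  p = p' /\ (~ B p -> g = g').
Proof.
move=> e; have /= pp : p = p' by have := congr1 (@glue_phi X B G) e; rewrite !glue_piK.
split=> // nB; move: e; rewrite -{}pp /glue_pi /=.
by case: pselect => // ? [].
Qed.

End glueing.

Section base_interval.
Context {R : realType} {len : R}.
Variable len0 : 0 < len.
Local Notation I := (itv0 len0).

Let clamp_itv (x : R) : [set` `[0, len]] (Num.max 0 (Num.min x len)).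
Proof. by rewrite /= in_itv /= le_max lexx /= ge_max ge_min lexx orbT ltW. Qed.

(** The retraction of the line onto [0, len], through which functions on [0, len]
    become functions on the line. *)
Definition clamp (x : R) : I := SigSub (mem_set (clamp_itv x)).

Lemma clamp_val x : set_val (clamp x) = Num.max 0 (Num.min x len).
Proof. by []. Qed.

Lemma clampE x : 0 <= x <= len -> set_val (clamp x) = x.
Proof.
move=> /andP[x0 xl]; rewrite clamp_val (min_idPl xl); exact/max_idPr.
Qed.

Lemma itv0P (x : I) : 0 <= (set_val x : R) <= len.
Proof. by have := set_valP x; rewrite /= in_itv. Qed.

Lemma clampK (x : I) : clamp (set_val x) = x.
Proof. apply: val_inj; exact: (clampE (itv0P x)). Qed.

Lemma set_val_continuous : continuous (set_val : I -> R).
Proof. exact: initial_continuous. Qed.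

Lemma clamp_continuous : continuous (clamp : R -> I).
Proof.
apply: continuous_comp_initial => x.
have cmin : {for x, continuous (fun y : R => Num.min y len)}.
  by apply: (@continuous_min R R id (cst len)); [exact: cvg_id|exact: cvg_cst].
exact: (@continuous_max R R (cst 0) _ x (@cvg_cst _ _ _ _ _) cmin).
Qed.

Lemma itv0_image : [set: I] = clamp @` `[0, len].
Proof.
apply/esym; rewrite -subTset => x _; exists (set_val x); last exact: clampK.
by rewrite /= in_itv /= itv0P.
Qed.

Lemma itv0_compact : compact [set: I].
Proof.
rewrite itv0_image; apply: continuous_compact; last exact: segment_compact.
exact/continuous_subspaceT/clamp_continuous.
Qed.

Lemma itv0_hausdorff : hausdorff_space I.
Proof.
move=> p q pq; apply: val_inj; apply: (@norm_hausdorff _ R) => A B nA nB.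
have [z [Az Bz]] := pq _ _ (@set_val_continuous p A nA) (@set_val_continuous q B nB).
by exists (set_val z).
Qed.

(* the metric structure, from which compactness gives second countability *)
HB.instance Definition _ := Uniform.copy (itv0 len0) (set_type [set` `[0, len]]).
HB.instance Definition _ := PseudoMetric.copy (itv0 len0) (set_type [set` `[0, len]]).

Lemma itv0_second_countable : @second_countable I.
Proof. exact: (@compact_second_countable R I itv0_compact). Qed.

Lemma itv0_locally_compact : locally_compact [set: I].
Proof.
move=> x _; exists setT; first exact: withinT.
split; last exact: closedT.
exact: itv0_compact.
Qed.

End base_interval.

(** Stated for an abstract space, since the fibre at a variable step is equal to
    [bool] but not convertible to it. *)
Definition two_points (G : ptopologicalType) :=
  (exists t : G, t <> point /\ forall g, g = point \/ g = t) /\ forall A : set G, open A.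

Lemma two_points_bool : two_points (bool : ptopologicalType).
Proof.
split; last by move=> A; exact: discrete_open.
by exists (~~ point); split => [|[]]; rewrite /point /=; [by []|right|left].
Qed.

Section haar_tower.
Context {R : realType} {len : R}.
Variable len0 : 0 < len.
Variable a : nat -> R.

Local Notation I := (itv0 len0).

Definition window (k : nat) : set I := [set x | 0 < (set_val x : R) < a k].

Lemma windowE k x : window k x = (0 < (set_val x : R) < a k).
Proof. by []. Qed.

(** The tower glues, at each step, a second copy of the window ]0, a k[ of the
    base branch to the space; sec is the base branch, a section of the
    projection to the interval. *)
CoFixpoint haar_tower_from (X : ptopologicalType) (sec : I -> X) (k : nat) : tower X :=
  @Tower X (~` (sec @` window k)) (bool : ptopologicalType)
    (@haar_tower_from (Defs.glue (~` (sec @` window k)) (bool : ptopologicalType) : ptopologicalType)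
      (fun x => glue_pi (~` (sec @` window k)) (sec x, false)) k.+1).

Definition haar_tower : tower I := @haar_tower_from I id 0.

(** The shape of the stages of [haar_tower], whose types are only given by
    iteration. *)
Inductive is_haar (k : nat) : forall z : {X : ptopologicalType & tower X},
    (I -> projT1 z) -> Prop :=
  IsHaar (X : ptopologicalType) (sec : I -> X) :
    @is_haar k (existT tower X (haar_tower_from sec k)) sec.

Lemma is_haar_next k z sec : is_haar k (z := z) sec ->
  is_haar k.+1 (z := tower_next z)
    (fun x => glue_pi (tower_B (projT2 z)) (sec x, point : tower_G (projT2 z))).
Proof. by move=> [X sec']; exact: IsHaar. Qed.

Lemma is_haar_BG k z sec : is_haar k (z := z) sec ->
  tower_B (projT2 z) = ~` (sec @` window k) /\ tower_G (projT2 z) = (bool : ptopologicalType).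
Proof. by move=> [X sec']. Qed.

Local Notation s := haar_tower.

Fixpoint sec (i : nat) : I -> FF s i :=
  match i return I -> FF s i with
  | 0%N => id
  | j.+1 => fun x => ppi s j (sec j x, point)
  end.

Lemma sec_is_haar i : is_haar i (z := stage s i) (@sec i).
Proof. by elim: i => [|i IH]; [exact: IsHaar|exact: is_haar_next IH]. Qed.

Lemma haar_BB i : BB s i = ~` (@sec i @` window i).
Proof. exact: (is_haar_BG (sec_is_haar i)).1. Qed.

Lemma haar_GG i : GG s i = (bool : ptopologicalType).
Proof. exact: (is_haar_BG (sec_is_haar i)).2. Qed.


Lemma GG_two i : two_points (GG s i).
Proof. by rewrite haar_GG; exact: two_points_bool. Qed.

(** The point of the fibre which carries the new copy of the window. *)
Definition tip i : GG s i := projT1 (cid (GG_two i).1).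

Lemma tip_neq i : tip i <> point.
Proof. by rewrite /tip; case: cid => t /= []. Qed.

Lemma GGP i (g : GG s i) : g = point \/ g = tip i.
Proof. by rewrite /tip; case: cid => t /= [_]; exact. Qed.

(** The j-th branch at stage i: it follows the base branch, except for the new copy
    of the window at step j. *)
Fixpoint curve (j i : nat) : I -> FF s i :=
  match i return I -> FF s i with
  | 0%N => id
  | k.+1 => fun x => ppi s k (curve j k x, if k == j then tip k else point)
  end.

Fixpoint abscissa (i : nat) : FF s i -> I :=
  match i return FF s i -> I with
  | 0%N => id
  | k.+1 => fun y => abscissa (phi s k y)
  end.

Lemma phi_ppi i p : phi s i (ppi s i p) = p.1.
Proof. exact: glue_piK. Qed.

Lemma curve_sec j i : (i <= j)%N -> curve j i = @sec i.
Proof.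
elim: i => // i IH ij; apply/funext => x /=.
by rewrite IH ?(ltnW ij)// (ltn_eqF ij).
Qed.

Lemma abscissa_curve j i x : abscissa (curve j i x) = x.
Proof. by elim: i => //= i IH; rewrite phi_ppi. Qed.

Lemma abscissa_sec i x : abscissa (sec i x) = x.
Proof. by rewrite -(@curve_sec i)// abscissa_curve. Qed.

Hypothesis a_anti : forall i j, (i <= j)%N -> a j <= a i.

Lemma window_anti i j : (i <= j)%N -> window j `<=` window i.
Proof. by move=> ij x /andP[x0 xj]; rewrite /window /= x0 (lt_le_trans xj)// a_anti. Qed.

Lemma BB_sec i x : BB s i (sec i x) <-> ~ window i x.
Proof.
rewrite haar_BB; split=> [h wx|nw [y wy e]]; first by apply: h; exists x.
by apply: nw; rewrite -(abscissa_sec i x) -e abscissa_sec.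
Qed.

Lemma curve_neq_sec j i x : (j < i)%N -> window j x -> curve j i x <> sec i x.
Proof.
elim: i => // i IH; rewrite ltnS leq_eqVlt => /orP[/eqP ->|ji] wx /=.
  rewrite eqxx curve_sec// => /glue_pi_inj[_ h].
  by apply: (@tip_neq i); apply: h => /BB_sec.
by move=> /glue_pi_inj[e _]; exact: IH e.
Qed.

Lemma curve_collapse j i x : ~ window j x -> curve j i x = sec i x.
Proof.
move=> nw; elim: i => //= i ->; case: eqP => // ->.
by apply: glue_pi_collapse; apply/BB_sec.
Qed.

(** After step j, the j-th branch belongs to the part which is not doubled. *)
Lemma BB_curve j i x : (j < i)%N -> BB s i (curve j i x).
Proof.
move=> ji; rewrite haar_BB => -[y wy e].
have xy : x = y by rewrite -(abscissa_curve j i x) -e abscissa_sec.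
move: wy e; rewrite -{}xy => wx e.
by apply: (@curve_neq_sec j i x ji) => //; exact: window_anti (ltnW ji) _ wx.
Qed.

Lemma ppi_curve j i x g : (j < i)%N -> ppi s i (curve j i x, g) = curve j i.+1 x.
Proof. by move=> ji; apply: glue_pi_collapse; exact: BB_curve. Qed.

Lemma ppi_surj i y : exists p g, y = ppi s i (p, g).
Proof. by have [[p g] ->] := glue_pi_surj y; exists p, g. Qed.

Lemma FF_curve i y : exists j x, (j <= i)%N /\ y = curve j i x.
Proof.
elim: i y => [|i IH] y; first by exists 0%N, y.
have [p [g ->]] := ppi_surj y; have [j [x [ji ->]]] := IH p.
move: ji; rewrite leq_eqVlt => /orP[/eqP ->|ji]; last first.
  by exists j, x; split; [rewrite ltnW// ltnW|exact: ppi_curve].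
have [->|->] := GGP g.
  by exists i.+1, x; split; rewrite //= (ltn_eqF (ltnSn i)) !curve_sec.
by exists i, x; split; rewrite //= eqxx.
Qed.

Lemma ppi_continuous i : continuous (ppi s i).
Proof. exact: glue_pi_continuous. Qed.

Lemma ppi_continuousl i g : continuous (fun p => ppi s i (p, g)).
Proof.
move=> p; apply: (@continuous_comp _ _ _ (fun p => (p, g)) (ppi s i)); last exact: ppi_continuous.
by apply: cvg_pair; [exact: cvg_id|exact: cvg_cst].
Qed.

Lemma curve_continuous j i : continuous (curve j i).
Proof.
elim: i => [|i IH] x; first exact: cvg_id.
apply: (@continuous_comp _ _ _ (curve j i)
  (fun p => ppi s i (p, if i == j then tip i else point))); first exact: IH.
exact: ppi_continuousl.
Qed.

Lemma FF_compact i : compact [set: FF s i].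
Proof.
elim: i => [|i IH]; first exact: itv0_compact.
rewrite (_ : [set: _] = ppi s i @` ([set: FF s i] `*` [set: GG s i])); last first.
  by apply/esym; rewrite -subTset => y _; have [p [g ->]] := ppi_surj y; exists (p, g).
apply: continuous_compact; first exact/continuous_subspaceT/ppi_continuous.
apply: compact_setX => //; apply: finite_compact.
apply: (@sub_finite_set _ _ [set point; tip i]); last exact: finite_set2.
by move=> g _; have [->|->] := GGP g; [left|right].
Qed.

Lemma window_open k : open (window k).
Proof.
rewrite (_ : window k = (set_val : I -> R) @^-1` `]0, a k[%classic); last first.
  by apply/seteqP; split => x; rewrite /window /= in_itv.
by apply: open_comp; [move=> x _; exact: set_val_continuous|exact: interval_open].
Qed.

Lemma FF_openE i (U : set (FF s i.+1)) : open U = open (ppi s i @^-1` U).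
Proof. by []. Qed.

(** Above the window the quotient map is injective, so that the preimage is a
    product of open sets. *)
Lemma branch_open i (U : set I) g : open (@sec i @` U) -> U `<=` window i ->
  open ((fun x => ppi s i (sec i x, g)) @` U).
Proof.
move=> oU Uw; rewrite FF_openE.
rewrite (_ : _ @^-1` _ = (@sec i @` U) `*` [set g]); last first.
  apply/seteqP; split => [[p g'] [x Ux]|[p g'] /= [[x Ux <-] ->]]; last by exists x.
  move=> /glue_pi_inj[<- h]; split => /=; first by exists x.
  by apply/esym/h => /BB_sec; apply; exact: Uw.
rewrite (_ : _ `*` _ = fst @^-1` (@sec i @` U) `&` snd @^-1` [set g])//.
apply: openI; (apply: open_comp; first by move=> p _; first [exact: cvg_fst|exact: cvg_snd]).
  exact: oU.
exact: (GG_two i).2.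
Qed.

Lemma sec_open i U : open U -> U `<=` window i -> open (@sec i @` U).
Proof.
elim: i => [|i IH] oU Uw; first by rewrite image_id.
have Uw' : U `<=` window i by move=> x /Uw; exact: window_anti.
by apply: branch_open => //; exact: IH.
Qed.

Lemma BB_closed i : closed (BB s i).
Proof. by rewrite haar_BB closedC; apply: sec_open => //; exact: window_open. Qed.

Lemma twig_open i : open (@sec i.+1 @` window i).
Proof. by apply: branch_open => //; apply: sec_open => //; exact: window_open. Qed.

Lemma curve_open i : open (curve i i.+1 @` window i).
Proof.
rewrite (_ : curve i i.+1 = fun x => ppi s i (sec i x, tip i)); last first.
  by apply/funext => x /=; rewrite eqxx curve_sec.
by apply: branch_open => //; apply: sec_open => //; exact: window_open.
Qed.

Let coherent_curve j x : @coherent _ s (fun i => curve j i x : FF s i).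
Proof. by move=> i; rewrite phi_ppi. Qed.

Definition Curve (j : nat) (x : I) : projlim s := SigSub (mem_set (coherent_curve j x)).

Lemma Phi_Curve j i x : Phi s i (Curve j x) = curve j i x.
Proof. by []. Qed.

Lemma projlimP (p q : projlim s) : (forall i, Phi s i p = Phi s i q) -> p = q.
Proof. by move=> h; apply: val_inj; apply: functional_extensionality_dep => i; exact: h. Qed.

Lemma phi_Phi i (p : projlim s) : phi s i (Phi s i.+1 p) = Phi s i p.
Proof. exact: (set_valP p). Qed.

Lemma abscissa_Phi i (p : projlim s) : abscissa (Phi s i p) = Phi s 0 p.
Proof. by elim: i => //= i IH; rewrite phi_Phi. Qed.

Lemma Phi_continuous i : continuous (Phi s i).
Proof.
move=> p; apply: (@continuous_comp _ (prod_topology (FF s)) _ (set_val : projlim s -> prod_topology (FF s)) (fun x => x i)).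
  exact: initial_continuous.
exact: proj_continuous.
Qed.

Lemma Curve_continuous j : continuous (Curve j).
Proof.
apply: (@continuous_comp_initial _ _ (prod_topology (FF s))
  (set_val : projlim s -> prod_topology (FF s)) (Curve j)).
move=> x; apply/cvg_sup; first exact/fmap_filter/nbhs_filter.
move=> i; move: x; apply/(@continuousP _ (initial_topology (@^~ i))) => A [B oB <-].
exact: (open_comp (f := curve j i)) (in1W (@curve_continuous j i)) oB.
Qed.

Hypothesis a_cvg : a @ \oo --> (0 : R).

Lemma window_near (x : I) : \forall j \near \oo, ~ window j x.
Proof.
have [x0|x0] := eqVneq (set_val x : R) 0.
  by near=> j; rewrite /window /= x0 ltxx.
have xgt0 : 0 < (set_val x : R) by rewrite lt_def x0; case/andP: (itv0P x).
near=> j; rewrite /window /= xgt0 /=; apply/negP; rewrite -leNgt.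
by near: j; exact: (cvgr_le _ a_cvg).
Unshelve. all: by end_near. Qed.

Lemma Curve_collapse j j' x : ~ window j x -> ~ window j' x -> Curve j x = Curve j' x.
Proof. by move=> n n'; apply: projlimP => i; rewrite !Phi_Curve !curve_collapse. Qed.

(** The coordinates of a point leave the base branch at most once, and stay on the
    same branch afterwards. If they never leave it, any branch beyond the last
    window that contains the point will do. *)
Lemma projlim_Curve (p : projlim s) : exists j, p = Curve j (Phi s 0 p).
Proof.
have [h|h] := pselect (forall i, Phi s i p = sec i (Phi s 0 p)).
  have [j _ /(_ j (leqnn j)) nj] := window_near (Phi s 0 p).
  by exists j; apply: projlimP => i; rewrite h Phi_Curve curve_collapse.
have [i] : exists i, Phi s i p <> sec i (Phi s 0 p).
  by apply: contrapT => nh; apply: h => i; apply: contrapT => ni; apply: nh; exists i.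
have [j [x [ji e]]] := FF_curve (Phi s i p).
have xe : x = Phi s 0 p by rewrite -(abscissa_Phi i) e abscissa_curve.
move: e; rewrite xe; set y := Phi s 0 p => e ns.
have {}ji : (j < i)%N.
  by rewrite ltn_neqAle ji andbT; apply/eqP => ij; apply: ns; rewrite e ij curve_sec.
exists j; apply: projlimP => k; rewrite Phi_Curve.
have down n : Phi s n.+1 p = curve j n.+1 y -> Phi s n p = curve j n y.
  by move=> h1; rewrite -phi_Phi h1 phi_ppi.
have up n : (j < n)%N -> Phi s n p = curve j n y -> Phi s n.+1 p = curve j n.+1 y.
  move=> jn h1; have [q [g h2]] := ppi_surj (Phi s n.+1 p).
  by rewrite h2 -(ppi_curve y g jn) -h1 -phi_Phi h2 phi_ppi.
have downs n m : Phi s (m + n) p = curve j (m + n) y -> Phi s m p = curve j m y.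
  by elim: n => [|n IH]; rewrite ?addn0 // addnS => /down.
have [ki|ik] := leqP k i; first by apply: (downs (i - k)%N); rewrite subnKC.
rewrite -(subnK (ltnW ik)); elim: (k - i)%N => [|n IH]; first by rewrite add0n.
by rewrite addSn; apply: up => //; rewrite (leq_trans ji)// leq_addl.
Qed.

(** All the branches start at the same point, above 0. *)
Lemma projlim_connected : connected [set: projlim s].
Proof.
rewrite (_ : [set: _] = \bigcup_(j in [set: nat]) (Curve j @` [set: I])); last first.
  by apply/esym; rewrite -subTset => p _; have [j ->] := projlim_Curve p; exists j => //; eexists.
apply: bigcup_connected => [|j _].
  exists (Curve 0 point) => j _; exists point => //.
  by apply: Curve_collapse; rewrite /window /= ltxx.
apply: connected_continuous_connected; last exact/continuous_subspaceT/Curve_continuous.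
rewrite itv0_image; apply: connected_continuous_connected; first exact: segment_connected.
exact/continuous_subspaceT/clamp_continuous.
Qed.

End haar_tower.

(** * Haar coefficients of eventually constant sequences *)

Section haar_coefficients.
Context {R : realType}.
Implicit Types y z : nat -> R.

(** The mass of the j-th branch. *)
Definition wt (j : nat) : R := 2^-1 ^+ j.+1.

Lemma wt_gt0 j : 0 < wt j.
Proof. by rewrite exprn_gt0// invr_gt0 ltr0n. Qed.

Lemma wtS j : wt j.+1 = wt j / 2.
Proof. by rewrite /wt exprS mulrC. Qed.

Lemma wt_half j : 2^-1 ^+ j = 2 * wt j.
Proof. by rewrite /wt exprS mulrA divff ?mul1r// pnatr_eq0. Qed.

(** The sum of wt j * y j over j >= k, with the terms beyond n replaced by the value
    y n, whose total weight is 2^-n. For an eventually constant y these sums are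
    stationary, which reduces [tail] to a finite sum. *)
Definition partial_tail y k n := \sum_(k <= j < n) wt j * y j + 2^-1 ^+ n * y n.

Definition tail y k := limn (partial_tail y k).

Definition constant_from J y := forall j, (J <= j)%N -> y j = y J.

Lemma constant_from_le J K y : (J <= K)%N -> constant_from J y -> constant_from K y.
Proof. by move=> JK cy j Kj; rewrite !cy// (leq_trans JK). Qed.

Lemma partial_tailS y k n : (k <= n)%N ->
  partial_tail y k n.+1 = partial_tail y k n + wt n * (y n.+1 - y n).
Proof.
move=> kn; rewrite /partial_tail big_nat_recr//= !wt_half wtS.
have alg (a b c d : R) : a + b * c + 2 * (b / 2) * d = a + 2 * b * c + b * (d - c) by field.
exact: alg.
Qed.

Lemma partial_tail_const J y k m n : constant_from J y -> (J <= m)%N -> (k <= m)%N ->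
  (m <= n)%N -> partial_tail y k n = partial_tail y k m.
Proof.
move=> cy Jm km /subnK <-; elim: (n - m)%N => // d IH.
have Jd : (J <= d + m)%N by rewrite (leq_trans Jm)// leq_addl.
rewrite addSn partial_tailS ?(leq_trans km) ?leq_addl// IH.
by rewrite (cy (d + m).+1) ?(cy (d + m)%N)// ?subrr ?mulr0 ?addr0// (leq_trans Jd).
Qed.

Lemma cvg_partial_tail J y k n : constant_from J y -> (J <= n)%N -> (k <= n)%N ->
  partial_tail y k m @[m --> \oo] --> partial_tail y k n.
Proof.
move=> cy Jn kn; apply: cvg_near_cst; near=> m; apply: (partial_tail_const cy) => //.
by near: m; exact: nbhs_infty_ge.
Unshelve. all: by end_near. Qed.

Lemma tailE J y k n : constant_from J y -> (J <= n)%N -> (k <= n)%N ->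
  tail y k = partial_tail y k n.
Proof. by move=> cy Jn kn; apply/cvg_lim => //; exact: cvg_partial_tail cy _ _. Qed.

Lemma tail_constant y k : constant_from k y -> tail y k = 2 * wt k * y k.
Proof.
move=> cy; rewrite (tailE cy (leqnn k) (leqnn k)) /partial_tail big_geq//.
by rewrite add0r wt_half.
Qed.

Lemma tail_step J y k : constant_from J y -> tail y k = wt k * y k + tail y k.+1.
Proof.
move=> cy; rewrite !(tailE (n := maxn J k.+1) cy) ?leq_maxl ?leq_maxr//.
  by rewrite /partial_tail big_ltn ?leq_maxr// addrA.
by rewrite ltnW// leq_maxr.
Qed.

Lemma tail_linear J y z (a b : R) k : constant_from J y -> constant_from J z ->
  tail (fun j => a * y j + b * z j) k = a * tail y k + b * tail z k.
Proof.
move=> cy cz; have cyz : constant_from J (fun j => a * y j + b * z j).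
  by move=> j Jj; rewrite cy// cz.
rewrite (tailE cyz (leq_maxl J k) (leq_maxr J k)) (tailE cy (leq_maxl J k) (leq_maxr J k)).
rewrite (tailE cz (leq_maxl J k) (leq_maxr J k)) /partial_tail.
rewrite (_ : \sum_(k <= j < maxn J k) _ = a * (\sum_(k <= j < maxn J k) wt j * y j) +
  b * (\sum_(k <= j < maxn J k) wt j * z j)); last first.
  by rewrite !mulr_sumr -big_split/=; apply: eq_bigr => i _; ring.
by ring.
Qed.

Definition rt2 : R := Num.sqrt 2.

Lemma rt2X k : rt2 ^+ k * rt2 ^+ k * (2 * wt k) = 1.
Proof.
rewrite -exprD addnn -mul2n exprM /rt2 sqr_sqrtr ?ler0n// -wt_half exprVn divff//.
Qed.

(** Coefficients in a Haar-like orthonormal system of the sequences with weights wt: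
    the coefficient 0 is the mean, and the coefficient k.+1 compares the tail beyond
    the k-th branch with the k-th branch. The powers of rt2 normalise the vectors. *)
Definition haar_coef y k :=
  if k is k'.+1 then rt2 ^+ k' * (tail y k'.+1 - wt k' * y k') else tail y 0.

Lemma haar_coef_linear J y z (a b : R) k : constant_from J y -> constant_from J z ->
  haar_coef (fun j => a * y j + b * z j) k = a * haar_coef y k + b * haar_coef z k.
Proof.
move=> cy cz; case: k => [|k] /=; first exact: tail_linear cy cz.
rewrite (tail_linear _ _ _ cy cz).
by ring.
Qed.

Lemma haar_coef_constant y k : constant_from k y -> haar_coef y k.+1 = 0.
Proof.
move=> cy; have cy1 := constant_from_le (leqnSn k) cy.
rewrite /= tail_constant// wtS (cy k.+1)//.
have alg (r w u : R) : r * (2 * (w / 2) * u - w * u) = 0 by field.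
exact: alg.
Qed.

(** Parseval's identity: at each step, the parallelogram law splits the tail at k
    into the k-th coefficient, the k-th branch and the tail at k.+1. *)
Lemma haar_parseval J y z N : constant_from J y -> constant_from J z ->
  \sum_(k < N.+1) haar_coef y k * haar_coef z k =
  \sum_(j < N) wt j * (y j * z j) + tail y N * tail z N / (2 * wt N).
Proof.
move=> cy cz; elim: N => [|N IH].
  by rewrite big_ord_recr !big_ord0 /= !add0r /wt expr1 divff ?divr1// pnatr_eq0.
rewrite big_ord_recr/= IH big_ord_recr/= -!addrA; congr (_ + _).
rewrite (tail_step _ cy) (tail_step _ cz) wtS.
have r2 : rt2 ^+ N * rt2 ^+ N = (2 * wt N)^-1.
  have w2 : 2 * wt N != 0 by apply: mulf_neq0; rewrite ?pnatr_eq0// gt_eqF ?wt_gt0.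
  by apply: (mulIf w2); rewrite rt2X mulVf.
have w0 : wt N != 0 by rewrite gt_eqF ?wt_gt0.
have alg (r w u v s t : R) : w != 0 -> r * r = (2 * w)^-1 ->
  (w * u + s) * (w * v + t) / (2 * w) + r * (s - w * u) * (r * (t - w * v)) =
  w * (u * v) + s * t / (2 * (w / 2)).
  move=> w1 rr; rewrite (_ : r * _ * _ = r * r * ((s - w * u) * (t - w * v))); last by ring.
  by rewrite rr; field.
exact: alg.
Qed.

Definition partial_synth (c : nat -> R) j := c 0%N + \sum_(k < j) rt2 ^+ k * c k.+1.

(** The value at j of the Haar series with coefficients c: up to the power of rt2,
    the vector of index k.+1 is 1 beyond k, - 1 at k and 0 before k. *)
Definition haar_synth (c : nat -> R) j := partial_synth c j - rt2 ^+ j * c j.+1.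

Lemma haar_synth_const c N : (forall k, (N < k)%N -> c k = 0) ->
  constant_from N (haar_synth c).
Proof.
move=> c0 j /subnK <-; rewrite /haar_synth !c0 ?ltnS ?leq_addl// !mulr0 !subr0.
elim: (j - N)%N => // d IH; rewrite addSn /partial_synth big_ord_recr/= addrA -/(partial_synth _ _) IH.
by rewrite c0 ?mulr0 ?addr0// ltnS leq_addl.
Qed.

Lemma tail_synth c N k : (forall k, (N < k)%N -> c k = 0) ->
  tail (haar_synth c) k = 2 * wt k * partial_synth c k.
Proof.
move=> c0; pose n := maxn N k.
rewrite (tailE (haar_synth_const c0) (leq_maxl N k) (leq_maxr N k)).
have -> m : (k <= m)%N -> partial_tail (haar_synth c) k m =
    2 * wt k * partial_synth c k - 2 * wt m * (rt2 ^+ m * c m.+1).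
  move=> /subnK <-; elim: (m - k)%N => [|d IH].
    by rewrite add0n /partial_tail big_geq// add0r wt_half -mulrBr.
  rewrite addSn partial_tailS ?leq_addl// IH /haar_synth wtS /partial_synth big_ord_recr/=.
  have alg (A w u s v0 v : R) : A - 2 * w * u + w * (v0 + (s + u) - v - (v0 + s - u)) =
    A - 2 * (w / 2) * v by field.
  exact: alg.
by rewrite c0 ?mulr0 ?subr0// ltnS leq_maxl.
exact: leq_maxr.
Qed.

Lemma haar_synthK c N k : (forall k, (N < k)%N -> c k = 0) ->
  haar_coef (haar_synth c) k = c k.
Proof.
move=> c0; case: k => [|k] /=; rewrite (tail_synth _ c0).
  by rewrite /partial_synth big_ord0 addr0 /wt expr1 divff ?mul1r// pnatr_eq0.
rewrite /haar_synth wtS /partial_synth big_ord_recr/=.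
transitivity (rt2 ^+ k * rt2 ^+ k * (2 * wt k) * c k.+1); last by rewrite rt2X mul1r.
have alg (r w v0 s u : R) : r * (2 * (w / 2) * (v0 + (s + r * u)) - w * (v0 + s - r * u))
  = r * r * (2 * w) * u by field.
exact: alg.
Qed.

End haar_coefficients.

(** * The measures of the tower *)

Section borel_maps.
Context {R : realType}.
Implicit Types X Y : ptopologicalType.

Lemma measurable_fun_borel d (T : measurableType d) Y (f : T -> borel Y) :
  (forall U : set Y, open U -> measurable (f @^-1` U)) -> measurable_fun setT f.
Proof.
move=> h; apply: (@measurability _ _ _ _ setT f (@open Y) erefl) => _ [U oU <-].
by rewrite setTI; exact: h.
Qed.

Lemma borel_open Y (U : set Y) : open U -> measurable (U : set (borel Y)).
Proof. by move=> oU; exact: sub_sigma_algebra. Qed.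

Lemma continuous_borel X Y (f : X -> Y) : continuous f ->
  measurable_fun setT (f : borel X -> borel Y).
Proof.
move=> /continuousP cf; apply: measurable_fun_borel => U oU.
by apply: borel_open; exact: cf.
Qed.

Lemma continuous_R_borel Y (f : R -> Y) : continuous f ->
  measurable_fun setT (f : measurableTypeR R -> borel Y).
Proof.
move=> /continuousP cf; apply: measurable_fun_borel => U oU.
by apply: open_measurable; exact: cf.
Qed.

Lemma continuous_borel_R X (f : X -> R) : continuous f ->
  measurable_fun setT (f : borel X -> measurableTypeR R).
Proof.
move=> /continuousP cf; apply: (measurability _ (RGenOpens.measurableE R)) => _ [_ [a [b ->]] <-].
by rewrite setTI; apply: borel_open; apply: cf; exact: interval_open.
Qed.

End borel_maps.

Section image_measure.
Context {d1 d2} {T1 : measurableType d1} {T2 : measurableType d2} {R : realType}.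
Variables (m : {measure set T1 -> \bar R}) (f : T1 -> T2).

Definition image_measure (mf : measurable_fun setT f) : {measure set T2 -> \bar R} :=
  measure_function_pushforward__canonical__measure_function_Measure m mf.

End image_measure.

Section coin.
Context {R : realType} {G : ptopologicalType} (t : G).

Let half_ge0 : (0 : R) <= 2^-1. Proof. by rewrite invr_ge0. Qed.

Definition coin_add : set (borel G) -> \bar R :=
  measure_add (mscale (NngNum half_ge0) \d_(point : borel G))
              (mscale (NngNum half_ge0) \d_(t : borel G)).

HB.instance Definition _ := Measure.on coin_add.

Lemma coin_addE A : coin_add A = ((2^-1)%:E * \d_(point : borel G) A + (2^-1)%:E * \d_(t : borel G) A)%E.
Proof. by rewrite /coin_add measure_addE. Qed.

Let coin_addT : coin_add setT = 1%E.
Proof. by rewrite coin_addE !diracT !mule1 -EFinD; congr EFin; lra. Qed.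

HB.instance Definition _ := Measure_isProbability.Build _ _ _ coin_add coin_addT.

Definition coin : probability (borel G) R := coin_add.

Lemma coinE A : coin A = ((2^-1)%:E * \d_(point : borel G) A + (2^-1)%:E * \d_(t : borel G) A)%E.
Proof. exact: coin_addE. Qed.

Hypothesis open_all : forall A : set G, open A.

Lemma coin_measurable_fun d (T : measurableType d) (F : G -> T) : measurable_fun setT (F : borel G -> T).
Proof. by move=> _ A _; exact: borel_open. Qed.

Lemma coin_Rintegral (F : G -> R) :
  \int[coin]_g F g = 2^-1 * F point + 2^-1 * F t.
Proof.
have I (H : G -> \bar R) : (forall g, 0 <= H g)%E ->
    (\int[coin]_g H g = (2^-1)%:E * H point + (2^-1)%:E * H t)%E.
  move=> H0; have mH : measurable_fun setT (H : borel G -> \bar R) by exact: coin_measurable_fun.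
  rewrite ge0_integral_measure_add//= !ge0_integral_mscale//= !integral_dirac//.
  by rewrite !diracT !mul1e.
rewrite /Rintegral integralE !I// !funeposE !funenegE.
rewrite -!EFinN -!EFin_max -!EFinM -!EFinD /=.
have maxB (x : R) : Num.max x 0 - Num.max (- x) 0 = x.
  by case: (leP x 0) => x0; case: leP; lra.
by rewrite -[in RHS](maxB (F point)) -[in RHS](maxB (F t)); ring.
Qed.

Lemma coin_full_support : (forall g, g = point \/ g = t) -> radon coin /\ full_support coin.
Proof.
move=> gt; have dir1 (U : set (borel G)) : U !=set0 -> (0 < coin U)%E.
  move=> [g Ug]; rewrite coinE !diracE -!EFinM -EFinD lte_fin.
  by have [e|e] := gt g; rewrite -e [g \in U]mem_set//=.
split; last by move=> U _; exact: dir1.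
have cpt (K : set G) : compact K.
  apply: finite_compact; apply: (@sub_finite_set _ _ [set point; t]); last exact: finite_set2.
  by move=> g _; have [->|->] := gt g; [left|right].
split.
- by move=> K _; rewrite (le_lt_trans (probability_le1 coin _)) ?ltry//; exact: borel_open.
- move=> A mA; apply/esym/le_anti/andP; split.
    by apply: ereal_inf_lbound; exists A => //; split => //; exact: open_all.
  apply: le_ereal_inf_tmp => _ [U [_ AU] <-]; apply: le_measure => //; rewrite inE//; exact: borel_open.
- move=> U oU; apply/le_anti/andP; split; first by apply: ereal_sup_ubound; exists U => //; split.
  apply: ge_ereal_sup => _ [K [_ KU] <-]; apply: le_measure => //; rewrite inE; exact: borel_open.
Qed.

End coin.

Section tower_measure.
Context {R : realType} {len : R}.
Variable len0 : 0 < len.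
Variable a : nat -> R.
Hypothesis a_anti : forall i j, (i <= j)%N -> a j <= a i.
Hypothesis a_cvg : a @ \oo --> (0 : R).

Local Notation I := (itv0 len0).
Local Notation s := (haar_tower len0 a).
Local Notation P := (projlim s).
Local Notation curve := (@curve R len len0 a).
Local Notation sec := (@sec R len len0 a).
Local Notation Curve := (@Curve R len len0 a).

Definition path j (x : R) : borel P := Curve j (clamp len0 x).

Lemma path_measurable j : measurable_fun setT (path j : measurableTypeR R -> borel P).
Proof.
apply: continuous_R_borel => x; apply: continuous_comp; first exact: clamp_continuous.
exact: Curve_continuous.
Qed.

Definition wtnn j : {nonneg R} := NngNum (ltW (@wt_gt0 R j)).

(** Each branch carries the image of Lebesgue measure, with its weight; outside the
    windows the branches overlap and the weights add up. *)
Definition tower_measure : {measure set (borel P) -> \bar R} :=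
  mseries (fun j => mscale (wtnn j) (image_measure (leb len) (path_measurable j))) 0.

Lemma Phi_measurable i : measurable_fun setT (Phi s i : borel P -> borel (FF s i)).
Proof. by apply: continuous_borel; exact: Phi_continuous. Qed.

(** With images of [tower_measure] as the measures of the stages, the compatibility
    with the limit is built in, and the product formula of a Barlow-Evans sequence
    has to be proved ([stage_measureS]). *)
Definition stage_measure i : {measure set (borel (FF s i)) -> \bar R} :=
  image_measure tower_measure (@Phi_measurable i).

Let m j i (A : set (FF s i)) : \bar R := leb len [set x | A (curve j i (clamp len0 x))].

Lemma stage_measureE i (A : set (borel (FF s i))) :
  stage_measure i A = (\sum_(0 <= j <oo) ((wt j)%:E * m j A))%E.
Proof. by []. Qed.

Lemma wt_series (c : R) i : 0 <= c ->
  (\sum_(i <= j <oo) ((wt j)%:E * c%:E) = (2 * wt i)%:E * c%:E)%E.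
Proof.
move=> c0; apply/cvg_lim => //.
have h n : (i <= n)%N -> \sum_(i <= j < n) (wt j * c) = 2 * wt i * c - 2 * wt n * c.
  move=> /subnK <-; elim: (n - i)%N => [|d IH]; first by rewrite add0n big_geq// subrr.
  by rewrite addSn big_nat_recr ?leq_addl//= IH wtS; lra.
apply: (@cvg_trans _ ((2 * wt i * c - 2 * wt n * c)%:E @[n --> \oo])%classic).
  apply: near_eq_cvg; near=> n.
  under [RHS]eq_bigr do rewrite -EFinM.
  rewrite sumEFin h//.
  by near: n; exact: nbhs_infty_ge.
rewrite -EFinM; apply: cvg_EFin; first by near=> n.
rewrite -[X in _ --> X]subr0 -[X in _ - X](mul0r c); apply: cvgB; first exact: cvg_cst.
apply: cvgMl; rewrite (_ : (fun n => 2 * wt n) = (fun n => 2^-1 ^+ n)); last by apply/funext => n; rewrite wt_half.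
by apply: cvg_expr; rewrite ger0_norm ?invr_ge0// invf_lt1// ltr1n.
Unshelve. all: by end_near. Qed.

Lemma leb_fin_num (A : set R) : measurable A -> leb len A \is a fin_num.
Proof. by move=> mA; exact: (leb_fin len). Qed.

Lemma curve_preimage_measurable j i (A : set (borel (FF s i))) : measurable A ->
  measurable [set x | A (curve j i (clamp len0 x))].
Proof.
move=> mA; have := @path_measurable j measurableT _ (@Phi_measurable i measurableT _ mA).
by rewrite !setTI.
Qed.

Lemma m_fine i j (A : set (borel (FF s i))) : measurable A -> m j A = (fine (m j A))%:E.
Proof. by move=> mA; rewrite fineK// leb_fin_num//; exact: curve_preimage_measurable. Qed.

(** From the i-th branch on, all branches are the base branch at stage i; it carries
    the mass of all of them. *)
Lemma stage_measure_split i (A : set (borel (FF s i))) : measurable A ->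
  stage_measure i A =
  (\sum_(0 <= j < i) ((wt j)%:E * m j A) + (2 * wt i)%:E * m i A)%E.
Proof.
move=> mA; rewrite stage_measureE (nneseries_split 0 i) ?add0n; last first.
  by move=> k _; rewrite mule_ge0// lee_fin ltW// wt_gt0.
congr (_ + _)%E; rewrite m_fine// -wt_series ?fine_ge0//.
apply: congr_lim; apply/funext => n; apply: eq_big_nat => j /andP[ij _]; congr (_ * _)%E.
by rewrite -m_fine// /m !curve_sec.
Qed.


Lemma stage_measure_fine i (A : set (borel (FF s i))) : measurable A ->
  stage_measure i A =
  (\sum_(0 <= j < i) (wt j * fine (m j A)) + 2 * wt i * fine (m i A))%:E.
Proof.
move=> mA; rewrite stage_measure_split// EFinD -sumEFin [in RHS]EFinM -!m_fine//.
by congr (_ + _)%E; apply: eq_bigr => j _; rewrite EFinM -m_fine.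
Qed.

Definition fair_coin i : probability (borel (GG s i)) R := coin (tip len0 a i).

(** The coin splits the mass 2 wt i of the base branch into wt i for the i-th branch
    and 2 wt i.+1 = wt i for the new base branch. *)
Lemma stage_measureS i (A : set (borel (FF s i.+1))) : measurable A ->
  stage_measure i.+1 A = (stage_measure i \x fair_coin i)%E (ppi s i @^-1` A).
Proof.
move=> mA; pose B g : set (borel (FF s i)) := [set p | A (ppi s i (p, g))].
have mB g : measurable (B g).
  have := continuous_borel (@ppi_continuousl R len len0 a i g).
  by move=> /(_ measurableT _ mA); rewrite setTI.
have -> : (stage_measure i \x fair_coin i)%E (ppi s i @^-1` A) = (\int[stage_measure i]_p
  ((2^-1)%:E * (\1_(B point) p)%:E + (2^-1)%:E * (\1_(B (tip len0 a i)) p)%:E))%E.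
  rewrite /product_measure1; apply: eq_integral => p _ /=; rewrite /fair_coin coinE !diracE !indicE; congr (_ * _%:R%:E + _ * _%:R%:E)%E.
    by congr nat_of_bool; apply/idP/idP => /set_mem h; apply/mem_set; move: h; rewrite /xsection /= ?inE.
  by congr nat_of_bool; apply/idP/idP => /set_mem h; apply/mem_set; move: h; rewrite /xsection /= ?inE.
have mI g : measurable_fun setT (fun p => (\1_(B g) p : R)%:E).
  by apply/measurable_EFinP; exact: measurable_indic.
pose F g p := ((2^-1)%:E * (\1_(B g) p)%:E : \bar R)%E.
have F0 g p : setT p -> (0 <= F g p)%E by rewrite /F -EFinM lee_fin mulr_ge0.
have mF g : measurable_fun setT (F g) by exact: measurable_funeM.
have IF g : (\int[stage_measure i]_p F g p = (2^-1)%:E * stage_measure i (B g))%E.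
  rewrite (@ge0_integralZl _ _ _ (stage_measure i) _ measurableT (fun p => (\1_(B g) p)%:E))//.
  by rewrite integral_indic// setIT.
rewrite (@ge0_integralD _ _ _ (stage_measure i) _ measurableT (F point) (F (tip len0 a i)) (F0 _) (mF _) (F0 _) (mF _)) !IF.
rewrite !stage_measure_fine// -!EFinM -EFinD; congr (_%:E).
have ml j g : (j < i)%N -> m j (B g) = m j A.
  by move=> ji; rewrite /m /B /=; congr (leb len _); apply/funext => x /=; rewrite ppi_curve.
have mt : m i (B (tip len0 a i)) = m i A.
  by rewrite /m /B /=; congr (leb len _); apply/funext => x /=; rewrite eqxx.
have mp : m i (B point) = m i.+1 A.
  by rewrite /m /B /=; congr (leb len _); apply/funext => x /=; rewrite (ltn_eqF (ltnSn i)) !curve_sec.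
rewrite big_nat_recr//= mt mp.
have sm g : \sum_(0 <= j < i) wt j * fine (m j (B g)) = \sum_(0 <= j < i) wt j * fine (m j A).
  by apply: eq_big_nat => j /andP[_ ji]; rewrite ml.
rewrite (sm point) (sm (tip len0 a i)) wtS.
move: (\sum_(0 <= _ < i) _) (wt i) (fine (m i A)) (fine (m i.+1 A)) => S w u v.
by field.
Qed.

Lemma base_measureE (A : set (borel I)) : measurable A ->
  stage_measure 0 A = lebesgue_measure (set_val @` A).
Proof.
move=> mA; rewrite stage_measure_split// big_geq// add0r /wt expr1 divff ?mul1e ?pnatr_eq0//.
have mA' : measurable ((clamp len0 : measurableTypeR R -> borel I) @^-1` A).
  have := continuous_R_borel (@clamp_continuous R len len0).
  by move=> /(_ measurableT _ mA); rewrite setTI.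
have e : set_val @` A = (clamp len0 @^-1` A) `&` `[0, len].
  apply/seteqP; split => [_ [x Ax <-]|x [Ax x01]].
    by split; rewrite /= ?clampK// in_itv /= itv0P.
  by exists (clamp len0 x) => //; rewrite clampE.
rewrite e /m lebE /=; set B := clamp len0 @^-1` A.
have eU : B `&` `[0, len] = (B `&` `]0, len[) `|` (B `&` [set 0; len]).
  rewrite -setIUr; congr (_ `&` _); apply/seteqP; split => x; rewrite /= !in_itv /=.
    move=> /andP[]; rewrite !le_eqVlt => /orP[/eqP <-|x0]; first by right; left.
    by move=> /orP[/eqP ->|xl]; [right; right|left; rewrite x0].
  by move=> [/andP[x0 xl]|[->|->]]; rewrite ?lexx ?ltW.
have mN : measurable (B `&` [set 0; len] : set (measurableTypeR R)).
  by apply: measurableI => //; apply: measurableU; exact: measurable_set1.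
have mB : measurable (B `&` `]0, len[ : set (measurableTypeR R)).
  by apply: measurableI => //; exact: measurable_itv.
rewrite eU (measureU0 mB mN)//.
apply: countable_lebesgue_measure0; apply: finite_set_countable.
apply: (@sub_finite_set _ _ [set 0; len]); last exact: finite_set2.
exact: subIsetr.
Qed.

Lemma borel_image_measurable (A : set (borel I)) : measurable A ->
  measurable (set_val @` A : set (measurableTypeR R)).
Proof.
move=> mA; rewrite (_ : set_val @` A = (clamp len0 @^-1` A) `&` `[0, len]); last first.
  apply/seteqP; split => [_ [x Ax <-]|x [Ax x01]].
    by split; rewrite /= ?clampK// in_itv /= itv0P.
  by exists (clamp len0 x) => //; rewrite clampE.
apply: measurableI; last exact: measurable_itv.
have := continuous_R_borel (@clamp_continuous R len len0).
by move=> /(_ measurableT _ mA); rewrite setTI.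
Qed.

Lemma base_measure_lty (A : set (borel I)) : measurable A -> (stage_measure 0 A < +oo)%E.
Proof. by move=> mA; rewrite stage_measure_fine// ltry. Qed.

Lemma base_sigma_finite : sigma_finite setT (stage_measure 0).
Proof.
exists (fun=> setT); first by rewrite bigcup_const//; exists 0%N.
by move=> _; split => //; exact: base_measure_lty.
Qed.

Lemma base_open_val (U : set I) : open U ->
  exists V : set R, open V /\ U = set_val @^-1` V.
Proof. by move=> [V oV <-]; exists V. Qed.

Lemma compact_borel (K : set I) : compact K -> measurable (K : set (borel I)).
Proof.
move=> cK; rewrite -[K]setCK; apply: measurableC; apply: borel_open; apply: closed_openC.
by apply: compact_closed => //; exact: itv0_hausdorff.
Qed.

(** The regularity of Lebesgue measure, transported to the interval. *)
Lemma base_radon : radon (stage_measure 0).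
Proof.
split.
- move=> K cK; apply: base_measure_lty.
  exact: compact_borel cK.
- move=> A mA; apply/le_anti/andP; split.
    apply: le_ereal_inf_tmp => _ [U [oU AU] <-]; apply: le_measure => //; rewrite inE//; exact: borel_open.
  have mA' := borel_image_measurable mA.
  apply/lee_addgt0Pr => e e0.
  have Alty : (lebesgue_measure (set_val @` A) < +oo)%E by rewrite -base_measureE ?base_measure_lty.
  have [V [oV AV VA]] := lebesgue_regularity_outer mA' Alty e0.
  have oU : open (set_val @^-1` V : set I) by exists V.
  apply: (@le_trans _ _ (stage_measure 0 (set_val @^-1` V : set I))).
    by apply: ereal_inf_lbound; exists (set_val @^-1` V) => //; split => // x Ax; apply: AV; exists x.
  rewrite !base_measureE//; last exact: borel_open.
  have mV : measurable (V : set (measurableTypeR R)) by exact: open_measurable.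
  apply: (@le_trans _ _ (lebesgue_measure V)).
    apply: le_measure; rewrite ?inE//; last by move=> _ [x Vx <-].
    by apply: borel_image_measurable; exact: borel_open.
  rewrite -(setDUK AV) measureU//; last by rewrite setDIK.
    by rewrite leeD2l// ltW.
  exact: measurableD.
- move=> U oU; rewrite base_measureE; last exact: borel_open.
  rewrite lebesgue_regularity_inner_sup; last by apply: borel_image_measurable; exact: borel_open.
  have mK := compact_borel.
  congr ereal_sup; apply/seteqP; split => _ [K [cK KU] <-].
    have cK' : compact (clamp len0 @` K).
      by apply: continuous_compact => //; exact/continuous_subspaceT/clamp_continuous.
    have KK : set_val @` (clamp len0 @` K) = K.
      apply/seteqP; split => [_ [_ [x Kx <-] <-]|x Kx]; have [y _ ey] := KU _ Kx.
        by rewrite -ey clampK ey.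
      by exists y => //; exists x => //; rewrite -ey clampK.
    exists (clamp len0 @` K); last by rewrite base_measureE ?KK//; exact: mK.
    by split => // _ [x Kx <-]; have [y Uy <-] := KU _ Kx; rewrite clampK.
  exists (set_val @` K); last by rewrite base_measureE//; exact: mK.
  split; last exact: image_subset.
  by apply: continuous_compact => //; exact/continuous_subspaceT/set_val_continuous.
Qed.

Lemma base_full_support : full_support (stage_measure 0).
Proof.
move=> U oU [x Ux]; rewrite base_measureE; last exact: borel_open.
have [V [oV UV]] := base_open_val oU; have /andP[x0 xl] := itv0P x.
have Vx : V (set_val x) by move: Ux; rewrite UV.
have /nbhs_ballP[e /= e0 eV] : nbhs (set_val x : R) V by exact: open_nbhs_nbhs.
pose p := Num.max 0 (set_val x - e); pose q := Num.min len (set_val x + e).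
have pq : p < q.
  by rewrite /p /q gt_max !lt_min len0 /=; do ?[apply/andP; split]; lra.
apply: (@lt_le_trans _ _ (lebesgue_measure `]p, q[%classic)).
  by rewrite lebesgue_measure_itv/= lte_fin pq -EFinB lte_fin subr_gt0.
apply: le_measure; rewrite ?inE; [exact: measurable_itv|apply: borel_image_measurable; exact: borel_open|].
move=> t; rewrite /= in_itv /= /p /q gt_max lt_min => /andP[/andP[t0 tx] /andP[tl xt]].
exists (clamp len0 t); last by rewrite clampE// !ltW.
rewrite UV /= clampE ?ltW//; apply: eV; rewrite /ball /= ltr_norml.
by apply/andP; split; lra.
Qed.

Definition haar_sequence : barlow_evans R I.
Proof.
apply: (@BarlowEvans R I s stage_measure fair_coin).
- by split; [exact: itv0_locally_compact|exact: itv0_second_countable|exact: itv0_hausdorff].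
- by split; [exact: base_sigma_finite|exact: base_radon|exact: base_full_support].
- move=> i; have [[t [_ gt]] oG] := GG_two len0 a i.
  have fG : finite_set [set: GG s i].
    apply: (@sub_finite_set _ _ [set point; t]); last exact: finite_set2.
    by move=> g _; have [->|->] := gt g; [left|right].
  split; first exact: finite_compact.
    exists [set [set g] | g in [set: GG s i]].
      exact/finite_set_countable/finite_image.
    split; first by move=> _ [g _ <-]; exact: oG.
    move=> g V Vg; exists [set g]; first by split => //; exists g.
    by move=> _ ->; exact: nbhs_singleton.
  move=> p q pq; have [z [-> ->]] := pq [set p] [set q] (open_nbhs_nbhs (conj (oG _) erefl)) (open_nbhs_nbhs (conj (oG _) erefl)).
  by [].
- by move=> i; apply: coin_full_support; [exact: (GG_two len0 a i).2|exact: GGP].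
- by move=> i; exact: BB_closed.
- exact: stage_measureS.
Defined.

Lemma haar_projlim_measure : projlim_measure haar_sequence tower_measure.
Proof. by []. Qed.

End tower_measure.

(** * Functions on the limit space and their coefficients *)

Section tower_coefficients.
Context {R : realType} {len : R}.
Variable len0 : 0 < len.
Variable a : nat -> R.
Hypothesis a_anti : forall i j, (i <= j)%N -> a j <= a i.
Hypothesis a_cvg : a @ \oo --> (0 : R).
Hypothesis a_le : forall i, a i <= len.

Local Notation I := (itv0 len0).
Local Notation s := (haar_tower len0 a).
Local Notation P := (projlim s).
Local Notation curve := (@curve R len len0 a).
Local Notation sec := (@sec R len len0 a).
Local Notation path := (@path R len len0 a).
Local Notation mu := (@tower_measure R len len0 a).
Local Notation window := (@window R len len0 a).
Implicit Types f g : P -> R.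

Definition fibre f x j : R := f (path j x).

Lemma path_collapse k x : ~ window k (clamp len0 x) -> forall j, (k <= j)%N ->
  path j x = path k x.
Proof.
move=> nk j kj; apply: Curve_collapse => // wj.
by apply: nk; exact: window_anti kj _ wj.
Qed.

(** The bound J works for all functions: it is a step from which on x lies outside
    the windows. *)
Lemma fibre_const x : exists J, forall f, constant_from J (fibre f x).
Proof.
have [J _ h] := window_near a_cvg (clamp len0 x).
exists J => f j Jj; rewrite /fibre (@path_collapse J)//; exact: h (leqnn J).
Qed.

(** A function on the limit space is encoded by the Haar coefficients of its values
    above x; the k-th one is a function on ]0, coef_length k[. *)
Definition coef f k x := haar_coef (fibre f x) k.

Arguments coef : simpl never.
Arguments fibre : simpl never.

Definition coef_length k := if k is k'.+1 then a k' else len.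

Lemma length_le k : coef_length k <= len.
Proof. by case: k. Qed.

Lemma windowP k x : window k (clamp len0 x) -> 0 < x < a k.
Proof.
rewrite windowE /= lt_max ltxx lt_min len0 andbT /= gt_max gt_min.
case/andP => x0 /andP[_ /orP[->|]]; first by rewrite x0.
by rewrite ltNge a_le.
Qed.

Lemma window_clamp k x : 0 < x < a k -> window k (clamp len0 x).
Proof.
move=> /andP[x0 xa]; rewrite windowE /= (@clampE _ _ len0) ?x0//.
by rewrite ltW//= (le_trans (ltW xa)).
Qed.

(** Outside the k-th window the fibre is constant from k on. *)
Lemma coef_vanish f k x : ~ window k (clamp len0 x) -> coef f k.+1 x = 0.
Proof.
move=> nk; apply: haar_coef_constant => j kj.
by rewrite /fibre (path_collapse nk).
Qed.

Lemma coef_linear b c f g k x :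
  coef (fun p => b * f p + c * g p) k x = b * coef f k x + c * coef g k x.
Proof.
have [J cJ] := fibre_const x.
exact: (haar_coef_linear _ _ _ (cJ f) (cJ g)).
Qed.

Lemma fibre_measurable f j : measurable_fun setT (f : borel P -> R) ->
  measurable_fun setT (fun x => fibre f x j).
Proof. by move=> mf; apply: measurableT_comp mf _; exact: path_measurable. Qed.

Lemma coef_measurable f k : measurable_fun setT (f : borel P -> R) ->
  measurable_fun setT (coef f k : R -> R).
Proof.
move=> mf; have mt i : measurable_fun setT (fun x => tail (fibre f x) i).
  apply: (@measurable_fun_cvg _ _ _ _ (fun n x => partial_tail (fibre f x) i n)).
    move=> n; apply: measurable_funD.
      by apply: measurable_sum => j; apply: measurable_funM => //; exact: fibre_measurable.
    by apply: measurable_funM => //; exact: fibre_measurable.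
  move=> x _; have [J cJ] := fibre_const x.
  rewrite (tailE (cJ f) (leq_maxl J i) (leq_maxr J i)).
  exact: (cvg_partial_tail (cJ f) (leq_maxl J i) (leq_maxr J i)).
case: k => [|k]; first exact: mt.
apply: measurable_funM => //; apply: measurable_funB => //.
by apply: measurable_funM => //; exact: fibre_measurable.
Qed.

Lemma tower_integral (g : borel P -> \bar R) : (forall p, 0 <= g p)%E ->
  measurable_fun setT g ->
  (\int[mu]_p g p = \sum_(0 <= j <oo) ((wt j)%:E * \int[leb len]_x g (path j x)))%E.
Proof.
move=> g0 mg; rewrite ge0_integral_measure_series//; apply: eq_eseriesr => j _.
rewrite ge0_integral_mscale//=; congr (_ * _)%E.
by rewrite ge0_integral_pushforward//; exact: path_measurable.
Qed.

(** The limit of [haar_parseval], above x. *)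
Lemma coef_sqr_series f x :
  (\sum_(0 <= k <oo) ((coef f k x) ^+ 2)%:E =
   \sum_(0 <= j <oo) (wt j * (fibre f x j) ^+ 2)%:E)%E.
Proof.
have [J cJ] := fibre_const x; have {cJ} cy := cJ f; set y := fibre f x in cy *.
pose z j := y j ^+ 2; have cz : constant_from J z by move=> j Jj; rewrite /z cy.
have eL : (\sum_(0 <= k < n) ((coef f k x) ^+ 2)%:E)%E @[n --> \oo] --> (tail z 0)%:E.
  rewrite -(cvg_shiftS (fun n => \sum_(0 <= k < n) ((coef f k x) ^+ 2)%:E)%E).
  apply: (@cvg_trans _ (@cst nat (\bar R) (tail z 0)%:E @ \oo)); last exact: cvg_cst.
  apply: near_eq_cvg; near=> n; rewrite /cst/=.
  have Jn : (J <= n)%N by near: n; exact: nbhs_infty_ge.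
  rewrite sumEFin big_mkord; congr EFin; apply/esym.
  rewrite (eq_bigr (fun k : 'I_n.+1 => haar_coef y k * haar_coef y k))//.
  rewrite (haar_parseval _ cy cy) (tailE cz Jn)// /partial_tail.
  rewrite (tail_constant (constant_from_le Jn cy)) wt_half big_mkord; congr (_ + _).
  have w0 : wt n != 0 :> R by rewrite gt_eqF ?wt_gt0.
  by rewrite /z; field.
have eR : (\sum_(0 <= j < n) (wt j * y j ^+ 2)%:E)%E @[n --> \oo] --> (tail z 0)%:E.
  apply: (@cvg_trans _ ((tail z 0 - 2^-1 ^+ n * y J ^+ 2)%:E @[n --> \oo])%classic).
    apply: near_eq_cvg; near=> n.
    have Jn : (J <= n)%N by near: n; exact: nbhs_infty_ge.
    by rewrite sumEFin (tailE cz Jn)// /partial_tail /z (cy n)// addrK.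
  apply: cvg_EFin; first by near=> n.
  rewrite -[X in _ --> X]subr0 -(mul0r (y J ^+ 2)); apply: cvgB; first exact: cvg_cst.
  by apply: cvgMl; apply: cvg_expr; rewrite ger0_norm ?invr_ge0// invf_lt1// ltr1n.
by rewrite (cvg_lim _ eL)// (cvg_lim _ eR).
Unshelve. all: by end_near. Qed.

Lemma coef_integral_restrict f k : measurable_fun setT (f : borel P -> R) ->
  (\int[leb len]_x ((coef f k x) ^+ 2)%:E = \int[leb (coef_length k)]_x ((coef f k x) ^+ 2)%:E)%E.
Proof.
move=> mf; have mW : measurable_fun setT (fun x => ((coef f k x) ^+ 2)%:E).
  by apply/measurable_EFinP/measurable_funX; exact: coef_measurable.
case: k mW => [//|k] mW; rewrite /coef_length !integral_leb//.
rewrite integral_mkcond [RHS]integral_mkcond; apply: eq_integral => x _.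
rewrite /patch !mem_setE !in_itv /=; case: ifPn => [/andP[x0 xl]|xl].
  case: ifPn => //; rewrite x0 /= => xa; rewrite coef_vanish ?expr0n//.
  by move/windowP; rewrite x0 (negPf xa).
case: ifPn => // /andP[x0 xa]; move: xl; rewrite x0 /= (lt_le_trans xa)//.
Qed.

(** Parseval's identity above x, integrated over the base. *)
Lemma coef_parseval f : measurable_fun setT (f : borel P -> R) ->
  (\int[mu]_p (f p ^+ 2)%:E =
   \sum_(0 <= k <oo) \int[leb (coef_length k)]_x ((coef f k x) ^+ 2)%:E)%E.
Proof.
move=> mf; rewrite tower_integral; first last.
- by apply/measurable_EFinP/measurable_funX.
- by move=> p; rewrite lee_fin sqr_ge0.
transitivity (\sum_(0 <= j <oo) \int[leb len]_x (wt j * (fibre f x j) ^+ 2)%:E)%E.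
  apply: eq_eseriesr => j _; under [RHS]eq_integral do rewrite EFinM.
  rewrite ge0_integralZl//.
  - by apply/measurable_EFinP/measurable_funX; exact: fibre_measurable.
  - by move=> x _; rewrite lee_fin sqr_ge0.
  - by rewrite lee_fin ltW// wt_gt0.
have mF j : measurable_fun setT (fun x => (wt j * (fibre f x j) ^+ 2)%:E).
  by apply/measurable_EFinP/measurable_funM => //; apply/measurable_funX; exact: fibre_measurable.
have mW k : measurable_fun setT (fun x => ((coef f k x) ^+ 2)%:E).
  by apply/measurable_EFinP/measurable_funX; exact: coef_measurable.
rewrite -(@integral_nneseries _ _ _ (leb len) setT measurableT _ mF); last first.
  by move=> j x _; rewrite lee_fin mulr_ge0 ?sqr_ge0// ltW// wt_gt0.
transitivity (\int[leb len]_x (\sum_(0 <= k <oo) ((coef f k x) ^+ 2)%:E))%E.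
  by apply: eq_integral => x _; rewrite coef_sqr_series.
rewrite (@integral_nneseries _ _ _ (leb len) setT measurableT _ mW); last first.
  by move=> k x _; rewrite lee_fin sqr_ge0.
by apply: eq_eseriesr => k _; exact: coef_integral_restrict.
Qed.

(** The Haar vector of index k.+1 as a function on the limit space, before
    normalisation: 1 on the base branch above the window after step k, - 1 on the
    new copy. *)
Definition haar k (p : P) : R :=
  \1_(sec k.+1 @` window k) (Phi s k.+1 p) - \1_(curve k k.+1 @` window k) (Phi s k.+1 p).

Definition base_point (p : P) : R := set_val (Phi s 0 p : I).

(** The function with prescribed coefficients c; at every point only finitely many
    terms of the series are not zero. *)
Definition synth (c : nat -> R -> R) (p : P) : R :=
  c 0%N (base_point p) +
  limn (fun n => \sum_(0 <= k < n) rt2 ^+ k * haar k p * c k.+1 (base_point p)).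

Lemma base_point_path j x : base_point (path j x) = set_val (clamp len0 x).
Proof. by []. Qed.

Lemma haar_path k j x : haar k (path j x) =
  if `[< window k (clamp len0 x) >] then (k < j)%:R - (k == j)%:R else 0.
Proof.
rewrite /haar !indicE /path Phi_Curve.
set y := clamp len0 x; have cs : curve k.+1 k.+1 = sec k.+1 by rewrite curve_sec.
have inE' i : (curve j k.+1 y \in curve i k.+1 @` window k) =
    `[< window k y /\ curve j k.+1 y = curve i k.+1 y >].
  apply/idP/asboolP => [/set_mem[z wz e]|[wy ->]]; last by apply/mem_set; exists y.
  have zy : z = y by rewrite -(abscissa_curve a i k.+1 z) e abscissa_curve.
  by rewrite -zy e zy; split => //; rewrite -zy.
have neq i j' : (i < k.+1)%N -> window k y -> (i < j')%N -> curve j' k.+1 y <> curve i k.+1 y.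
  move=> ik wy ij' e; have ik' : (i <= k)%N by [].
  have wi : window i y by exact: (window_anti a_anti ik' wy).
  apply: (@curve_neq_sec _ _ len0 _ i i.+1 y (ltnSn i) wi).
  rewrite -(curve_sec len0 a ij'); move: e; rewrite -(subnK ik).
  elim: (k.+1 - i.+1)%N => [|n IH]; first by rewrite add0n => ->.
  by rewrite addSn => /(congr1 (phi s _)); rewrite /= !phi_ppi.
rewrite -cs !inE'; case: asboolP => [[wy e]|h1]; case: asboolP => [[wy' e']|h2].
- by exfalso; apply: (neq k k.+1) => //; rewrite -e -e'.
- rewrite asboolT//; have [kj|jk|kj] := ltngtP k j; first by [].
    by exfalso; apply: (neq j k.+1) => //; rewrite ?e// ltnW// ltnS.
  by exfalso; apply: h2; rewrite -kj.
- rewrite asboolT//.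
  have [kj|jk|//] := ltngtP k j; first by exfalso; apply: h1; split=> //; rewrite !curve_sec.
  by exfalso; apply: (neq j k) => //; rewrite ltnW// ltnS.
- case: asboolP => [wy|_]; last by rewrite subrr.
  have [kj|//|kj] := ltngtP k j.
    by exfalso; apply: h1; split=> //; rewrite !curve_sec.
  by exfalso; apply: h2; rewrite -kj.
Qed.

Lemma haar_sum_cvg c j x : let y := set_val (clamp len0 x) in
  let d k := if `[< window k (clamp len0 x) >] then c k.+1 y else 0 in
  \sum_(0 <= k < n) rt2 ^+ k * haar k (path j x) * c k.+1 y @[n --> \oo] -->
  \sum_(k < j) rt2 ^+ k * d k - rt2 ^+ j * d j.
Proof.
move=> y d.
apply: (@cvg_trans _ (@cst nat R (\sum_(k < j) rt2 ^+ k * d k - rt2 ^+ j * d j) @ \oo)); last exact: cvg_cst.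
apply: near_eq_cvg; near=> n; rewrite /cst/=.
have jn : (j < n)%N by near: n; exact: nbhs_infty_gt.
have term k : rt2 ^+ k * haar k (path j x) * c k.+1 y = rt2 ^+ k * d k * ((k < j)%:R - (k == j)%:R).
  by rewrite haar_path /d; case: ifP => _; ring.
rewrite (eq_bigr _ (fun k _ => term k)) (big_cat_nat (leq0n j) (ltnW jn))/=.
rewrite [X in _ = _ + X]big_ltn//.
rewrite [X in _ = _ + (_ + X)]big_nat_cond [X in _ = _ + (_ + X)]big1 ?addr0; last first.
  by move=> k /andP[/andP[jk _] _]; rewrite ltnNge (ltnW jk) gtn_eqF//= subrr mulr0.
rewrite ltnn eqxx sub0r mulrN1; congr (_ - _); rewrite big_mkord.
by apply: eq_bigr => k _; rewrite ltn_ord ltn_eqF// subr0 mulr1.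
Unshelve. all: by end_near. Qed.

Lemma synth_path c j x : synth c (path j x) =
  haar_synth (fun k => if k is k'.+1
    then (if `[< window k' (clamp len0 x) >] then c k (set_val (clamp len0 x)) else 0)
    else c 0%N (set_val (clamp len0 x))) j.
Proof.
rewrite /synth /haar_synth /partial_synth base_point_path -addrA; congr (_ + _).
apply/cvg_lim => //; exact: haar_sum_cvg.
Qed.

Lemma coef_synth c k x : 0 < x < coef_length k -> coef (synth c) k x = c k x.
Proof.
move=> /andP[x0 xl]; have xl' : 0 <= x <= len by rewrite !ltW// (lt_le_trans xl)// length_le.
rewrite /coef (_ : fibre _ x = haar_synth (fun k => if k is k'.+1
    then (if `[< window k' (clamp len0 x) >] then c k x else 0) else c 0%N x)); last first.
  by apply/funext => j; rewrite /fibre synth_path clampE.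
have [N _ hN] := window_near a_cvg (clamp len0 x).
rewrite (@haar_synthK _ _ N.+1).
  by case: k xl => // k xa; rewrite asboolT//; apply: window_clamp; rewrite x0.
move=> [//|k']; rewrite ltnS => Nk; rewrite asboolF//.
by apply: hN; rewrite /= ltnW.
Qed.

Lemma haar_measurable k : measurable_fun setT (haar k : borel P -> R).
Proof.
by apply: measurable_funB; apply: (measurableT_comp _ (@Phi_measurable _ _ len0 a k.+1));
  apply: measurable_indic; apply: borel_open; [exact: twig_open|exact: curve_open].
Qed.

Lemma base_point_measurable : measurable_fun setT (base_point : borel P -> measurableTypeR R).
Proof.
apply: (@measurableT_comp _ _ _ _ _ _ (set_val : borel I -> measurableTypeR R)).
  by apply: continuous_borel_R; exact: set_val_continuous.
exact: (@Phi_measurable _ _ len0 a 0).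
Qed.

Lemma synth_measurable c : (forall k, measurable_fun setT (c k)) ->
  measurable_fun setT (synth c : borel P -> R).
Proof.
move=> mc; have mcb k : measurable_fun setT (fun p : borel P => c k (base_point p)).
  by apply: measurableT_comp (mc k) _; exact: base_point_measurable.
apply: measurable_funD; first exact: mcb.
apply: (@measurable_fun_cvg _ _ _ _
    (fun n (p : borel P) => \sum_(0 <= k < n) rt2 ^+ k * haar k p * c k.+1 (base_point p) : R)).
  move=> n; apply: measurable_sum => k; apply: measurable_funM; last exact: mcb.
  by apply: measurable_funM => //; exact: haar_measurable.
move=> p _; have [j pj] := projlim_Curve a_anti a_cvg p.
have -> : p = path j (set_val (Phi s 0 p : I)) by rewrite /path clampK.
have h := @haar_sum_cvg c j (set_val (Phi s 0 p : I)).
by rewrite base_point_path; rewrite (cvg_lim _ h).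
Qed.

End tower_coefficients.

(** * The closure of a diagonal form *)

Section semidefinite_form.
Context {R : realType} {T : Type}.
Variable E : bform R T.
Local Notation D := (fdom E).
Local Notation B := (fval E).
Hypothesis DL : forall b c f g, D f -> D g -> D (fun x => b * f x + c * g x).
Hypothesis BL : forall b c f g h, D f -> D g -> D h ->
  B (fun x => b * f x + c * g x) h = b * B f h + c * B g h.
Hypothesis BC : forall f g, D f -> D g -> B f g = B g f.
Hypothesis B_ge0 : forall f, D f -> 0 <= B f f.

Let subE (f g : T -> R) : (fun x => f x - g x) = (fun x => 1 * f x + (-1) * g x).
Proof. by apply/funext => x; rewrite mul1r mulN1r. Qed.

Lemma form_domB f g : D f -> D g -> D (fun x => f x - g x).
Proof. by move=> Df Dg; rewrite subE; exact: DL. Qed.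

Lemma formBl f g h : D f -> D g -> D h -> B (fun x => f x - g x) h = B f h - B g h.
Proof. by move=> Df Dg Dh; rewrite subE BL// mul1r mulN1r. Qed.

Lemma formBr f g h : D f -> D g -> D h -> B h (fun x => f x - g x) = B h f - B h g.
Proof. by move=> Df Dg Dh; rewrite BC ?formBl ?(BC Dh)//; exact: form_domB. Qed.

Lemma form_cauchy_schwarz f g : D f -> D g -> B f g ^+ 2 <= B f f * B g g.
Proof.
move=> Df Dg.
have q t : 0 <= t ^+ 2 * B f f - 2 * t * B f g + B g g.
  have Dtf : D (fun x => t * f x + (-1) * g x) by exact: DL.
  have := B_ge0 Dtf; rewrite BL// (BC Df Dtf) (BC Dg Dtf) !BL// (BC Dg Df).
  by move=> h; apply: (le_trans h); rewrite le_eqVlt; apply/orP; left; apply/eqP; ring.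
have [a0|a0] := eqVneq (B f f) 0.
  rewrite a0 mul0r; have [->|b0] := eqVneq (B f g) 0; first by rewrite expr0n.
  have := q ((B g g + 1) / (2 * B f g)); rewrite a0 mulr0 sub0r => h.
  exfalso; move: h; apply/negP; rewrite -ltNge.
  have -> : 2 * ((B g g + 1) / (2 * B f g)) * B f g = B g g + 1 by field.
  by lra.
have a1 : 0 < B f f by rewrite lt_def a0 B_ge0.
have := q (B f g / B f f).
have -> : (B f g / B f f) ^+ 2 * B f f - 2 * (B f g / B f f) * B f g + B g g =
  B g g - B f g ^+ 2 / B f f by field.
by rewrite subr_ge0 ler_pdivrMr// mulrC.
Qed.

Lemma form_parallelogram f g : D f -> D g ->
  B (fun x => f x - g x) (fun x => f x - g x) <= 2 * B f f + 2 * B g g.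
Proof.
move=> Df Dg; have DB := form_domB Df Dg.
have Dp : D (fun x => 1 * f x + 1 * g x) by exact: DL.
have := B_ge0 Dp; rewrite BL// (BC Df Dp) (BC Dg Dp) !BL//.
rewrite formBl// (BC Df DB) (BC Dg DB) !formBl// (BC Dg Df) => h.
by move: h; lra.
Qed.

Definition form_cauchy (u : nat -> T -> R) := forall e : R, 0 < e ->
  exists N, forall m n, (N <= m)%N -> (N <= n)%N ->
    B (fun x => u m x - u n x) (fun x => u m x - u n x) < e.

Lemma form_cauchyB u v : (forall n, D (u n)) -> (forall n, D (v n)) ->
  form_cauchy u -> form_cauchy v -> form_cauchy (fun n x => u n x - v n x).
Proof.
move=> Du Dv cu cv e e0; have e4 : 0 < e / 4 by rewrite divr_gt0.
have [N uN] := cu _ e4; have [M vM] := cv _ e4.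
exists (maxn N M) => m n; rewrite !geq_max => /andP[Nm Mm] /andP[Nn Mn].
have -> : (fun x => u m x - v m x - (u n x - v n x)) =
  (fun x => (u m x - u n x) - (v m x - v n x)) by apply/funext => x; ring.
apply: (le_lt_trans (form_parallelogram _ _)); [exact: form_domB|exact: form_domB|].
by have := uN _ _ Nm Nn; have := vM _ _ Mm Mn; lra.
Qed.

Lemma form_cauchy_bounded u : (forall n, D (u n)) -> form_cauchy u ->
  exists2 M : R, 0 < M & exists N, forall n, (N <= n)%N -> B (u n) (u n) <= M.
Proof.
move=> Du cu; have [N uN] := cu 1 ltr01.
exists (2 * B (u N) (u N) + 2 + 2 * B (u N) (u N)); first by have := B_ge0 (Du N); lra.
exists N => n Nn; have := uN _ _ (leqnn N) Nn.
have := form_parallelogram (Du N) (form_domB (Du N) (Du n)).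
have -> : (fun x => u N x - (u N x - u n x)) = u n by apply/funext => x; ring.
by have := B_ge0 (Du N); lra.
Qed.

(** For a closable form, two approximating sequences of the same pair of functions
    give the same limit values; this makes the choice in [form_closure] harmless. *)
Section closable.
Variable (norm : (T -> R) -> R).
Hypothesis closable : forall w, (forall n, D (w n)) -> norm (w n) @[n --> \oo] --> (0 : R) ->
  form_cauchy w -> B (w n) (w n) @[n --> \oo] --> (0 : R).

Let cross_cvg0 u v : (forall n, D (u n)) -> (forall n, D (v n)) ->
  B (u n) (u n) @[n --> \oo] --> (0 : R) -> form_cauchy v ->
  B (u n) (v n) @[n --> \oo] --> (0 : R).
Proof.
move=> Du Dv u0 cv; have [M M0 [N vM]] := form_cauchy_bounded Dv cv.
apply/cvgrPdist_le => e e0.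
have e2 : 0 < e ^+ 2 / M by rewrite divr_gt0// exprn_gt0.
have /cvgrPdist_le/(_ _ e2) u0' := u0.
near=> n.
rewrite sub0r normrN -(@ler_pXn2r _ 2) ?nnegrE ?(ltW e0)// real_normK ?num_real//.
have Nn : (N <= n)%N by near: n; exact: nbhs_infty_ge.
apply: (le_trans (form_cauchy_schwarz (Du n) (Dv n))).
have un : B (u n) (u n) <= e ^+ 2 / M.
  by apply: le_trans (ler_norm _) _; rewrite -normrN -sub0r; near: n.
apply: (@le_trans _ _ (e ^+ 2 / M * M)); last by rewrite divfK// gt_eqF.
by apply: ler_pM => //; [exact: B_ge0|exact: B_ge0|exact: vM].
Unshelve. all: by end_near. Qed.

Lemma form_limit_unique u v u' v' (c c' : R) :
  (forall n, D (u n)) -> (forall n, D (v n)) -> (forall n, D (u' n)) -> (forall n, D (v' n)) ->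
  form_cauchy u -> form_cauchy v -> form_cauchy u' -> form_cauchy v' ->
  norm (fun x => u n x - u' n x) @[n --> \oo] --> (0 : R) ->
  norm (fun x => v n x - v' n x) @[n --> \oo] --> (0 : R) ->
  B (u n) (v n) @[n --> \oo] --> c -> B (u' n) (v' n) @[n --> \oo] --> c' -> c = c'.
Proof.
move=> Du Dv Du' Dv' cu cv cu' cv' uu vv uc uc'.
have DU n : D (fun x => u n x - u' n x) by exact: form_domB.
have DV n : D (fun x => v n x - v' n x) by exact: form_domB.
have h1 := cross_cvg0 DU Dv (closable DU uu (form_cauchyB Du Du' cu cu')) cv.
have h2 := cross_cvg0 DV Du' (closable DV vv (form_cauchyB Dv Dv' cv cv')) cu'.
apply/eqP; rewrite -subr_eq0; apply/eqP.
have h3 : (fun n => B (u n) (v n) - B (u' n) (v' n)) @ \oo --> c - c' by exact: cvgB.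
have h4 : (fun n => B (fun x => u n x - u' n x) (v n) + B (fun x => v n x - v' n x) (u' n)) @ \oo --> (0 : R).
  by rewrite -[X in _ --> X]addr0; exact: cvgD.
rewrite -(cvg_lim _ h3)// -[RHS](cvg_lim _ h4)//; congr (limn _); apply/funext => n.
by rewrite !formBl// (BC (Dv n) (Du' n)) (BC (Dv' n) (Du' n)); ring.
Qed.

End closable.

End semidefinite_form.

Lemma cvg_inner2 {R : realType} d (T : measurableType d) (mu : {measure set T -> \bar R})
    (u v : nat -> T -> R) f g :
  (forall n, L2 mu (u n)) -> (forall n, L2 mu (v n)) -> L2 mu f -> L2 mu g ->
  L2norm mu (fun x => u n x - f x) @[n --> \oo] --> (0 : R) ->
  L2norm mu (fun x => v n x - g x) @[n --> \oo] --> (0 : R) ->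
  inner mu (u n) (v n) @[n --> \oo] --> inner mu f g.
Proof.
move=> u2 v2 f2 g2 uf vg.
have ufg := cvg_inner u2 f2 g2 uf.
have fvg := cvg_inner v2 g2 f2 vg.
have h : inner mu (fun x => u n x - f x) (fun x => v n x - g x) @[n --> \oo] --> (0 : R).
  apply/norm_cvg0P; apply: (squeeze_cvgr (f := fun=> 0)
    (h := fun n => L2norm mu (fun x => u n x - f x) * L2norm mu (fun x => v n x - g x))).
  - by near=> n; rewrite normr_ge0 cauchy_schwarz//; exact: L2B.
  - exact: cvg_cst.
  - by rewrite -[X in _ --> X](mulr0 0); exact: cvgM.
rewrite (_ : (fun n => _) = fun n => inner mu (fun x => u n x - f x) (fun x => v n x - g x)
    + inner mu (u n) g + inner mu (v n) f - inner mu f g).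
  rewrite [X in _ --> X](_ : inner mu f g = 0 + inner mu f g + inner mu g f - inner mu f g); last first.
    by rewrite (innerC _ g f); ring.
  by apply: cvgB; [apply: cvgD => //; exact: cvgD|exact: cvg_cst].
apply/funext => n; rewrite innerBl ?innerBr//; last exact: L2B.
by rewrite (innerC _ (v n) f); ring.
Unshelve. all: by end_near. Qed.

Lemma cvg_ord_sum0 {R : realType} (a : nat -> nat -> R) K :
  (forall k, a k n @[n --> \oo] --> (0 : R)) -> \sum_(k < K) a k n @[n --> \oo] --> (0 : R).
Proof.
move=> a0; elim: K => [|K IH].
  by rewrite (_ : (fun n => _) = fun=> 0); [exact: cvg_cst|apply/funext => n; rewrite big_ord0].
rewrite (_ : (fun n => _) = fun n => \sum_(k < K) a k n + a K n).
  by rewrite -[X in _ --> X]addr0; exact: cvgD.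
by apply/funext => n; rewrite big_ord_recr.
Qed.

Lemma L2_sqr_lty {R : realType} d (T : measurableType d) (mu : {measure set T -> \bar R})
  (f : T -> R) : L2 mu f -> (\int[mu]_p (f p ^+ 2)%:E < +oo)%E.
Proof.
by move=> f2; have := integrable_fin_num measurableT (L2_sqr_integrable f2); rewrite ltey_eq => ->.
Qed.

(** A form in coordinates: W is a linear isometry which decomposes functions into
    components on the intervals ]0, L k[, with the right inverse S. On its domain
    the form is a finite sum of Dirichlet energies, the number of terms depending
    on one of the two arguments only, and every finite family of functions of
    H^1_0(]0, L k[) comes from the domain. *)
Section diagonal_form.
Context {R : realType} {d : measure_display} {T : measurableType d}.
Variable mu : {measure set T -> \bar R}.
Variable E : bform R T.
Variable L : nat -> R.
Variable W : (T -> R) -> nat -> R -> R.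
Variable S : (nat -> R -> R) -> T -> R.
Local Notation D := (fdom E).
Local Notation B := (fval E).
Hypothesis L0 : forall k, 0 < L k.
Hypothesis W_lin : forall b c f g k x,
  W (fun p => b * f p + c * g p) k x = b * W f k x + c * W g k x.
Hypothesis W_meas : forall f k, measurable_fun setT f -> measurable_fun setT (W f k).
Hypothesis W_parseval : forall f : T -> R, measurable_fun setT f ->
  (\int[mu]_p (f p ^+ 2)%:E = \sum_(0 <= k <oo) \int[leb (L k)]_x ((W f k x) ^+ 2)%:E)%E.
Hypothesis S_meas : forall c, (forall k, measurable_fun setT (c k)) -> measurable_fun setT (S c).
Hypothesis W_S : forall c k x, 0 < x < L k -> W (S c) k x = c k x.
Hypothesis E_lin : forall b c f g, D f -> D g -> D (fun x => b * f x + c * g x).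
Hypothesis E_L2 : forall f, D f -> L2 mu f.
Hypothesis E_h10 : forall f, D f -> exists v, forall k, h10 (L k) (W f k) (v k).
Hypothesis E_val : forall f, D f -> exists N0, forall g v w, D g ->
  (forall k, h10 (L k) (W f k) (v k)) -> (forall k, h10 (L k) (W g k) (w k)) ->
  forall N, (N0 <= N)%N -> B f g = \sum_(k < N) inner (leb (L k)) (v k) (w k).
Hypothesis E_S : forall N c v, (forall k, h10 (L k) (c k) (v k)) ->
  (forall k, (N <= k)%N -> c k = fun=> 0) ->
  D (S c) /\ forall k, h10 (L k) (W (S c) k) (v k).

Local Notation nrm k := (L2norm (leb (L k))).

Let h10_L2 k f v : h10 (L k) f v -> L2 (leb (L k)) v.
Proof. by case=> -[]. Qed.

(** The derivatives of the components; they are unique up to null sets, so that the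
    choice made by [get] is harmless. *)
Definition der f : nat -> R -> R := get [set v | forall k, h10 (L k) (W f k) (v k)].

Lemma der_h10 f k : D f -> h10 (L k) (W f k) (der f k).
Proof.
by move=> /E_h10[v hv]; have := @getPex _ [set v | forall k, h10 (L k) (W f k) (v k)]
  (ex_intro _ v hv); exact.
Qed.

Lemma der_L2 f k : D f -> L2 (leb (L k)) (der f k).
Proof. by move=> /der_h10-/(_ k)/h10_L2. Qed.

Lemma h10_W_lin b c f g k : D f -> D g -> h10 (L k) (W (fun p => b * f p + c * g p) k)
  (fun x => b * der f k x + c * der g k x).
Proof.
move=> Df Dg; rewrite (_ : W _ k = fun x => b * W f k x + c * W g k x); last first.
  by apply/funext => x; rewrite W_lin.
by apply: h10D; apply: h10Z; exact: der_h10.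
Qed.

Lemma diag_val f : D f -> exists N0, forall g, D g -> forall N, (N0 <= N)%N ->
  B f g = \sum_(k < N) inner (leb (L k)) (der f k) (der g k).
Proof.
move=> Df; have [N0 h] := E_val Df; exists N0 => g Dg N NN.
by apply: h => // k; exact: der_h10.
Qed.

Lemma diag_lin b c f g h : D f -> D g -> D h ->
  B (fun x => b * f x + c * g x) h = b * B f h + c * B g h.
Proof.
move=> Df Dg Dh; have [Nf hf] := diag_val Df; have [Ng hg] := diag_val Dg.
have [N hN] := E_val (E_lin b c Df Dg).
pose M := (Nf + Ng + N)%N.
rewrite (hf h Dh M) ?(hg h Dh M) /M; [|lia|lia].
rewrite (hN h _ _ Dh (fun k => h10_W_lin b c k Df Dg) (fun k => der_h10 k Dh) M); last by rewrite /M; lia.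
rewrite !mulr_sumr -big_split/=; apply: eq_bigr => k _.
by rewrite innerDl ?innerZl//; try apply: L2Z; exact: der_L2.
Qed.

Lemma diag_sym f g : D f -> D g -> B f g = B g f.
Proof.
move=> Df Dg; have [Nf hf] := diag_val Df; have [Ng hg] := diag_val Dg.
rewrite (hf g Dg (Nf + Ng)%N) ?(hg f Df (Nf + Ng)%N) ?leq_addr ?leq_addl//.
by apply: eq_bigr => k _; rewrite innerC.
Qed.

Lemma diag_sqr f : D f -> exists N0, forall N, (N0 <= N)%N ->
  B f f = \sum_(k < N) nrm k (der f k) ^+ 2.
Proof.
move=> Df; have [N0 h] := diag_val Df; exists N0 => N NN.
by rewrite (h f Df N NN); apply: eq_bigr => k _; rewrite inner_sqr.
Qed.

Lemma diag_ge0 f : D f -> 0 <= B f f.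
Proof.
by move=> /diag_sqr[N /(_ N (leqnn N)) ->]; apply: sumr_ge0 => k _; rewrite sqr_ge0.
Qed.

Lemma diag_component f v k : D f -> h10 (L k) (W f k) v -> nrm k v ^+ 2 <= B f f.
Proof.
move=> Df hv; have [N0 h] := E_val Df.
pose v' j := if j == k then v else der f j.
have hv' j : h10 (L j) (W f j) (v' j).
  by rewrite /v'; case: eqP => [->|_] //; exact: der_h10.
rewrite (h f v' v' Df hv' hv' (N0 + k.+1)%N (leq_addr _ _)).
have kN : (k < N0 + k.+1)%N by rewrite addnS ltnS leq_addl.
rewrite (bigD1 (Ordinal kN))//= /v' eqxx inner_sqr lerDl.
by apply: sumr_ge0 => j _; rewrite inner_sqr sqr_ge0.
Qed.

Lemma W_norm_series (f : T -> R) : measurable_fun setT f ->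
  (\int[mu]_p (f p ^+ 2)%:E < +oo)%E ->
  (forall k, L2 (leb (L k)) (W f k)) /\
  \sum_(k < n) nrm k (W f k) ^+ 2 @[n --> \oo] --> L2norm mu f ^+ 2.
Proof.
move=> mf flty; have f2 := L2P mf flty.
have W2 k : L2 (leb (L k)) (W f k).
  apply: L2P; first exact: W_meas.
  apply: le_lt_trans flty; rewrite W_parseval//.
  rewrite (nneseries_split 0 k.+1); last first.
    by move=> j _; apply: integral_ge0 => x _; rewrite lee_fin sqr_ge0.
  rewrite add0n big_nat_recr//= -addeA addeCA leeDl// adde_ge0//.
    by apply: sume_ge0 => j _; apply: integral_ge0 => x _; rewrite lee_fin sqr_ge0.
  by apply: nneseries_ge0 => j _ _; apply: integral_ge0 => x _; rewrite lee_fin sqr_ge0.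
have sqE k : (\int[leb (L k)]_x ((W f k x) ^+ 2)%:E = (nrm k (W f k) ^+ 2)%:E)%E.
  by rewrite L2norm_sqr /Rintegral fineK//; apply: integrable_fin_num => //; exact: L2_sqr_integrable.
have fE : (\int[mu]_p (f p ^+ 2)%:E = (L2norm mu f ^+ 2)%:E)%E.
  by rewrite L2norm_sqr /Rintegral fineK//; apply: integrable_fin_num => //; exact: L2_sqr_integrable.
split=> //; move: fE; rewrite W_parseval// => fE.
have : cvgn (fun n => \sum_(0 <= k < n) (nrm k (W f k) ^+ 2)%:E)%E.
  by apply: is_cvg_nneseries => k _ _; rewrite lee_fin sqr_ge0.
move=> h; have {}h : (fun n => \sum_(0 <= k < n) (nrm k (W f k) ^+ 2)%:E)%E @ \oo -->
    (L2norm mu f ^+ 2)%:E.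
  by rewrite -fE (eq_eseriesr (fun k _ => sqE k)).
move/fine_cvgP : h => [_]; apply: cvg_trans; apply: near_eq_cvg; near=> n.
by rewrite /= sumEFin big_mkord.
Unshelve. all: by end_near. Qed.

Lemma W_L2 f k : L2 mu f -> L2 (leb (L k)) (W f k).
Proof. by move=> f2; have [] := W_norm_series (L2_measurable f2) (L2_sqr_lty f2). Qed.

Lemma W_norm f : L2 mu f -> \sum_(k < n) nrm k (W f k) ^+ 2 @[n --> \oo] --> L2norm mu f ^+ 2.
Proof. by move=> f2; have [] := W_norm_series (L2_measurable f2) (L2_sqr_lty f2). Qed.

Lemma W_norm_le f n : L2 mu f -> \sum_(k < n) nrm k (W f k) ^+ 2 <= L2norm mu f ^+ 2.
Proof.
move=> f2; have h := W_norm f2; rewrite -(cvg_lim _ h)//.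
apply: (@nondecreasing_cvgn_le _ (fun n => \sum_(k < n) nrm k (W f k) ^+ 2)); last by apply/cvg_ex; eexists; exact: h.
apply/nondecreasing_seqP => i; rewrite big_ord_recr/= lerDl sqr_ge0//.
Qed.

Lemma W_component_le f k : L2 mu f -> nrm k (W f k) <= L2norm mu f.
Proof.
move=> f2; rewrite -(@ler_pXn2r _ 2) ?nnegrE ?L2norm_ge0//.
apply: le_trans (W_norm_le k.+1 f2); rewrite big_ord_recr/= lerDr.
by apply: sumr_ge0 => j _; rewrite sqr_ge0.
Qed.

(** Polarization of [W_norm]. *)
Lemma W_inner f g : L2 mu f -> L2 mu g ->
  \sum_(k < n) inner (leb (L k)) (W f k) (W g k) @[n --> \oo] --> inner mu f g.
Proof.
move=> f2 g2.
have polar d' (T' : measurableType d') (m : {measure set T' -> \bar R}) (p q : T' -> R) :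
    L2 m p -> L2 m q -> inner m p q =
    2^-1 * (L2norm m (fun x => 1 * p x + 1 * q x) ^+ 2 - L2norm m p ^+ 2 - L2norm m q ^+ 2).
  move=> p2 q2; rewrite -!inner_sqr; have p1 := L2Z 1 p2; have q1 := L2Z 1 q2.
  rewrite innerDl ?innerDr ?innerZl ?innerZr//; try exact: L2D.
  by rewrite (innerC m q p); field.
rewrite polar//; have fg2 : L2 mu (fun x => 1 * f x + 1 * g x) by apply: L2D; exact: L2Z.
rewrite (_ : (fun n => _) = fun n => 2^-1 * (\sum_(k < n) nrm k (W (fun x => 1 * f x + 1 * g x) k) ^+ 2
   - \sum_(k < n) nrm k (W f k) ^+ 2 - \sum_(k < n) nrm k (W g k) ^+ 2)).
  by apply: cvgMr; apply: cvgB; [apply: cvgB|]; exact: W_norm.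
apply/funext => n; rewrite -!sumrB mulr_sumr; apply: eq_bigr => k _.
rewrite polar; [|exact: W_L2|exact: W_L2].
by rewrite (_ : W (fun x => 1 * f x + 1 * g x) k = fun x => 1 * W f k x + 1 * W g k x)//;
  apply/funext => x; rewrite W_lin.
Qed.

(** The components of a form-Cauchy sequence tending to 0 have derivatives tending
    to 0, and only finitely many of them enter the pairing with a fixed function. *)
Lemma diag_closable w : (forall n, D (w n)) ->
  L2norm mu (w n) @[n --> \oo] --> (0 : R) -> form_cauchy E w ->
  B (w n) (w n) @[n --> \oo] --> (0 : R).
Proof.
move=> Dw w0 wC.
(* each component is a sequence to which [h10_closable] applies *)
have comp k : nrm k (der (w n) k) @[n --> \oo] --> (0 : R).
  apply: (h10_closable (L0 k) (f := fun n => W (w n) k)) => [n||e e0].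
  - exact: der_h10.
  - apply: (squeeze_cvgr (f := fun=> 0) (h := fun n => L2norm mu (w n))) => //; last exact: cvg_cst.
    by near=> n; rewrite L2norm_ge0 W_component_le//; exact: E_L2.
  have [N NP] := wC (e ^+ 2) (exprn_gt0 2 e0); exists N => m n Nm Nn.
  rewrite -(@ler_pXn2r _ 2) ?nnegrE ?L2norm_ge0 ?(ltW e0)//.
  apply: le_trans (ltW (NP _ _ Nm Nn)); apply: diag_component.
    exact: (form_domB E_lin).
  rewrite (_ : W _ k = fun x => W (w m) k x - W (w n) k x); first by apply: h10B; exact: der_h10.
  rewrite (_ : (fun x => w m x - w n x) = fun x => 1 * w m x + (-1) * w n x).
    by apply/funext => x; rewrite W_lin mul1r mulN1r.
  by apply/funext => x; rewrite mul1r mulN1r.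
(* B (w n) (w n) is the limit in m of B (w n) (w n - w m), since B (w n) (w m) is a
   sum of finitely many terms that tend to 0; Cauchy-Schwarz bounds it *)
have small e : 0 < e -> exists N, forall n, (N <= n)%N -> B (w n) (w n) <= e.
  move=> e0; have [N NP] := wC e e0; exists N => n Nn.
  have [K KP] := diag_val (Dw n).
  have c0 : B (w n) (w m) @[m --> \oo] --> (0 : R).
    rewrite (_ : (fun m => _) = fun m => \sum_(k < K) inner (leb (L k)) (der (w n) k) (der (w m) k)).
      apply: (@cvg_ord_sum0 R (fun k m => inner (leb (L k)) (der (w n) k) (der (w m) k))) => k.
        apply/norm_cvg0P; apply: (squeeze_cvgr (f := fun=> 0)
            (h := fun m => nrm k (der (w n) k) * nrm k (der (w m) k))).
        - by near=> m; rewrite normr_ge0 cauchy_schwarz//; exact: der_L2.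
        - exact: cvg_cst.
        - by rewrite -[X in _ --> X](mulr0 (nrm k (der (w n) k))); apply: cvgMr; exact: comp.
    by apply/funext => m; exact: KP.
  have bnd m : (N <= m)%N -> B (w n) (w n) - B (w n) (w m) <= Num.sqrt (B (w n) (w n) * e).
    move=> Nm; rewrite -(formBr E_lin diag_lin diag_sym)//.
    apply: le_trans (ler_norm _) _; rewrite -sqrtr_sqr; apply: ler_wsqrtr.
    apply: (le_trans (form_cauchy_schwarz E_lin diag_lin diag_sym diag_ge0 (Dw n) (form_domB E_lin (Dw n) (Dw m)))).
    by apply: ler_wpM2l; [exact: diag_ge0|apply: ltW; exact: NP].
  have {}bnd : B (w n) (w n) <= Num.sqrt (B (w n) (w n) * e).
    rewrite -[leLHS]subr0; apply: (@cvgr_to_le _ \oo _ _ (fun m => B (w n) (w n) - B (w n) (w m))).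
      by apply: cvgB => //; exact: cvg_cst.
    by near=> m; apply: bnd; near: m; exact: nbhs_infty_ge.
  have [->|b0] := eqVneq (B (w n) (w n)) 0; first exact: ltW.
  have b1 : 0 < B (w n) (w n) by rewrite lt_def b0 diag_ge0.
  rewrite -(ler_pM2l b1) -expr2 -(@ler_sqrt _ (_ ^+ 2)) ?mulr_ge0 ?(ltW b1) ?(ltW e0)//.
  by rewrite sqrtr_sqr ger0_norm// ltW.
apply/cvgrPdist_le => e e0; have [N NP] := small e e0; near=> n.
rewrite sub0r normrN ger0_norm ?diag_ge0//; apply: NP; near: n; exact: nbhs_infty_ge.
Unshelve. all: by end_near. Qed.

Lemma form_cauchyP (u : nat -> T -> R) : form_cauchy E u <->
  (forall e : R, 0 < e -> \forall m & n \near \oo,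
     B (fun x => u m x - u n x) (fun x => u m x - u n x) < e).
Proof.
split=> [uC e e0|h e e0].
  have [N NP] := uC e e0; exists ([set n | (N <= n)%N], [set n | (N <= n)%N]).
    by split; exact: nbhs_infty_ge.
  by move=> [m n] [/= Nm Nn]; exact: NP.
have [[P Q] [[N _ NP] [M _ MQ]] PQ] := h e e0; exists (maxn N M) => m n.
rewrite !geq_max => /andP[Nm Mm] /andP[Nn Mn].
by apply: (PQ (m, n)); split; [exact: NP|exact: MQ].
Qed.

Lemma approximatesP u f : approximates mu E u f <->
  [/\ forall n, D (u n), L2norm mu (fun x => u n x - f x) @[n --> \oo] --> (0 : R) &
      form_cauchy E u].
Proof. by split=> -[Du uf /form_cauchyP uC]. Qed.

(** By [form_limit_unique], the choice in [form_closure] does not matter. *)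
Lemma closure_val f h u v (c : R) : L2 mu f -> L2 mu h ->
  approximates mu E u f -> approximates mu E v h ->
  B (u n) (v n) @[n --> \oo] --> c -> fval (form_closure mu E) f h = c.
Proof.
move=> f2 h2 uf vh uvc; rewrite /form_closure /=.
set A := [set _ | _]; have Ac : A c by exists u, v.
have Ag : A (get A) by apply: getI Ac.
move: Ag => [u' [v' [u'f v'h u'v']]].
move: uf vh u'f v'h => /approximatesP[Du uf uC] /approximatesP[Dv vh vC]
  /approximatesP[Du' uf' uC'] /approximatesP[Dv' vh' vC'].
have diff (a b : nat -> T -> R) g : L2 mu g -> (forall n, D (a n)) -> (forall n, D (b n)) ->
    L2norm mu (fun x => a n x - g x) @[n --> \oo] --> (0 : R) ->
    L2norm mu (fun x => b n x - g x) @[n --> \oo] --> (0 : R) ->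
    L2norm mu (fun x => a n x - b n x) @[n --> \oo] --> (0 : R).
  move=> g2 Da Db ag bg; apply: (squeeze_cvgr (f := fun=> 0)
    (h := fun n => L2norm mu (fun x => a n x - g x) + L2norm mu (fun x => b n x - g x))).
  - near=> n; rewrite L2norm_ge0/= (L2normBC mu (b n)).
    by apply: L2normB_triangle => //; exact: E_L2.
  - exact: cvg_cst.
  - by rewrite -[X in _ --> X]addr0; exact: cvgD.
by apply: (form_limit_unique E_lin diag_lin diag_sym diag_ge0 diag_closable Du' Dv' Du Dv) u'v' uvc => //;
  [exact: (diff _ _ f)|exact: (diff _ _ h)].
Unshelve. all: by end_near. Qed.

Lemma approximates_cst f : D f -> approximates mu E (fun=> f) f.
Proof.
move=> Df; have z : (fun x => f x - f x) = cst 0 by apply/funext => x; rewrite subrr.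
apply/approximatesP; split=> // [|e e0].
  by rewrite z L2norm0; exact: cvg_cst.
exists 0%N => m n _ _; have Dz := form_domB E_lin Df Df.
by rewrite (formBl diag_lin)// subrr.
Qed.

(** Truncation to the first n components, since only finite families are known to
    come from the domain of the form. *)
Definition chop (c : nat -> R -> R) n : nat -> R -> R := fun k => if (k < n)%N then c k else fun=> 0.

Let chop_h10 c v n k : h10 (L k) (c k) (v k) -> h10 (L k) (chop c n k) (chop v n k).
Proof.
rewrite /chop; case: ifP => // _ _; split=> //; split=> //; first exact: L2_0.
by move=> x _; rewrite /prim /cut/=; under eq_Rintegral do rewrite mul0r; rewrite Rintegral_cst// mul0r addr0.
Qed.

Lemma chop_core c v n : (forall k, h10 (L k) (c k) (v k)) ->
  D (S (chop c n)) /\ forall k, h10 (L k) (W (S (chop c n)) k) (chop v n k).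
Proof.
move=> cv; apply: (@E_S n) => [k|k nk]; first exact: chop_h10.
by rewrite /chop ltnNge nk.
Qed.

Lemma pair_chop f c v g n : D f -> (forall k, solves (L k) (c k) (v k) (g k)) ->
  B (S (chop c n)) f = \sum_(k < n) inner (leb (L k)) (g k) (W f k).
Proof.
move=> Df cv; have [Dc hc] := chop_core n (fun k => (cv k).1).
have [N NP] := E_val Dc.
rewrite (NP f (chop v n) (der f) Df hc (fun k => der_h10 k Df) (N + n)%N (leq_addr _ _)).
rewrite addnC big_split_ord/= [X in _ + X]big1 ?addr0; last first.
  move=> k _; rewrite /chop ltnNge leq_addr/= /inner.
  by under eq_Rintegral do rewrite mul0r; rewrite Rintegral_cst// mul0r.
apply: eq_bigr => k _; rewrite /chop /= ltn_ord innerC.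
by rewrite (solves_energy (L0 k) (der_h10 k Df) (cv k)) innerC.
Qed.

Let solves0 k : solves (L k) (fun=> 0) (fun=> 0) (fun=> 0).
Proof.
have z (w : R -> R) : (fun x => 0 * w x) = (fun=> 0) by apply/funext => x; rewrite mul0r.
have [p [q pq]] := dirichlet_solvable (L0 k) (L2_0 (leb (L k))).
by have := solvesZ 0 pq; rewrite !z.
Qed.

Lemma W_S_ae c k : ae_eq (leb (L k)) setT (W (S c) k) (c k).
Proof. by apply: ae_imp (leb_ae_itv (L k)) => x xL _; exact: W_S. Qed.

Lemma S_chop_L2 c n : (forall k, L2 (leb (L k)) (c k)) -> L2 mu (S (chop c n)).
Proof.
move=> c2; have mc k : measurable_fun setT (chop c n k).
  by rewrite /chop; case: ifP => // _; exact: L2_measurable (c2 k).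
have mS := S_meas mc; apply: L2P => //.
rewrite W_parseval// (nneseries_split 0 n); last first.
  by move=> j _; apply: integral_ge0 => x _; rewrite lee_fin sqr_ge0.
have WE k : (\int[leb (L k)]_x (W (S (chop c n)) k x ^+ 2)%:E =
    \int[leb (L k)]_x (chop c n k x ^+ 2)%:E)%E.
  apply: ae_eq_integral => //.
  - by apply/measurable_EFinP/measurable_funX; exact: W_meas.
  - by apply/measurable_EFinP/measurable_funX; exact: mc.
  by apply: ae_imp (@W_S_ae (chop c n) k) => x /(_ I) /= ->.
rewrite add0n eseries0 ?adde0; last first.
  move=> j nj _; rewrite WE /chop ltnNge nj/=.
  by under eq_integral do rewrite expr0n/=; rewrite integral0.
apply/lte_sum_pinfty => k _; rewrite WE /chop; case: ifP => _.
  exact: (L2_sqr_lty (c2 k)).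
by under eq_integral do rewrite expr0n/=; rewrite integral0.
Qed.

Lemma inner_W_S h c k : L2 (leb (L k)) h -> (forall j, L2 (leb (L j)) (c j)) ->
  inner (leb (L k)) h (W (S c) k) = inner (leb (L k)) h (c k).
Proof.
move=> h2 c2; apply: ae_eq_inner; [exact: L2_measurable h2| |exact: L2_measurable h2|
  exact: L2_measurable (c2 k)|exact: aeW|exact: W_S_ae].
by apply: W_meas; apply: S_meas => j; exact: L2_measurable (c2 j).
Qed.

Lemma inner_chop g c n : L2 mu g -> (forall k, L2 (leb (L k)) (c k)) ->
  inner mu g (S (chop c n)) = \sum_(k < n) inner (leb (L k)) (W g k) (c k).
Proof.
move=> g2 c2; have S2 := S_chop_L2 n c2.
have WE k : inner (leb (L k)) (W g k) (W (S (chop c n)) k) =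
    if (k < n)%N then inner (leb (L k)) (W g k) (c k) else 0.
  have mc : measurable_fun setT (chop c n k).
    by rewrite /chop; case: ifP => // _; exact: L2_measurable (c2 k).
  rewrite (@ae_eq_inner _ _ _ (leb (L k)) _ (W g k) _ (chop c n k))//.
  - rewrite /chop; case: ifP => // _; rewrite /inner.
    by under eq_Rintegral do rewrite mulr0; rewrite Rintegral_cst// mul0r.
  - exact: L2_measurable (W_L2 k g2).
  - exact: L2_measurable (W_L2 k S2).
  - exact: L2_measurable (W_L2 k g2).
  - by apply: aeW.
  - exact: W_S_ae.
rewrite -(cvg_lim _ (W_inner g2 S2))//; apply/cvg_lim => //.
apply: cvg_near_cst; near=> N.
have nN : (n <= N)%N by near: N; exact: nbhs_infty_ge.
rewrite -(subnKC nN) big_split_ord/= [X in _ + X]big1 ?addr0; last first.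
  by move=> k _; rewrite WE ltnNge leq_addr.
by apply: eq_bigr => k _; rewrite WE ltn_ord.
Unshelve. all: by end_near. Qed.

Lemma chop_cvg (h : T -> R) (b : nat -> R -> R) : L2 mu h ->
  (forall k, L2 (leb (L k)) (b k)) ->
  (forall k, ae_eq (leb (L k)) setT (W h k) (b k)) ->
  L2norm mu (fun x => S (chop b n) x - h x) @[n --> \oo] --> (0 : R).
Proof.
move=> h2 b2 hb; pose A n := \sum_(k < n) nrm k (W h k) ^+ 2.
have S2 n := S_chop_L2 n b2.
have bb k : inner (leb (L k)) (b k) (b k) = nrm k (W h k) ^+ 2.
  rewrite -inner_sqr; apply: ae_eq_inner; [exact: L2_measurable (b2 k)|exact: L2_measurable (b2 k)|
    exact: L2_measurable (W_L2 k h2)|exact: L2_measurable (W_L2 k h2)|exact: ae_eq_sym (hb k)|exact: ae_eq_sym (hb k)].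
have sq n : L2norm mu (fun x => S (chop b n) x - h x) ^+ 2 = L2norm mu h ^+ 2 - A n.
  rewrite -!inner_sqr innerBl// ?innerBr//; try exact: L2B.
  rewrite (innerC mu (S _) h) !inner_chop//.
  have -> : \sum_(k < n) inner (leb (L k)) (W (S (chop b n)) k) (b k) = A n.
    apply: eq_bigr => k _; rewrite innerC inner_W_S// ?bb//.
      by rewrite /chop ltn_ord bb.
    by move=> j; rewrite /chop; case: ifP => // _; exact: L2_0.
  have -> : \sum_(k < n) inner (leb (L k)) (W h k) (b k) = A n.
    apply: eq_bigr => k _; rewrite -bb; apply: ae_eq_inner; [exact: L2_measurable (W_L2 k h2)|exact: L2_measurable (b2 k)|
    exact: L2_measurable (b2 k)|exact: L2_measurable (b2 k)|exact: hb|exact: aeW].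
  by rewrite inner_sqr; ring.
rewrite (_ : (fun n => _) = fun n => Num.sqrt (L2norm mu h ^+ 2 - A n)); last first.
  by apply/funext => n; rewrite -sq sqrtr_sqr ger0_norm// L2norm_ge0.
rewrite -[X in _ --> X](@sqrtr0 R) -(subrr (L2norm mu h ^+ 2)).
apply: (@continuous_cvg _ _ _ _ _ (fun n => L2norm mu h ^+ 2 - A n) Num.sqrt); first exact: sqrt_continuous.
by apply: cvgB; [exact: cvg_cst|exact: W_norm].
Qed.

(** Let f be in the domain of the operator with image g. The component W f k is
    compared with the solution p of the Dirichlet problem for W g k: let psi be
    their difference, and test against an h whose only component solves the
    Dirichlet problem for psi; this gives |psi|^2 = 0. Conversely, the truncations
    of the solutions are a Cauchy sequence for the form, because their energies are
    the partial sums of the pairing of g with f, and they converge to f. *)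
Lemma diagonal_graph f g : op_graph (form_operator mu (form_closure mu E)) f g <->
  [/\ L2 mu f, L2 mu g & forall k, op_graph (dirichlet_laplacian (L k)) (W f k) (W g k)].
Proof.
split=> [[[f2 [u uf]] g2 fgh]|[f2 g2 fg]].
  split=> // k; apply/(dirichlet_graphP (L0 k)); split; [exact: W_L2|exact: W_L2|].
  have [p [q pq]] := dirichlet_solvable (L0 k) (W_L2 k g2).
  exists p, q; split=> //.
  have p2 : L2 (leb (L k)) p by case: pq => [[pq' _ _] _]; exact: ac_L2 pq'.
  pose psi x := W f k x - p x.
  have psi2 : L2 (leb (L k)) psi by apply: L2B => //; exact: W_L2.
  have [p' [q' pq']] := dirichlet_solvable (L0 k) psi2.
  pose c j := if j == k then p' else fun=> 0.
  pose v j := if j == k then q' else fun=> 0.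
  pose gg j := if j == k then psi else fun=> 0.
  have cv j : solves (L j) (c j) (v j) (gg j).
    by rewrite /c /v /gg; case: eqP => [->//|_]; exact: solves0.
  pose h := S (chop c k.+1).
  have [Dh hW] := chop_core k.+1 (fun j => (cv j).1).
  have h2 := E_L2 Dh.
  have Bh w : D w -> B w h = inner (leb (L k)) (W w k) psi.
    move=> Dw; rewrite diag_sym// (pair_chop _ Dw cv) big_ord_recr/= big1 ?add0r; last first.
      move=> j _; rewrite /gg ltn_eqF// /inner.
      by under eq_Rintegral do rewrite mul0r; rewrite Rintegral_cst// mul0r.
    by rewrite /gg eqxx innerC.
  have val : fval (form_closure mu E) f h = inner (leb (L k)) (W f k) psi.
    apply: (closure_val f2 h2 uf (approximates_cst Dh)).
    have [Du {}uf _] := (approximatesP u f).1 uf.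
    rewrite (_ : (fun n => _) = fun n => inner (leb (L k)) (W (u n) k) psi); last first.
      by apply/funext => n; exact: Bh.
    apply: cvg_inner => //; [by move=> n; exact/W_L2/E_L2|exact: W_L2|].
    apply: (squeeze_cvgr (f := fun=> 0) (h := fun n => L2norm mu (fun x => u n x - f x))) => //; last exact: cvg_cst.
    near=> n; rewrite L2norm_ge0/=.
    have <- : W (fun x => u n x - f x) k = fun x => W (u n) k x - W f k x.
      rewrite (_ : (fun x => u n x - f x) = fun x => 1 * u n x + (-1) * f x).
        by apply/funext => x; rewrite W_lin mul1r mulN1r.
      by apply/funext => x; rewrite mul1r mulN1r.
    by apply: W_component_le; apply: L2B => //; exact: E_L2.
  have gh : fval (form_closure mu E) f h = inner mu g h.
    by apply: fgh; split => //; exists (fun=> h); exact: approximates_cst.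
  have gW : inner mu g h = inner (leb (L k)) (W g k) p'.
    have c2 j : L2 (leb (L j)) (c j).
      by have [[cj _ _] _] := cv j; exact: ac_L2 cj.
    rewrite inner_chop// big_ord_recr/= big1 ?add0r; last first.
      move=> j _; rewrite /c ltn_eqF// /inner.
      by under eq_Rintegral do rewrite mulr0; rewrite Rintegral_cst// mul0r.
    by rewrite /c eqxx.
  have : inner (leb (L k)) psi psi = 0.
    rewrite {1}/psi innerBl//; last exact: W_L2.
    by rewrite -val gh gW (solves_sym (L0 k) pq pq') subrr.
  rewrite inner_sqr => /eqP; rewrite sqrf_eq0 => /eqP psi0.
  have := L2norm_eq0 psi2 psi0; apply: ae_imp => x /(_ I)/= h0 _.
  by apply/eqP; rewrite -subr_eq0; apply/eqP.
have /choice[c /choice[v cv]] : forall k, exists c v, solves (L k) c v (W g k) /\ ae_eq (leb (L k)) setT (W f k) c.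
  move=> k; have /(dirichlet_graphP (L0 k))[_ _ [p [q pq]]] := fg k.
  by exists p, q.
have sv k := (cv k).1; have fc k := (cv k).2.
have c2 k : L2 (leb (L k)) (c k) by have [[ck _ _] _] := sv k; exact: ac_L2 ck.
pose F n := S (chop c n); have DF n : D (F n) := (chop_core n (fun k => (sv k).1)).1.
have F2 n := E_L2 (DF n).
pose A n := \sum_(k < n) inner (leb (L k)) (W g k) (c k).
have Acv : A n @[n --> \oo] --> inner mu g f.
  rewrite (_ : A = fun n => \sum_(k < n) inner (leb (L k)) (W g k) (W f k)); first exact: W_inner.
  apply/funext => n; apply: eq_bigr => k _.
  by apply: ae_eq_inner; [exact: L2_measurable (W_L2 k g2)|exact: L2_measurable (c2 k)|
    exact: L2_measurable (W_L2 k g2)|exact: L2_measurable (W_L2 k f2)|exact: aeW|exact: ae_eq_sym (fc k)].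
have FF m n : B (F m) (F n) = A (minn m n).
  rewrite (pair_chop m (DF n) sv) -(big_mkord xpredT (fun k => inner (leb (L k)) (W g k) (W (F n) k))).
  have [_ hc] := chop_core n (fun k => (sv k).1).
  rewrite (eq_bigr (fun k => if (k < n)%N then inner (leb (L k)) (W g k) (c k) else 0)); last first.
    move=> k _; rewrite (@inner_W_S (W g k) (chop c n) k) //; last first.
    - by move=> j; rewrite /chop; case: ifP => // _; exact: L2_0.
    - exact: W_L2.
    rewrite /chop; case: ifP => // _; rewrite /inner.
    by under eq_Rintegral do rewrite mulr0; rewrite Rintegral_cst// mul0r.
  rewrite -big_mkcond/= /A -(big_mkord xpredT (fun k => inner (leb (L k)) (W g k) (c k))).
  rewrite [RHS](big_nat_widen _ _ m) ?geq_minl// big_nat_cond [RHS]big_nat_cond.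
  by apply: eq_bigl => k; rewrite ltn_min /=; case: (k < m)%N; case: (k < n)%N.
have FC : form_cauchy E F.
  move=> e e0; have e2 : 0 < e / 2 by rewrite divr_gt0.
  have /cvgrPdist_lt/(_ _ e2)[N _ NP] := Acv; exists N => m n Nm Nn.
  have DB := form_domB E_lin (DF m) (DF n).
  rewrite (formBl diag_lin)// !(formBr E_lin diag_lin diag_sym)// !FF !minnn (minnC n m).
  have := NP _ Nm; have := NP _ Nn; rewrite /= !ltr_norml.
  move=> /andP[h1 h2] /andP[h3 h4].
  by have [mn|nm] := leqP m n; lra.
have uF : approximates mu E F f.
  by apply/approximatesP; split => //; exact: chop_cvg.
split=> [||h [h2 [w wh]]] //; first by split => //; exists F.
apply: (closure_val f2 h2 uF wh).
have [Dw {}wh _] := (approximatesP w h).1 wh.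
have Wg2 k : L2 (leb (L k)) (W g k) by exact: W_L2.
have Ggcv : L2norm mu (fun x => S (chop (W g) n) x - g x) @[n --> \oo] --> (0 : R).
  by apply: chop_cvg => // k; exact: aeW.
rewrite (_ : (fun n => _) = fun n => inner mu (w n) (S (chop (W g) n))); last first.
  apply/funext => n; rewrite (pair_chop n (Dw n) sv) inner_chop//; last exact: E_L2.
  by apply: eq_bigr => k _; rewrite innerC.
rewrite -/(inner mu g h) innerC; apply: cvg_inner2 => // n; [exact: E_L2|exact: S_chop_L2].
Unshelve. all: by end_near. Qed.

End diagonal_form.

(** * The energy at the finite stages *)

Section nested_intervals.
Context {R : realType}.
Variables a l : R.
Hypotheses (a0 : 0 < a) (al : a <= l).
Implicit Types (f v w : R -> R).

Let l0 : 0 < l. Proof. exact: lt_le_trans al. Qed.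

Lemma leb_nestedE (f : R -> \bar R) : measurable_fun setT f ->
  (\int[leb a]_x f x = \int[leb l]_x (f x * (x < a)%R%:R%:E))%E.
Proof.
move=> mf; have mfa : measurable_fun setT (fun x => f x * (x < a)%R%:R%:E)%E.
  apply: emeasurable_funM => //; apply/measurable_EFinP.
  by apply: measurable_bool_natr; exact: measurable_fun_ltr.
rewrite !integral_leb// integral_mkcond [RHS]integral_mkcond; apply: eq_integral => x _.
rewrite /patch !mem_setE !in_itv /=; case: ifPn => [/andP[x0 xa]|xa].
  by rewrite x0 (lt_le_trans xa al)/= xa mule1.
case: ifPn => // /andP[x0 xl]; move: xa; rewrite x0 /= => /negPf ->.
by rewrite mule0.
Qed.

Lemma leb_nested f : measurable_fun setT f ->
  \int[leb a]_x f x = \int[leb l]_x (f x * (x < a)%R%:R).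
Proof. by move=> mf; rewrite /Rintegral leb_nestedE//; exact/measurable_EFinP. Qed.

Let ae_neq_a : \forall t \ae leb l, t <> a.
Proof. by exists [set a]; split; [exact: measurable_set1|exact: leb_set1|move=> t /= /contrapT]. Qed.

Lemma leb_nested_le (f : R -> \bar R) : measurable_fun setT f -> (forall x, 0 <= f x)%E ->
  (\int[leb a]_x f x <= \int[leb l]_x f x)%E.
Proof.
move=> mf f0; rewrite !integral_leb//; apply: ge0_subset_integral => //.
  exact: measurable_funS mf.
by move=> x /=; rewrite !in_itv /= => /andP[-> xa]; exact: lt_le_trans al.
Qed.

Lemma leb_nested_L2 v : L2 (leb l) v -> L2 (leb a) v.
Proof.
move=> v2; have mv := L2_measurable v2; apply: L2P => //.
apply: le_lt_trans (L2_sqr_lty v2); apply: leb_nested_le.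
  by apply/measurable_EFinP; exact: measurable_funX mv.
by move=> x; rewrite lee_fin sqr_ge0.
Qed.

Lemma prim_nested v x : measurable_fun setT v -> x <= a ->
  prim (leb a) v x = prim (leb l) v x.
Proof.
move=> mv xa; rewrite /prim leb_nested; last exact: measurable_cut.
have mv1 : measurable_fun setT (fun t => cut v x t * (t < a)%R%:R).
  apply: measurable_funM; first exact: measurable_cut.
  by apply: measurable_bool_natr; exact: measurable_fun_ltr.
apply: ae_eq_Rintegral => //; first exact: measurable_cut.
apply: ae_imp ae_neq_a => t ta _; rewrite /cut; case: (leP t x) => tx; last by rewrite !mulr0 mul0r.
by rewrite lt_neqAle (introN eqP ta) (le_trans tx xa)/= !mulr1.
Qed.

Lemma ac_nested f v : ac l f v -> ac a f v.
Proof.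
move=> [mf v2 fE]; split=> //; first exact: leb_nested_L2.
move=> x /andP[x0 xa]; rewrite fE ?x0 ?(le_trans xa)//.
by rewrite prim_nested//; exact: L2_measurable v2.
Qed.

Lemma cut_cut v x y t : cut (cut v x) y t = v t * (t <= Num.min x y)%R%:R.
Proof. by rewrite /cut le_min -mulrA mulrb; case: (t <= x); rewrite ?mul1r ?mul0r//=; case: (t <= y). Qed.

Lemma prim_cut_nested v x : measurable_fun setT v ->
  prim (leb l) (cut v a) x = prim (leb l) v (Num.min a x).
Proof.
by move=> mv; rewrite /prim; apply: eq_Rintegral => t _; rewrite cut_cut.
Qed.

(** The two pieces fit together at a, where c vanishes. *)
Lemma h10_extend c v : h10 a c v ->
  ac l (fun x => if 0 < x < a then c x else 0) (cut v a).
Proof.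
move=> [[mc v2 cE] c0 ca]; have mv := L2_measurable v2.
have mi : measurable_fun setT (fun x : R => (0 < x < a)%R%:R : R).
  apply: measurable_bool_natr; apply: measurable_and; exact: measurable_fun_ltr.
split.
- rewrite (_ : (fun x => _) = fun x => c x * (0 < x < a)%R%:R); first exact: measurable_funM.
  by apply/funext => x; case: ifP; rewrite ?mulr1 ?mulr0.
- have mcv : measurable_fun setT (cut v a) by exact: measurable_cut.
  apply: L2P => //; apply: le_lt_trans (L2_sqr_lty v2).
  have mv2 : measurable_fun setT (fun x => (v x ^+ 2)%:E) by apply/measurable_EFinP; exact: measurable_funX.
  rewrite leb_nestedE// le_eqVlt; apply/orP; left; apply/eqP.
  apply: ae_eq_integral => //.
  + by apply/measurable_EFinP; exact: measurable_funX.
  + apply: emeasurable_funM => //; apply/measurable_EFinP.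
    by apply: measurable_bool_natr; exact: measurable_fun_ltr.
  apply: ae_imp ae_neq_a => t ta _; rewrite /cut -EFinM; congr EFin.
  by case: (ltgtP t a) => //= _; ring.
- move=> x /andP[x0 xl]; rewrite ltxx/= add0r prim_cut_nested// -prim_nested ?ge_min ?lexx//.
  have m0 : 0 <= Num.min a x <= a by rewrite le_min (ltW a0) x0 ge_min lexx.
  have := cE _ m0; rewrite c0 add0r => <-.
  have [->|xn0] := eqVneq x 0; first by rewrite ltxx (min_idPr (ltW a0)) c0.
  rewrite lt_def xn0 x0 /=; have [xa|ax] := boolP (x < a).
    by rewrite (min_idPr (ltW xa)).
  by rewrite -leNgt in ax; rewrite (min_idPl ax) ca.
Qed.

(** Where f vanishes on an interval, so does its derivative, almost everywhere. *)
Lemma ac_vanish f v w : ac l f v -> (forall x, a <= x <= l -> f x = 0) ->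
  L2 (leb l) w -> inner (leb l) v w = inner (leb a) v w.
Proof.
move=> fv f0 w2; have [mf v2 fE] := fv; have mv := L2_measurable v2.
have mw := L2_measurable w2; have c2 := leb_cut a v2.
have acc : ac l f (cut v a).
  split=> // x xl; rewrite prim_cut_nested//; case: (leP a x) => ax; last by rewrite -fE.
  rewrite -fE ?lexx ?(ltW a0) ?al//.
  by rewrite !f0 ?ax ?lexx ?al//; case/andP: xl.
have vc := ac_unique l0 fv acc; have mc := L2_measurable c2.
rewrite (@ae_eq_inner _ _ _ (leb l) v (cut v a) w w)//; last exact: aeW.
rewrite /inner leb_nested; last exact: measurable_funM.
have mv1 : measurable_fun setT (fun t => v t * w t * (t < a)%R%:R : R).
  apply: measurable_funM; first exact: measurable_funM.
  by apply: measurable_bool_natr; exact: measurable_fun_ltr.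
apply: ae_eq_Rintegral => //; first exact: measurable_funM.
apply: ae_imp ae_neq_a => t ta _; rewrite /cut; case: (ltgtP t a) => //= _; by ring.
Qed.

End nested_intervals.

Section continuous_representatives.
Context {R : realType}.
Variable l : R.
Hypothesis l0 : 0 < l.

Lemma continuous_ae_eq (f g : R -> R) : continuous f -> continuous g ->
  ae_eq (leb l) setT f g -> forall x, 0 <= x <= l -> f x = g x.
Proof.
move=> cf cg fg x /andP[x0 xl]; apply/eqP; rewrite -subr_eq0; apply: contrapT => /negP h0.
have ch : continuous (fun x => f x - g x) by move=> y; apply: continuousB; [exact: cf|exact: cg].
have /nbhs_ballP[e /= e0 he] : \forall y \near x, f y - g y != 0.
  by apply: (cvgr_neq0 _ (ch x)).
pose p := Num.max 0 (x - e); pose q := Num.min l (x + e).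
have pq : p < q by rewrite /p /q gt_max !lt_min l0 /=; do ?[apply/andP; split]; lra.
have p0 : 0 <= p by rewrite /p le_max lexx.
have ql : q <= l by rewrite /q ge_min lexx.
have [y /andP[]] := ae_leb_meets fg p0 pq ql.
rewrite /p /q gt_max lt_min => /andP[y0 xy] /andP[yl yx] /(_ I) fy.
have : ball x e y by rewrite /ball /= ltr_norml; apply/andP; split; lra.
by move/he; rewrite /= fy subrr eqxx.
Qed.

Variable u : itv0 l0 -> R.
Let y x := u (clamp l0 x).

(** The representative given by [weak_deriv_prim] agrees everywhere with the
    continuous function. *)
Lemma wderiv_ac v : continuous u -> itv0_wderiv u v -> ac l y v.
Proof.
move=> cu [v2 [U [Uu U2 Uv]]]; have mU := L2_measurable U2.
have cy : continuous y by move=> x; apply: continuous_comp; [exact: clamp_continuous|exact: cu].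
have my : measurable_fun setT y by exact: continuous_measurable_fun.
have [c Uc] := weak_deriv_prim l0 U2 v2 Uv.
have yU : ae_eq (leb l) setT y U.
  apply: ae_imp (leb_ae_itv l) => x /andP[x0 xl] _.
  by rewrite /y -Uu /= clampE// !ltW.
have yc : ae_eq (leb l) setT y (fun x => c + prim (leb l) v x).
  by apply: ae_imp2 yU Uc => x yx cx _; rewrite yx// cx.
have cc : continuous (fun x => c + prim (leb l) v x).
  by move=> x; apply: continuousD; [exact: cst_continuous|exact: prim_continuous].
have E := continuous_ae_eq cy cc yc.
split=> // x xl; rewrite !E ?lexx ?(ltW l0)//.
by rewrite (@prim_le0 _ _ _ 0) ?addr0//; exact: L2_measurable v2.
Qed.

Lemma ac_wderiv v : ac l y v -> itv0_wderiv u v.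
Proof.
move=> yv; have [_ v2 _] := yv; split=> //; exists y; split; [|exact: ac_L2 yv|exact: ac_weak_deriv].
by apply/funext => x; rewrite /y /= clampK.
Qed.

End continuous_representatives.

(** Weak derivatives are unique up to null sets, so that the choice in [itv0_form]
    is harmless. *)
Lemma itv0_formE {R : realType} (l : R) (l0 : 0 < l) (u u' : itv0 l0 -> R) v v' :
  continuous u -> continuous u' ->
  ac l (fun x => u (clamp l0 x)) v -> ac l (fun x => u' (clamp l0 x)) v' ->
  fval (itv0_form l0) u u' = inner (leb l) v v'.
Proof.
move=> cu cu' uv uv'.
have g (w : itv0 l0 -> R) z : continuous w -> ac l (fun x => w (clamp l0 x)) z ->
    ac l (fun x => w (clamp l0 x)) (get (itv0_wderiv w)).
  by move=> cw wz; apply: wderiv_ac => //; apply: getI (ac_wderiv wz).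
have gu := g _ _ cu uv; have gu' := g _ _ cu' uv'.
have m z (w : R -> R) : ac l w z -> measurable_fun setT z by case=> _ /L2_measurable.
have e := ac_unique l0 gu uv; have e' := ac_unique l0 gu' uv'.
exact: (@ae_eq_inner _ _ _ (leb l) _ _ _ _ (m _ _ gu) (m _ _ gu') (m _ _ uv) (m _ _ uv') e e').
Qed.

Lemma ac_lin {R : realType} (l b c : R) (f g v w : R -> R) : ac l f v -> ac l g w ->
  ac l (fun x => b * f x + c * g x) (fun x => b * v x + c * w x).
Proof. by move=> fv gw; apply: acD; exact: acZ. Qed.

Lemma ac_sum {R : realType} (l : R) (J : Type) (r : seq J) (f v : J -> R -> R) :
  0 < l -> (forall k, ac l (f k) (v k)) ->
  ac l (fun x => \sum_(k <- r) f k x) (fun x => \sum_(k <- r) v k x).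
Proof.
move=> l0 fv; elim: r => [|k r IH].
  rewrite (_ : (fun x => _) = cst 0); last by apply/funext => x; rewrite big_nil.
  rewrite (_ : (fun x => \sum_(k <- [::]) v k x) = cst 0); last by apply/funext => x; rewrite big_nil.
  exact: ac_cst.
rewrite (_ : (fun x => _) = fun x => f k x + \sum_(k <- r) f k x); last first.
  by apply/funext => x; rewrite big_cons.
rewrite (_ : (fun x => \sum_(k <- k :: r) v k x) = fun x => v k x + \sum_(k <- r) v k x); last first.
  by apply/funext => x; rewrite big_cons.
exact: acD.
Qed.

Section stage_forms.
Context {R : realType} {len : R}.
Variable len0 : 0 < len.
Variable a : nat -> R.
Hypothesis a_anti : forall i j, (i <= j)%N -> a j <= a i.

Local Notation I := (itv0 len0).
Local Notation s := (haar_tower len0 a).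
Local Notation P := (projlim s).
Local Notation curve := (@curve R len len0 a).
Local Notation sec := (@sec R len len0 a).
Local Notation be := (haar_sequence len0 a_anti).
Local Notation E0 := (itv0_form len0).

Definition stage_dom i : set (FF s i -> R) := fdom (stage_form be E0 i).

Definition stage_val i : (FF s i -> R) -> (FF s i -> R) -> R := fval (stage_form be E0 i).

Arguments stage_dom : clear implicits.
Arguments stage_val : clear implicits.

Lemma FF_C0 i (u : FF s i -> R) : C0 u <-> continuous u.
Proof.
split=> [[]//|cu]; split=> //.
exact: (subclosed_compact (@closed_closure _ _) (@FF_compact R len len0 a i) (@subsetT _ _)).
Qed.

Lemma stage_dom0 (u : I -> R) : stage_dom 0 u <->
  continuous u /\ exists v, ac len (fun x => u (clamp len0 x)) v.
Proof.
split=> [[[v uv] /(@FF_C0 0) cu]|[cu [v uv]]].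
  by split=> //; exists v; exact: wderiv_ac.
by split; [exists v; exact: ac_wderiv|exact/(@FF_C0 0)].
Qed.

Lemma stage_domS i (u : FF s i.+1 -> R) : stage_dom i.+1 u <->
  continuous u /\ exists n (w : 'I_n -> FF s i -> R) (h : 'I_n -> GG s i -> R),
    [/\ forall k, stage_dom i (w k), forall k, continuous (h k)
      & forall x g, u (ppi s i (x, g)) = \sum_(k < n) w k x * h k g].
Proof. by split=> -[/(@FF_C0 i.+1) cu h]; split=> //; exact/(@FF_C0 i.+1). Qed.

Lemma stage_cont i u : stage_dom i u -> continuous u.
Proof. by case: i u => [|i] u; [move/stage_dom0 => []|move/stage_domS => []]. Qed.

Lemma stage_ac i u j : stage_dom i u ->
  exists v, ac len (fun x => u (curve j i (clamp len0 x))) v.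
Proof.
elim: i u => [u /stage_dom0[]//|i IH u /stage_domS[_ [n [w [h [wD _ uE]]]]]].
have /choice[v vP] : forall k, exists v, ac len (fun x => w k (curve j i (clamp len0 x))) v.
  by move=> k; exact: IH.
set g := if i == j then tip len0 a i else point.
exists (fun x => \sum_(k < n) h k g * v k x).
rewrite (_ : (fun x => _) = fun x => \sum_(k < n) h k g * w k (curve j i (clamp len0 x))).
  by apply: ac_sum => // k; exact: acZ.
by apply/funext => x; rewrite /= -/g uE; apply: eq_bigr => k _; rewrite mulrC.
Qed.

Lemma stage_lin i b c u w : stage_dom i u -> stage_dom i w ->
  stage_dom i (fun x => b * u x + c * w x).
Proof.
have clin (X : topologicalType) (f g : X -> R) : continuous f -> continuous g ->
    continuous (fun x => b * f x + c * g x).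
  by move=> cf cg x; apply: (@cvgD _ R^o); apply: cvgM;
    [exact: cvg_cst|exact: cf|exact: cvg_cst|exact: cg].
case: i u w => [u w /stage_dom0[cu [v uv]] /stage_dom0[cw [v' wv']]|i u w].
  by apply/stage_dom0; split; [exact: clin|eexists; exact: ac_lin uv wv'].
move=> /stage_domS[cu [n [p [h [pD hc uE]]]]] /stage_domS[cw [n' [p' [h' [pD' hc' wE]]]]].
apply/stage_domS; split; first exact: clin.
exists (n + n')%N, (fun k => match fintype.split k with inl k1 => p k1 | inr k2 => p' k2 end),
  (fun k => match fintype.split k with inl k1 => fun g => b * h k1 g | inr k2 => fun g => c * h' k2 g end).
split=> [k|k|x g]; first by case: fintype.split.
  by case: fintype.split => k' y; (apply: continuousM; first exact: cst_continuous); [exact: hc|exact: hc'].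
rewrite uE wE big_split_ord/= !mulr_sumr; congr (_ + _); apply: eq_bigr => k _.
  by rewrite (unsplitK (inl k))/= mulrCA.
by rewrite (unsplitK (inr k))/= mulrCA.
Qed.

Lemma stage_zero i : stage_dom i (fun=> 0).
Proof.
case: i => [|i]; first by apply/stage_dom0; split; [exact: cst_continuous|exists (cst 0); exact: ac_cst].
apply/stage_domS; split; first exact: cst_continuous.
by exists 0%N, (fun=> fun=> 0), (fun=> fun=> 0); split=> [[]|[]|x g] //; rewrite big_ord0.
Qed.

Lemma stage_sum i n (w : 'I_n -> FF s i -> R) (c : 'I_n -> R) :
  (forall k, stage_dom i (w k)) -> stage_dom i (fun x => \sum_(k < n) w k x * c k).
Proof.
elim: n w c => [|n IH] w c wD.
  by rewrite (_ : (fun x => _) = fun=> 0); [exact: stage_zero|apply/funext => x; rewrite big_ord0].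
have := stage_lin 1 (c ord_max) (IH _ (fun k => c (widen_ord (leqnSn n) k))
  (fun k => wD (widen_ord (leqnSn n) k))) (wD ord_max).
by congr (stage_dom i _); apply/funext => x; rewrite big_ord_recr/= mul1r [c _ * _]mulrC.
Qed.

Lemma stage_ppi i u g : stage_dom i.+1 u -> stage_dom i (fun x => u (ppi s i (x, g))).
Proof.
move=> /stage_domS[_ [n [w [h [wD _ uE]]]]].
by rewrite (_ : (fun x => _) = fun x => \sum_(k < n) w k x * h k g); [exact: stage_sum|exact/funext].
Qed.

Lemma stage_phi i u : stage_dom i u -> stage_dom i.+1 (u \o phi s i).
Proof.
move=> uD; have cu := stage_cont uD; apply/stage_domS; split.
  by move=> x; apply: continuous_comp; [exact: glue_phi_continuous|exact: cu].
exists 1%N, (fun=> u), (fun=> fun=> 1); split=> // [_|x g]; first exact: cst_continuous.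
by rewrite big_ord1 mulr1 /= phi_ppi.
Qed.

(** The form of the i-th stage is the weighted sum of the energies of its branches:
    at each step, the coin halves the weight of the base branch. *)
Lemma stage_valE i u u' v v' : stage_dom i u -> stage_dom i u' ->
  (forall j, (j <= i)%N -> ac len (fun x => u (curve j i (clamp len0 x))) (v j)) ->
  (forall j, (j <= i)%N -> ac len (fun x => u' (curve j i (clamp len0 x))) (v' j)) ->
  stage_val i u u' = \sum_(j < i) wt j * inner (leb len) (v j) (v' j)
    + 2 * wt i * inner (leb len) (v i) (v' i).
Proof.
elim: i u u' v v' => [|i IH] u u' v v' uD uD' uv uv'.
  rewrite big_ord0 add0r /wt expr1 divff ?mul1r ?pnatr_eq0//.
  by apply: itv0_formE; [exact: stage_cont uD|exact: stage_cont uD'|exact: uv|exact: uv'].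
have -> : stage_val i.+1 u u' = \int[fair_coin len0 a i]_g
  stage_val i (fun x => u (ppi s i (x, g))) (fun x => u' (ppi s i (x, g))) by [].
rewrite coin_Rintegral; last exact: (GG_two len0 a i).2.
have br (w : FF s i.+1 -> R) z : (forall j, (j <= i.+1)%N -> ac len (fun x => w (curve j i.+1 (clamp len0 x))) (z j)) ->
  forall j, (j <= i)%N ->
    ac len (fun x => w (ppi s i (curve j i (clamp len0 x), point))) (if j == i then z i.+1 else z j) /\
    ac len (fun x => w (ppi s i (curve j i (clamp len0 x), tip len0 a i))) (z j).
  move=> wz j; rewrite leq_eqVlt => /orP[/eqP ->|ji].
    rewrite eqxx; split.
      have := wz i.+1 (leqnn _); congr (ac len _ _); apply/funext => x /=.
      by rewrite (ltn_eqF (ltnSn i)) !curve_sec.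
    have := wz i (leqnSn _); congr (ac len _ _); apply/funext => x /=.
    by rewrite eqxx.
  rewrite (ltn_eqF ji); have := wz j (leqW (ltnW ji)).
  by move=> wj; split; move: wj; congr (ac len _ _); apply/funext => x; rewrite ppi_curve.
have b1 := br u v uv; have b2 := br u' v' uv'.
rewrite (IH _ _ (fun j => if j == i then v i.+1 else v j) (fun j => if j == i then v' i.+1 else v' j)); first last.
- by move=> j ji; exact: (b2 j ji).1.
- by move=> j ji; exact: (b1 j ji).1.
- exact: stage_ppi.
- exact: stage_ppi.
rewrite (IH _ _ v v'); first last.
- by move=> j ji; exact: (b2 j ji).2.
- by move=> j ji; exact: (b1 j ji).2.
- exact: stage_ppi.
- exact: stage_ppi.
rewrite eqxx big_ord_recr/= wtS (eq_bigr (fun j : 'I_i => wt j * inner (leb len) (v j) (v' j))); last first.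
  by move=> j _; rewrite ltn_eqF.
move: (\sum_(_ < i) _) (inner (leb len) (v i.+1) (v' i.+1)) (inner (leb len) (v i) (v' i)) (wt i).
by move=> S p q w; field.
Qed.

End stage_forms.

Arguments stage_dom {R len len0 a} a_anti i _.
Arguments stage_val {R len len0 a} a_anti i _ _.

(** * The limit form in coefficients *)

Lemma Rintegral_ord_sum {R : realType} d (T : measurableType d) (mu : {measure set T -> \bar R})
    n (F : nat -> T -> R) : (forall k, mu.-integrable setT (EFin \o F k)) ->
  mu.-integrable setT (EFin \o (fun x => \sum_(k < n) F k x)) /\
  \int[mu]_x (\sum_(k < n) F k x) = \sum_(k < n) \int[mu]_x F k x.
Proof.
move=> iF; elim: n => [|n [IH1 IH2]].
  rewrite big_ord0 (_ : (fun x => _) = cst 0); last by apply/funext => x; rewrite big_ord0.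
  by split; [exact: integrable0|rewrite Rintegral_cst// mul0r].
rewrite (_ : (fun x => _) = fun x => \sum_(k < n) F k x + F n x); last first.
  by apply/funext => x; rewrite big_ord_recr.
split; last by rewrite RintegralD// IH2 big_ord_recr.
exact: integrableD IH1 (iF n).
Qed.

Lemma sum_ord_trail {R : realType} (F : nat -> R) m n : (m <= n)%N ->
  (forall k, (m <= k)%N -> F k = 0) -> \sum_(k < n) F k = \sum_(k < m) F k.
Proof.
move=> /subnKC <- F0; rewrite big_split_ord/= [X in _ + X]big1 ?addr0// => k _.
by rewrite F0// leq_addr.
Qed.

Section limit_form.
Context {R : realType} {len : R}.
Variable len0 : 0 < len.
Variable a : nat -> R.
Hypothesis a_anti : forall i j, (i <= j)%N -> a j <= a i.
Hypothesis a_cvg : a @ \oo --> (0 : R).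
Hypothesis a_le : forall i, a i <= len.
Hypothesis a_gt0 : forall i, 0 < a i.

Local Notation I := (itv0 len0).
Local Notation s := (haar_tower len0 a).
Local Notation P := (projlim s).
Local Notation curve := (@curve R len len0 a).
Local Notation sec := (@sec R len len0 a).
Local Notation path := (@path R len len0 a).
Local Notation mu := (@tower_measure R len len0 a).
Local Notation window := (@window R len len0 a).
Local Notation be := (haar_sequence len0 a_anti).
Local Notation E0 := (itv0_form len0).
Local Notation coef := (@coef R len len0 a).
Local Notation length := (@coef_length R len a).
Local Notation stage_dom := (@stage_dom R len len0 a a_anti).
Local Notation stage_val := (@stage_val R len len0 a a_anti).

Definition limit_dom : set (P -> R) := fdom (limit_form be E0).

Definition at_stage i (f : P -> R) := exists2 u, stage_dom i u & f = u \o Phi s i.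

Lemma limit_domP f : limit_dom f <-> exists i, at_stage i f.
Proof. by split=> [[i [u [uD ->]]]|[i [u uD ->]]]; [exists i, u|exists i, u]. Qed.

Lemma at_stage_le i j f : (i <= j)%N -> at_stage i f -> at_stage j f.
Proof.
move=> /subnK <-; elim: (j - i)%N => // n IH /IH[u uD ->].
exists (u \o phi s _); first exact: stage_phi.
by apply/funext => p; rewrite /= phi_Phi.
Qed.

Lemma at_stage2 f g : limit_dom f -> limit_dom g -> exists i, at_stage i f /\ at_stage i g.
Proof.
move=> /limit_domP[i fi] /limit_domP[j gj]; exists (maxn i j).
by split; [exact: at_stage_le (leq_maxl _ _) fi|exact: at_stage_le (leq_maxr _ _) gj].
Qed.

Lemma limit_lin b c f g : limit_dom f -> limit_dom g -> limit_dom (fun p => b * f p + c * g p).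
Proof.
move=> Df Dg; have [i [[u uD ->] [w wD ->]]] := at_stage2 Df Dg.
apply/limit_domP; exists i, (fun x => b * u x + c * w x) => //; exact: stage_lin.
Qed.

(** Derivatives along the branches of a function of the i-th stage, at which the
    branches from i on agree. *)
Definition branch_der i (u : FF s i -> R) (v : nat -> R -> R) :=
  (forall j, ac len (fun x => u (curve j i (clamp len0 x))) (v j)) /\
  forall x, constant_from i (v ^~ x).

Lemma branch_derP i u : stage_dom i u -> exists v, branch_der u v.
Proof.
move=> uD; have /choice[v vP] := fun j => stage_ac j uD.
exists (fun j => v (minn j i)); split=> [j|x j ij].
  have [ji|ij] := leqP j i; first exact: vP.
  by have := vP i; rewrite !curve_sec// ltnW.
by rewrite (minn_idPr ij) minnn.
Qed.

Lemma fibre_stage i (u : FF s i -> R) x : constant_from i (fibre (u \o Phi s i) x).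
Proof. by move=> j ij; rewrite /fibre /path /= !Phi_Curve !curve_sec. Qed.

Lemma coef_high i (u : FF s i -> R) k x : (i < k)%N -> coef (u \o Phi s i) k x = 0.
Proof.
case: k => // k ik; apply: haar_coef_constant; apply: constant_from_le (fibre_stage u x).
by rewrite -ltnS.
Qed.

(** The Haar vectors do not depend on x, so that taking coefficients commutes with
    differentiation. *)
Lemma coef_ac i (u : FF s i -> R) v k : branch_der u v ->
  ac len (coef (u \o Phi s i) k) (fun x => haar_coef (v ^~ x) k).
Proof.
move=> [uv vc].
have tail_ac m : ac len (fun x => tail (fibre (u \o Phi s i) x) m) (fun x => tail (v ^~ x) m).
  have tE (z : R -> nat -> R) : (forall x, constant_from i (z x)) ->
     (fun x => tail (z x) m) = fun x => \sum_(j <- index_iota m (maxn i m)) wt j * z x j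
        + 2^-1 ^+ (maxn i m) * z x (maxn i m).
    by move=> cz; apply/funext => x; rewrite (tailE (cz x) (leq_maxl i m) (leq_maxr i m)).
  rewrite (tE _ (fibre_stage u)) (tE (fun x => v ^~ x) vc).
  apply: acD; last by apply: acZ; exact: uv.
  by apply: ac_sum => // j; apply: acZ; exact: uv.
case: k => [|k]; first exact: tail_ac.
by apply: acZ; apply: acB; [exact: tail_ac|apply: acZ; exact: uv].
Qed.

(** Parseval's identity for the derivatives along the branches. *)
Lemma stage_val_coef i u u' v v' : stage_dom i u -> stage_dom i u' ->
  branch_der u v -> branch_der u' v' ->
  stage_val i u u' =
  \sum_(k < i.+1) inner (leb len) (fun x => haar_coef (v ^~ x) k) (fun x => haar_coef (v' ^~ x) k).
Proof.
move=> uD uD' uv uv'; rewrite (stage_valE uD uD' (v := v) (v' := v')); first last.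
- by move=> j _; exact: uv'.1.
- by move=> j _; exact: uv.1.
have v2 j : L2 (leb len) (v j) by case: (uv.1 j).
have v2' j : L2 (leb len) (v' j) by case: (uv'.1 j).
have c2 k : L2 (leb len) (fun x => haar_coef (v ^~ x) k) by case: (coef_ac k uv).
have c2' k : L2 (leb len) (fun x => haar_coef (v' ^~ x) k) by case: (coef_ac k uv').
have [_ <-] := Rintegral_ord_sum i.+1 (fun k => inner_integrable (c2 k) (c2' k)).
pose q j := if (j < i)%N then wt j else 2 * wt i : R.
pose F j x := q j * v j x * v' j x.
have iF j : (leb len).-integrable setT (EFin \o F j) by apply: inner_integrable => //; exact: L2Z.
have [_ FE] := Rintegral_ord_sum i.+1 iF.
have FI j : \int[leb len]_x F j x = q j * inner (leb len) (v j) (v' j) by rewrite -innerZl.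
transitivity (\int[leb len]_x \sum_(k < i.+1) F k x).
  rewrite FE big_ord_recr/= FI /q ltnn; congr (_ + _).
  by apply: eq_bigr => j _; rewrite FI /q ltn_ord.
apply: eq_Rintegral => x _; rewrite (haar_parseval _ (uv.2 x) (uv'.2 x)).
rewrite big_ord_recr/= /F /q ltnn !tail_constant; [|exact: uv'.2|exact: uv.2].
have w0 : wt i != 0 :> R by rewrite gt_eqF ?wt_gt0.
congr (_ + _); last by field.
by apply: eq_bigr => j _; rewrite ltn_ord mulrA.
Qed.

Local Notation E := (form_restrict (limit_form be E0) (Phi s 0 @^-1` (itv0_ends len0))).

Lemma core_ends f j : fdom E f -> fibre f 0 j = 0 /\ fibre f len j = 0.
Proof.
move=> [_ f0]; split; apply: f0; rewrite /= /itv0_ends /= Phi_Curve /=.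
  by left; rewrite clampE// lexx ltW.
by right; rewrite clampE// lexx ltW.
Qed.

Lemma haar_coef0 (y : nat -> R) k : (forall j, y j = 0) -> haar_coef y k = 0.
Proof.
move=> y0; have cy : constant_from 0 y by move=> j _; rewrite !y0.
case: k => [|k]; first by rewrite /= tail_constant// y0 mulr0.
by rewrite haar_coef_constant//; exact: constant_from_le cy.
Qed.

(** At 0 and len the function vanishes on all branches, and beyond its window a
    coefficient vanishes by [coef_vanish]. *)
Lemma core_coef_ends f k : fdom E f -> [/\ coef f k 0 = 0, coef f k (length k) = 0 &
  forall x, length k <= x <= len -> coef f k x = 0].
Proof.
move=> fD; have c0 : coef f k 0 = 0 by apply: haar_coef0 => j; exact: (core_ends j fD).1.
have cl : coef f k len = 0 by apply: haar_coef0 => j; exact: (core_ends j fD).2.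
case: k c0 cl => [|k] c0 cl.
  by split=> // x; rewrite /= => h; rewrite (_ : x = len)//; apply/le_anti; rewrite andbC.
have van x : a k <= x -> coef f k.+1 x = 0.
  by move=> ax; apply: coef_vanish => // /(windowP a_le)/andP[_]; rewrite ltNge ax.
by split=> //; [exact: van|move=> x /andP[ax _]; exact: van].
Qed.

Lemma length_gt0 k : 0 < length k.
Proof. by case: k. Qed.

Lemma core_h10 f i u v k : fdom E f -> f = u \o Phi s i -> branch_der u v ->
  h10 (length k) (coef f k) (fun x => haar_coef (v ^~ x) k).
Proof.
move=> fD fu uv; have [c0 cl _] := core_coef_ends k fD; split=> //.
by apply: (ac_nested (length_le a_le k)); rewrite fu; exact: coef_ac.
Qed.

Lemma core_derivatives f : fdom E f -> exists v, forall k, h10 (length k) (coef f k) (v k).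
Proof.
move=> fD; have [/limit_domP[i [u uD fu]] _] := fD; have [v uv] := branch_derP uD.
by exists (fun k x => haar_coef (v ^~ x) k) => k; exact: core_h10 fD fu uv.
Qed.

Lemma h10_unique (l : R) (f v w : R -> R) : 0 < l -> h10 l f v -> h10 l f w -> ae_eq (leb l) setT v w.
Proof. by move=> l0 [fv _ _] [fw _ _]; have := ac_unique l0 fv fw. Qed.

Lemma h10_L2 (l : R) (f v : R -> R) : h10 l f v -> L2 (leb l) v.
Proof. by case=> -[]. Qed.

(** The coefficients beyond the stage of f vanish, so that the value does not depend
    on the stage at which [limit_form] evaluates it. *)
Lemma core_val f : fdom E f -> exists N0, forall g v w, fdom E g ->
  (forall k, h10 (length k) (coef f k) (v k)) -> (forall k, h10 (length k) (coef g k) (w k)) ->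
  forall N, (N0 <= N)%N -> fval E f g = \sum_(k < N) inner (leb (length k)) (v k) (w k).
Proof.
move=> fD; have [/limit_domP[i [u uD fu]] _] := fD; exists i.+1 => g v w gD fv gw N iN.
have zero j (z : FF s j -> R) k : f = z \o Phi s j -> (j < k)%N ->
    inner (leb (length k)) (v k) (w k) = 0.
  move=> fz jk; have : h10 (length k) (coef f k) (fun=> 0).
    rewrite fz (_ : coef _ k = fun=> 0); last by apply/funext => x; exact: coef_high.
    by split=> //; exact: ac_cst.
  move=> /(h10_unique (length_gt0 k) (fv k)) v0.
  have m := L2_measurable (h10_L2 (gw k)).
  rewrite (@ae_eq_inner _ _ _ (leb (length k)) (v k) (fun=> 0) (w k) (w k))//; last exact: aeW.
    by rewrite /inner; under eq_Rintegral do rewrite mul0r; rewrite Rintegral_cst// mul0r.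
  exact: L2_measurable (h10_L2 (fv k)).
have valE j z z' : stage_dom j z -> stage_dom j z' -> f = z \o Phi s j -> g = z' \o Phi s j ->
    stage_val j z z' = \sum_(k < N) inner (leb (length k)) (v k) (w k).
  move=> zD zD' fz gz; have [p zp] := branch_derP zD; have [q zq] := branch_derP zD'.
  have -> : stage_val j z z' = \sum_(k < j.+1) inner (leb (length k)) (v k) (w k).
    rewrite (stage_val_coef zD zD' zp zq); apply: eq_bigr => k _.
    have pk := core_h10 k fD fz zp; have qk := core_h10 k gD gz zq.
    have cp := coef_ac k zp; have [_ cq _] := coef_ac k zq.
    have [_ _ van] := core_coef_ends k fD; rewrite fz in van.
    rewrite (ac_vanish (length_gt0 k) (length_le a_le k) cp van cq).
    apply: ae_eq_inner; [exact: L2_measurable (h10_L2 pk)|exact: L2_measurable (h10_L2 qk)|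
      exact: L2_measurable (h10_L2 (fv k))|exact: L2_measurable (h10_L2 (gw k))| |].
      exact: h10_unique (length_gt0 k) pk (fv k).
    exact: h10_unique (length_gt0 k) qk (gw k).
  pose F k := inner (leb (length k)) (v k) (w k).
  rewrite -(@sum_ord_trail _ F _ (j.+1 + N)%N (leq_addr _ _)); last by move=> k jk; exact: zero fz jk.
  by rewrite (@sum_ord_trail _ F N) ?leq_addl// => k Nk; apply: zero fu _; exact: leq_trans iN Nk.
rewrite /form_restrict/=; set A := [set _ | _].
have [Lf Lg] : limit_dom f /\ limit_dom g by split; [case: fD|case: gD].
have [j [[z zD fz] [z' zD' gz]]] := at_stage2 Lf Lg.
have : A (get A) by apply: (@getI _ A (stage_val j z z')); exists j, z, z'.
move=> [j' [y [y' [yD yD' fy gy ->]]]].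
exact: valE.
Qed.

Lemma core_lin b c f g : fdom E f -> fdom E g -> fdom E (fun p => b * f p + c * g p).
Proof.
move=> [Df f0] [Dg g0]; split; first exact: limit_lin.
by move=> p Zp; rewrite f0// g0// !mulr0 addr0.
Qed.

Lemma core_L2 f : fdom E f -> L2 mu f.
Proof.
move=> fD; have [/limit_domP[i [u uD fu]] _] := fD; have [v uv] := branch_derP uD.
have mf : measurable_fun setT (f : borel P -> R).
  rewrite fu; apply: continuous_borel_R => p.
  by apply: continuous_comp; [exact: Phi_continuous|exact: (stage_cont uD)].
apply: L2P => //; rewrite (coef_parseval a_anti a_cvg a_le mf) (nneseries_split 0 i.+1); last first.
  by move=> j _; apply: integral_ge0 => x _; rewrite lee_fin sqr_ge0.
rewrite add0n eseries0 ?adde0; last first.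
  move=> k ik _; rewrite fu (_ : (fun x => _) = fun=> 0%E) ?integral0//.
  by apply/funext => x; rewrite coef_high// expr0n.
apply/lte_sum_pinfty => k _; apply: L2_sqr_lty.
by have [cv _ _] := core_h10 k fD fu uv; exact: (ac_L2 (length_gt0 k) cv).
Qed.

(** A function of H^1_0(]0, a k[), transported to the base branch of the i-th stage. *)
Definition base_lift k (c : R -> R) i (p : FF s i) : R :=
  \1_(sec i @` window k) p * c (set_val (abscissa p : I)).

Lemma branch_indic k i g0 p g : (i <= k)%N ->
  \1_((fun x => ppi s i (sec i x, g0)) @` window k) (ppi s i (p, g)) =
  \1_(sec i @` window k) p * \1_[set g0] g :> R.
Proof.
move=> ik; rewrite !indicE -natrM mulnb; congr (nat_of_bool _)%:R.
apply/idP/andP => [/set_mem[x wx /glue_pi_inj[<- h]]|[/set_mem[x wx <-] /set_mem ->]].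
  split; apply/mem_set; first by exists x.
  by apply/esym; apply: h => /BB_sec; apply; exact: (window_anti a_anti ik wx).
by apply/mem_set; exists x.
Qed.

Lemma base_lift_ppi k c i p g : (i <= k)%N ->
  base_lift k c (ppi s i (p, g)) = base_lift k c p * \1_[set (point : GG s i)] g.
Proof.
by move=> ik; rewrite /base_lift /= phi_ppi mulrAC; congr (_ * _); exact: branch_indic.
Qed.

Lemma fibre_fun_continuous i (A : set (GG s i)) : continuous (\1_A : GG s i -> R).
Proof. by apply/continuousP => B _; exact: (GG_two len0 a i).2. Qed.

Lemma glue_prod_continuous i (u : FF s i.+1 -> R) (w : FF s i -> R) (h : GG s i -> R) :
  continuous w -> continuous h -> (forall x g, u (ppi s i (x, g)) = w x * h g) -> continuous u.
Proof.
move=> cw ch uE; apply: glue_continuous.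
rewrite (_ : _ \o _ = fun q : FF s i * GG s i => w q.1 * h q.2); last first.
  by apply/funext => -[x g]; exact: uE.
move=> q; apply: cvgM.
  by apply: (@continuous_comp _ _ _ fst w); [exact: cvg_fst|exact: cw].
by apply: (@continuous_comp _ _ _ snd h); [exact: cvg_snd|exact: ch].
Qed.

Lemma stage_dom_prod i (u : FF s i.+1 -> R) w h : stage_dom i w -> continuous h ->
  (forall x g, u (ppi s i (x, g)) = w x * h g) -> stage_dom i.+1 u.
Proof.
move=> wD ch uE; apply/stage_domS; split; first exact: glue_prod_continuous (stage_cont wD) ch uE.
by exists 1%N, (fun=> w), (fun=> h); split=> // x g; rewrite big_ord1.
Qed.

(** By induction on the stage: each step multiplies by the indicator function of the
    base point of the fibre. *)
Lemma base_lift_dom k c v i : (i <= k)%N -> h10 (a k) c v -> stage_dom i (@base_lift k c i).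
Proof.
move=> ik cv; elim: i ik => [|i IH] ik.
  have ext := h10_extend (a_gt0 k) (a_le k) cv.
  have c2 : L2 (leb len) (cut v (a k)) by case: ext.
  have lE (x : I) : base_lift k c (x : FF s 0) =
      (if 0 < (set_val x : R) < a k then c (set_val x) else 0).
    rewrite /base_lift /= image_id indicE; case: ifPn => h; last first.
      by rewrite memNset ?mul0r// => wx; move: h; rewrite wx.
    by rewrite mem_set ?mul1r.
  have cont : continuous (@base_lift k c 0).
    rewrite (_ : @base_lift k c 0 = prim (leb len) (cut v (a k)) \o (set_val : I -> R)); last first.
      apply/funext => x; rewrite lE /=; have [_ _ /(_ _ (itv0P x))] := ext.
      by rewrite ltxx add0r.
    by move=> x; apply: continuous_comp; [exact: set_val_continuous|exact: prim_continuous].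
  apply/stage_dom0; split=> //; exists (cut v (a k)).
  apply: (ac_ext len0 _ _ _ _ ext) => [x xl|||]; [by rewrite lE clampE| |exact: aeW|exact: L2_measurable c2].
  apply: continuous_measurable_fun => x.
  by apply: continuous_comp; [exact: clamp_continuous|exact: cont].
apply: (@stage_dom_prod _ _ (@base_lift k c i) (\1_[set (point : GG s i)])).
- by apply: IH; exact: ltnW.
- exact: fibre_fun_continuous.
- by move=> x g; rewrite base_lift_ppi// ltnW.
Qed.

(** The product of [base_lift] with the function on the fibre that is 1 at the base
    point and - 1 at the tip. *)
Lemma haar_lift_dom k c v : h10 (a k) c v ->
  limit_dom (fun p => haar k p * c (base_point p)).
Proof.
move=> cv; apply/limit_domP; exists k.+1.
exists (fun q : FF s k.+1 => (\1_(sec k.+1 @` window k) q - \1_(curve k k.+1 @` window k) q)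
   * c (set_val (abscissa q : I))); last first.
  by apply/funext => p; rewrite /haar /base_point /= -(abscissa_Phi k.+1).
apply: (@stage_dom_prod _ _ (@base_lift k c k)
   (fun g => 1 * \1_[set (point : GG s k)] g + (-1) * \1_[set tip len0 a k] g)).
- exact: base_lift_dom cv.
- by move=> g; apply: (@cvgD _ R^o); apply: cvgM; [exact: cvg_cst|exact: fibre_fun_continuous|
    exact: cvg_cst|exact: fibre_fun_continuous].
have cE : curve k k.+1 = fun x => ppi s k (sec k x, tip len0 a k).
  by apply/funext => y /=; rewrite eqxx curve_sec.
move=> x g; rewrite /base_lift cE [abscissa _]/= phi_ppi !(branch_indic _ _ _ (leqnn k)).
by rewrite mul1r mulN1r mulrBl mulrBr; ring.
Qed.

Lemma base_dom c v : h10 len c v -> limit_dom (fun p => c (base_point p)).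
Proof.
move=> [cv c0 cl]; apply/limit_domP; exists 0%N, (fun x : I => c (set_val x)) => //.
have [mc v2 cE] := cv; apply/stage_dom0; split.
  rewrite (_ : (fun x => _) = prim (leb len) v \o (set_val : I -> R)); last first.
    by apply/funext => x; rewrite /= cE ?itv0P// c0 add0r.
  by move=> x; apply: continuous_comp; [exact: set_val_continuous|exact: prim_continuous].
exists v; apply: (ac_ext len0 _ _ _ _ cv) => [x xl|||]; [by rewrite clampE| |exact: aeW|exact: L2_measurable v2].
apply: (measurableT_comp mc); rewrite (_ : (fun x => _) = set_val \o clamp len0)//.
apply: continuous_measurable_fun => x.
by apply: continuous_comp; [exact: clamp_continuous|exact: set_val_continuous].
Qed.

Lemma synth_finite c N (p : P) : (forall k, (N <= k)%N -> c k = fun=> 0) ->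
  synth c p = c 0%N (base_point p) +
    \sum_(k < N) rt2 ^+ k * (haar k p * c k.+1 (base_point p)) :> R.
Proof.
move=> c0; rewrite /synth; congr (_ + _); apply/cvg_lim => //; apply: cvg_near_cst; near=> n.
have Nn : (N <= n)%N by near: n; exact: nbhs_infty_ge.
rewrite big_mkord (@sum_ord_trail _ (fun k => rt2 ^+ k * haar k p * c k.+1 (base_point p)) N)//.
  by apply: eq_bigr => k _; rewrite mulrA.
by move=> k Nk; rewrite c0 ?mulr0// leqW.
Unshelve. all: by end_near. Qed.

Lemma haar_end k (p : P) : base_point p = len -> haar k p = 0.
Proof.
move=> pl; have [j ->] := projlim_Curve a_anti a_cvg p.
have -> : Curve a j (Phi s 0 p) = path j (base_point p) by rewrite /path /base_point clampK.
rewrite (haar_path len0 a_anti) asboolF// => /(windowP a_le); rewrite pl => /andP[_].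
by rewrite ltNge a_le.
Qed.

Lemma core_synth N c v : (forall k, h10 (length k) (c k) (v k)) ->
  (forall k, (N <= k)%N -> c k = fun=> 0) ->
  fdom E (synth c) /\ forall k, h10 (length k) (coef (synth c) k) (v k).
Proof.
move=> cv cN.
have cD : fdom E (synth c).
  split.
    rewrite (_ : synth c = fun p => c 0%N (base_point p) +
      \sum_(k < N) rt2 ^+ k * (haar k p * c k.+1 (base_point p))); last first.
      by apply/funext => p; exact: synth_finite.
    have sumD n : limit_dom (fun p => c 0%N (base_point p) +
        \sum_(k < n) rt2 ^+ k * (haar k p * c k.+1 (base_point p))).
      elim: n => [|n IH].
        rewrite (_ : (fun p => _) = fun p => c 0%N (base_point p)); first exact: base_dom (cv 0%N).
        by apply/funext => p; rewrite big_ord0 addr0.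
      have := limit_lin 1 (rt2 ^+ n) IH (haar_lift_dom (cv n.+1)).
      by congr (limit_dom _); apply/funext => p; rewrite big_ord_recr/= mul1r addrA.
    exact: sumD.
  move=> p pe; rewrite (synth_finite _ cN).
  have [b0|bl] : base_point p = 0 \/ base_point p = len by [].
    rewrite b0 big1 ?addr0; first by case: (cv 0%N).
    by move=> k _; have [_ -> _] := cv k.+1; rewrite !mulr0.
  rewrite bl big1 ?addr0; first by case: (cv 0%N).
  by move=> k _; rewrite haar_end// mul0r mulr0.
split=> // k; have [c0 cl _] := core_coef_ends k cD; have [ck k0 kl] := cv k.
split=> //.
apply: (ac_ext (length_gt0 k) _ _ _ _ ck) => [x /andP[x0 xl]|||].
- have [->|xn0] := eqVneq x 0; first by rewrite c0 k0.
  have [->|xnl] := eqVneq x (length k); first by rewrite cl kl.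
  by rewrite (coef_synth len0 a_anti)// !lt_def xn0 x0 eq_sym xnl.
- apply: (coef_measurable a_anti a_cvg); exact: L2_measurable (core_L2 cD).
- exact: aeW.
- by case: ck => _ /L2_measurable.
Qed.

(** [diagonal_graph], applied to the isometry [coef] with the right inverse [synth]. *)
Theorem limit_laplacian_graph f g :
  op_graph (zero_bc_laplacian be E0 mu (itv0_ends len0)) f g <->
  [/\ L2 mu f, L2 mu g &
    forall k, op_graph (dirichlet_laplacian (length k)) (coef f k) (coef g k)].
Proof.
exact: (@diagonal_graph R _ _ mu E length coef (@synth R len len0 a) length_gt0
  (fun b c p q k x => coef_linear a_anti a_cvg b c p q k x)
  (fun p k => coef_measurable a_anti a_cvg k)
  (coef_parseval a_anti a_cvg a_le) (synth_measurable a_anti a_cvg)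
  (coef_synth len0 a_anti a_cvg a_le) core_lin core_L2 core_derivatives core_val core_synth f g).
Qed.

End limit_form.

(** * Isospectrality *)

(** Unitary equivalence: U is a linear isometry which intertwines the operators, and
    it is onto modulo [eqv], which stands for equality almost everywhere. *)
Section transfer.
Context {R : realType} {T T' : Type}.
Variables (A : operator R T) (A' : operator R T').
Variable U : (T -> R) -> T' -> R.
Variable eqv : (T' -> R) -> (T' -> R) -> Prop.
Local Notation mem := (op_mem A).
Local Notation mem' := (op_mem A').
Hypothesis mem_lin : forall b c f g, mem f -> mem g -> mem (fun x => b * f x + c * g x).
Hypothesis mem_lin' : forall b c f g, mem' f -> mem' g -> mem' (fun x => b * f x + c * g x).
Hypothesis graph_mem' : forall f g, op_graph A' f g -> mem' f /\ mem' g.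
Hypothesis U_lin : forall b c f g,
  U (fun x => b * f x + c * g x) = fun y => b * U f y + c * U g y.
Hypothesis U_mem : forall f, mem f -> mem' (U f).
Hypothesis U_norm : forall f, mem f -> op_norm A' (U f) = op_norm A f.
Hypothesis U_graph : forall f g, op_graph A f g <-> [/\ mem f, mem g & op_graph A' (U f) (U g)].
Hypothesis eqv_refl : forall f, eqv f f.
Hypothesis eqv_sym : forall f g, eqv f g -> eqv g f.
Hypothesis eqv_lin : forall b c f f' g g', eqv f f' -> eqv g g' ->
  eqv (fun x => b * f x + c * g x) (fun x => b * f' x + c * g' x).
Hypothesis eqv_norm : forall f g, mem' f -> mem' g -> eqv f g -> op_norm A' f = op_norm A' g.
Hypothesis eqv_graph : forall f g f1 g1, op_graph A' f g -> mem' f1 -> mem' g1 ->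
  eqv f f1 -> eqv g g1 -> op_graph A' f1 g1.
Hypothesis U_onto : forall h, mem' h -> exists2 f, mem f & eqv (U f) h.

Lemma transfer_onto_graph f' g' : op_graph A' f' g' ->
  exists f g, [/\ op_graph A f g, eqv (U f) f' & eqv (U g) g'].
Proof.
move=> fg; have [f'm g'm] := graph_mem' fg.
have [f fm ff] := U_onto f'm; have [g gm gg] := U_onto g'm.
exists f, g; split=> //; apply/U_graph; split=> //.
by apply: (eqv_graph fg); [exact: U_mem|exact: U_mem|exact: eqv_sym|exact: eqv_sym].
Qed.

Let subE (X : Type) (lambda : R) (f g : X -> R) :
  (fun x => g x - lambda * f x) = (fun x => 1 * g x + (- lambda) * f x).
Proof. by apply/funext => x; rewrite mul1r mulNr. Qed.

Let addE (X : Type) (lambda : R) (f g : X -> R) :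
  (fun x => g x + lambda * f x) = (fun x => 1 * g x + lambda * f x).
Proof. by apply/funext => x; rewrite mul1r. Qed.

Lemma transfer_resolvent : resolvent_set A = resolvent_set A'.
Proof.
apply/seteqP; split=> lambda [on [C CP]]; split.
- move=> g' g'm; have [g gm gg] := U_onto g'm; have [f fg] := on g gm.
  exists (U f); have /U_graph[fm hm fgU] := fg.
  rewrite addE; apply: (eqv_graph fgU); [exact: U_mem| |exact: eqv_refl|].
    by apply: mem_lin' => //; exact: U_mem.
  by rewrite addE U_lin; apply: eqv_lin.
- exists C => f' g' fg'; have [f'm g'm] := graph_mem' fg'.
  have [f [g [fg ff gg]]] := transfer_onto_graph fg'.
  have /U_graph[fm gm _] := fg.
  rewrite -(eqv_norm (U_mem fm) f'm ff) U_norm//; apply: le_trans (CP _ _ fg) _.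
  rewrite le_eqVlt; apply/orP; left; apply/eqP; congr (_ * _).
  rewrite !subE -U_norm; last exact: mem_lin.
  rewrite U_lin; apply: eqv_norm; [apply: mem_lin'; exact: U_mem|exact: mem_lin'|exact: eqv_lin].
- move=> g gm; have [f' fg'] := on (U g) (U_mem gm); have [f'm _] := graph_mem' fg'.
  have [f fm ff] := U_onto f'm; exists f; apply/U_graph; rewrite addE; split=> //; first exact: mem_lin.
  rewrite addE in fg'; apply: (eqv_graph fg'); [exact: U_mem|by apply: U_mem; exact: mem_lin|exact: eqv_sym|].
  by rewrite U_lin; apply: eqv_lin; [exact: eqv_refl|exact: eqv_sym].
- exists C => f g fg; have /U_graph[fm gm fgU] := fg.
  rewrite -U_norm//; apply: le_trans (CP _ _ fgU) _.
  by rewrite !subE -U_norm ?U_lin//; exact: mem_lin.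
Qed.

Lemma U_combination n (f : T -> R) (e : 'I_n -> T -> R) (c : 'I_n -> R) :
  U (fun x => f x - \sum_(k < n) c k * e k x) = fun y => U f y - \sum_(k < n) c k * U (e k) y.
Proof.
elim: n e c => [|n IH] e c.
  by under eq_fun do rewrite big_ord0 subr0; under [RHS]eq_fun do rewrite big_ord0 subr0.
rewrite (_ : (fun x => _) = fun x =>
  1 * (f x - \sum_(k < n) c (widen_ord (leqnSn n) k) * e (widen_ord (leqnSn n) k) x)
    + (- c ord_max) * e ord_max x); last first.
  by apply/funext => x; rewrite big_ord_recr/=; ring.
rewrite U_lin (IH (fun k => e (widen_ord (leqnSn n) k)) (fun k => c (widen_ord (leqnSn n) k))).
by apply/funext => y; rewrite [in RHS]big_ord_recr/=; ring.
Qed.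

Lemma mem_combination n f (e : 'I_n -> T -> R) (c : 'I_n -> R) : mem f -> (forall k, mem (e k)) ->
  mem (fun x => f x - \sum_(k < n) c k * e k x).
Proof.
move=> fm; elim: n e c => [|n IH] e c em.
  by rewrite (_ : (fun x => _) = f)//; apply/funext => x; rewrite big_ord0 subr0.
rewrite (_ : (fun x => _) = fun x =>
  1 * (f x - \sum_(k < n) c (widen_ord (leqnSn n) k) * e (widen_ord (leqnSn n) k) x)
    + (- c ord_max) * e ord_max x); last first.
  by apply/funext => x; rewrite big_ord_recr/=; ring.
by apply: mem_lin => //; apply: (IH (fun k => e (widen_ord (leqnSn n) k)) (fun k => c (widen_ord (leqnSn n) k))).
Qed.

Lemma eqv_combination n f f' (e e' : 'I_n -> T' -> R) (c : 'I_n -> R) :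
  mem' f -> mem' f' -> (forall k, mem' (e k)) -> (forall k, mem' (e' k)) ->
  eqv f f' -> (forall k, eqv (e k) (e' k)) ->
  op_norm A' (fun x => f x - \sum_(k < n) c k * e k x) =
  op_norm A' (fun x => f' x - \sum_(k < n) c k * e' k x).
Proof.
move=> fm fm' em em' ff ee.
have step (f0 : T' -> R) m (e0 : 'I_m.+1 -> T' -> R) (c0 : 'I_m.+1 -> R) :
  (fun x => f0 x - \sum_(k < m.+1) c0 k * e0 k x) = fun x =>
  1 * (f0 x - \sum_(k < m) c0 (widen_ord (leqnSn m) k) * e0 (widen_ord (leqnSn m) k) x)
    + (- c0 ord_max) * e0 ord_max x by apply/funext => x; rewrite big_ord_recr/=; ring.
suff [h1 h2 h3] : [/\ mem' (fun x => f x - \sum_(k < n) c k * e k x),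
   mem' (fun x => f' x - \sum_(k < n) c k * e' k x)
   & eqv (fun x => f x - \sum_(k < n) c k * e k x) (fun x => f' x - \sum_(k < n) c k * e' k x)].
  exact: eqv_norm.
elim: n e e' c em em' ee => [|n IH] e e' c em em' ee.
  have z (f0 : T' -> R) (e0 : 'I_0 -> T' -> R) : (fun x => f0 x - \sum_(k < 0) c k * e0 k x) = f0.
    by apply/funext => x; rewrite big_ord0 subr0.
  by rewrite !z.
have [h1 h2 h3] := IH (fun k => e (widen_ord (leqnSn n) k)) (fun k => e' (widen_ord (leqnSn n) k))
  (fun k => c (widen_ord (leqnSn n) k)) (fun k => em _) (fun k => em' _) (fun k => ee _).
by rewrite !step; split; [exact: mem_lin'|exact: mem_lin'|exact: eqv_lin].
Qed.

Let scale (X : Type) (lambda : R) (f : X -> R) : (fun x => lambda * f x) = (fun x => lambda * f x + 0 * f x).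
Proof. by apply/funext => x; rewrite mul0r addr0. Qed.

Lemma transfer_eigen lambda f : Defs.eigenspace A lambda f -> mem f /\ Defs.eigenspace A' lambda (U f).
Proof.
by rewrite /Defs.eigenspace /= => /U_graph[fm _]; rewrite scale U_lin -scale.
Qed.

Lemma transfer_eigen_onto lambda f' f : Defs.eigenspace A' lambda f' -> mem f -> eqv (U f) f' ->
  Defs.eigenspace A lambda f.
Proof.
move=> fl fm ff; have [f'm _] := graph_mem' fl; apply/U_graph.
rewrite scale; split=> //; first exact: mem_lin.
rewrite U_lin; apply: (eqv_graph fl); [exact: U_mem|apply: mem_lin'; exact: U_mem|exact: eqv_sym|].
by rewrite [X in eqv X _]scale; apply: eqv_lin; exact: eqv_sym.
Qed.

Lemma transfer_multiplicity lambda n :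
  has_multiplicity A lambda n <-> has_multiplicity A' lambda n.
Proof.
split=> -[e [eE eP]].
  have em k := (transfer_eigen (eE k)).1.
  exists (fun k => U (e k)); split=> [k|f' fE]; first exact: (transfer_eigen (eE k)).2.
  have [f'm _] := graph_mem' fE; have [f fm ff] := U_onto f'm.
  have := eP f (transfer_eigen_onto fE fm ff).
  have nE (c : 'rV[R]_n) : op_norm A (fun x => f x - \sum_(k < n) c 0 k * e k x) =
      op_norm A' (fun x => f' x - \sum_(k < n) c 0 k * U (e k) x).
    rewrite -U_norm; last exact: mem_combination.
    rewrite (U_combination f e (fun k => c 0 k)).
    by apply: eqv_combination => //; try (move=> k; exact: U_mem); exact: U_mem.
  move=> [c [c0 cU]]; exists c; split=> [|c' c'0]; first by rewrite -nE.
  by apply: cU; rewrite nE.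
have e'm k : mem' (e k) by have [] := graph_mem' (eE k).
have /choice[d dP] : forall k, exists d, mem d /\ eqv (U d) (e k).
  by move=> k; have [d dm de] := U_onto (e'm k); exists d.
have dm k := (dP k).1; have de k := (dP k).2.
exists d; split=> [k|f fE]; first exact: transfer_eigen_onto (eE k) (dm k) (de k).
have [fm fE'] := transfer_eigen fE; have := eP _ fE'.
have nE (c : 'rV[R]_n) : op_norm A (fun x => f x - \sum_(k < n) c 0 k * d k x) =
    op_norm A' (fun x => U f x - \sum_(k < n) c 0 k * e k x).
  rewrite -U_norm; last exact: mem_combination.
  rewrite (U_combination f d (fun k => c 0 k)).
  by apply: eqv_combination => //; try (move=> k; exact: U_mem); exact: U_mem.
move=> [c [c0 cU]]; exists c; split=> [|c' c'0]; first by rewrite nE.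
by apply: cU; rewrite -nE.
Qed.

Lemma transfer_isospectral : isospectral A A'.
Proof. by split; [rewrite /spectrum transfer_resolvent|exact: transfer_multiplicity]. Qed.

End transfer.

(** The intervals of the string, listed by nonincreasing length. *)
Section enumeration.
Variable m : nat -> nat.
Hypothesis m_gt0 : forall i, (0 < m i)%N.
Local Notation J := {i : nat & 'I_(m i)}.

(** The next copy of the same length, or the first copy of the next length. *)
Definition next_interval (j : J) : J :=
  if insub (tagged j).+1 is Some r then Tagged (fun i => 'I_(m i)) (r : 'I_(m (tag j)))
  else Tagged (fun i => 'I_(m i)) (Ordinal (m_gt0 (tag j).+1)).

Definition interval k : J := iter k next_interval (Tagged (fun i => 'I_(m i)) (Ordinal (m_gt0 0))).

Definition before i := (\sum_(j < i) m j)%N.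

Definition rank (j : J) : nat := (before (tag j) + tagged j)%N.

Lemma rank_next j : rank (next_interval j) = (rank j).+1.
Proof.
rewrite /next_interval; case: insubP => [r _ rE|nr] /=.
  by rewrite /rank /= rE addnS.
rewrite /rank /= addn0 /before big_ord_recr/= -addnS; congr (_ + _)%N.
by apply/eqP; rewrite eqn_leq ltn_ord andbT leqNgt.
Qed.

Lemma intervalK k : rank (interval k) = k.
Proof. by elim: k => [|k IH]; [rewrite /rank /= /before big_ord0|rewrite /= rank_next IH]. Qed.

Lemma before_le i j : (i <= j)%N -> (before i <= before j)%N.
Proof.
move=> /subnK <-; elim: (j - i)%N => // n IH; rewrite addSn.
by apply: leq_trans IH _; rewrite /before big_ord_recr/= leq_addr.
Qed.

Lemma rank_lt j : (rank j < before (tag j).+1)%N.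
Proof. by rewrite /rank /before big_ord_recr/= ltn_add2l. Qed.

Lemma rank_inj : injective rank.
Proof.
move=> j j' e; have tt : tag j = tag j'.
  have [tt|tt|//] := ltngtP (tag j) (tag j').
    have := leq_trans (rank_lt j) (before_le tt); rewrite e /rank ltnNge leq_addr//.
  have := leq_trans (rank_lt j') (before_le tt); rewrite -e /rank ltnNge leq_addr//.
case: j j' tt e => [i r] [i' r'] /= tt; move: r r'; rewrite -{}tt => r r'.
by rewrite /rank /= => /addnI/val_inj ->.
Qed.

Lemma rankK j : interval (rank j) = j.
Proof. by apply: rank_inj; rewrite intervalK. Qed.

Lemma interval_bij : set_bij [set: nat] [set: J] interval.
Proof.
split=> //; first by move=> k k' _ _ e; rewrite -(intervalK k) e intervalK.
by move=> j _; exists (rank j) => //; exact: rankK.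
Qed.

Lemma tag_interval_le k k' : (k <= k')%N -> (tag (interval k) <= tag (interval k'))%N.
Proof.
move=> /subnK <-; elim: (k' - k)%N => // n IH; rewrite addSn; apply: leq_trans IH _ => /=.
by rewrite /next_interval; case: insubP => [r _ _|_] /=.
Qed.

Lemma tag_interval_ge N k : (before N <= k)%N -> (N <= tag (interval k))%N.
Proof.
move=> Nk; rewrite leqNgt; apply/negP => tN.
have := leq_trans (rank_lt (interval k)) (before_le tN).
by rewrite intervalK ltnNge Nk.
Qed.

End enumeration.

Section string_tower.
Context {R : realType}.
Variables (l : nat -> R) (m : nat -> nat).
Hypothesis l_gt0 : forall i, 0 < l i.
Hypothesis l_decr : forall i j, (i < j)%N -> l j < l i.
Hypothesis l_cvg : l @ \oo --> (0 : R).
Hypothesis m_gt0 : forall i, (0 < m i)%N.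
Local Notation J := {i : nat & 'I_(m i)}.
Local Notation len0 := (l_gt0 0%N).

Definition interval_length k := l (tag (interval m_gt0 k)).

(** The interval of rank k.+1 is glued on at step k; the interval of rank 0 is the
    base. *)
Definition window_length k := interval_length k.+1.

Let l_le i j : (i <= j)%N -> l j <= l i.
Proof. by rewrite leq_eqVlt => /orP[/eqP ->//|/l_decr/ltW]. Qed.

Lemma window_length_anti i j : (i <= j)%N -> window_length j <= window_length i.
Proof. by move=> ij; apply/l_le/tag_interval_le. Qed.

Lemma window_length_le k : window_length k <= l 0%N.
Proof. exact: l_le. Qed.

Lemma window_length_gt0 k : 0 < window_length k.
Proof. exact: l_gt0. Qed.

Lemma window_length_cvg : window_length @ \oo --> (0 : R).
Proof.
apply/cvgrPdist_le => e e0; have /cvgrPdist_le/(_ _ e0)[N _ NP] := l_cvg.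
near=> k; apply: (NP (tag (interval m_gt0 k.+1))); apply: (tag_interval_ge m_gt0); apply: leqW.
by near: k; exact: nbhs_infty_ge.
Unshelve. all: by end_near. Qed.

Lemma length_interval k : coef_length (len := l 0%N) window_length k = interval_length k.
Proof. by case: k. Qed.

Local Notation s := (haar_tower len0 window_length).
Local Notation be := (haar_sequence len0 window_length_anti).
Local Notation mu := (tower_measure len0 window_length).
Local Notation coef := (@coef R (l 0%N) len0 window_length).
Local Notation Delta := (zero_bc_laplacian be (itv0_form len0) mu (itv0_ends len0)).
Local Notation D := (string_laplacian l m).

Definition string_coef (f : projlim s -> R) (p : J * R) : R := coef f (rank p.1) p.2.

Definition string_ae (f g : J * R -> R) :=
  forall j, ae_eq (leb (l (tag j))) setT (component f j) (component g j).

Lemma laplacian_graph f g : op_graph Delta f g <->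
  [/\ L2 mu f, L2 mu g & forall k,
    op_graph (dirichlet_laplacian (interval_length k)) (coef f k) (coef g k)].
Proof.
have H := limit_laplacian_graph (a_anti := window_length_anti) window_length_cvg
  window_length_le window_length_gt0 f g.
split=> [/H[f2 g2 fg]|[f2 g2 fg]]; first by split=> // k; have := fg k; rewrite length_interval.
by apply/H; split=> // k; rewrite length_interval.
Qed.

Lemma interval_length_rank (j : J) : interval_length (rank j) = l (tag j).
Proof. by rewrite /interval_length rankK. Qed.

Lemma length_intervalE : coef_length (len := l 0%N) window_length = interval_length.
Proof. by apply/funext => k; exact: length_interval. Qed.

Lemma component_interval f k : component (string_coef f) (interval m_gt0 k) = coef f k.
Proof. by apply/funext => x; rewrite /component /string_coef /= intervalK. Qed.

(** Parseval's identity, reindexed by the enumeration of the intervals. *)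
Lemma string_norm2 (f : projlim s -> R) :
  measurable_fun setT (f : borel (projlim s) -> R) ->
  (\int[mu]_p (f p ^+ 2)%:E < +oo)%E ->
  (forall j, L2 (leb (l (tag j))) (component (string_coef f) j)) /\
  sum_norm2 (fun j : J => l (tag j)) (string_coef f) = (L2norm mu f ^+ 2)%:E.
Proof.
move=> mf flty.
have P := @coef_parseval R (l 0%N) len0 window_length window_length_anti window_length_cvg
  window_length_le.
rewrite length_intervalE in P.
have M := fun h k => @coef_measurable R (l 0%N) len0 window_length window_length_anti
  window_length_cvg h k.
have [c2 cn] := @W_norm_series R _ (borel (projlim s)) mu interval_length coef M P f mf flty.
split=> [j|].
  by have := c2 (rank j); rewrite interval_length_rank.
rewrite /sum_norm2 (reindex_esum _ _ _ _ (interval_bij m_gt0)) -nneseries_esumT; last first.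
  by move=> k; rewrite lee_fin sqr_ge0.
apply: cvg_lim => //.
rewrite (_ : (fun n => _) = EFin \o fun n =>
  \sum_(k < n) L2norm (leb (interval_length k)) (coef f k) ^+ 2).
  by apply: cvg_EFin; [exact: nearW|exact: cn].
apply/funext => n /=; rewrite big_mkord sumEFin; congr _%:E.
by apply: eq_bigr => k _; rewrite component_interval.
Qed.

Lemma string_coef_mem f : L2 mu f -> op_mem D (string_coef f).
Proof.
move=> f2; have [c2 cn] := string_norm2 (L2_measurable f2) (L2_sqr_lty f2).
by apply/sum_memP; split=> //; rewrite cn ltry.
Qed.

Lemma string_coef_norm f : L2 mu f -> op_norm D (string_coef f) = L2norm mu f.
Proof.
move=> f2; have [_ cn] := string_norm2 (L2_measurable f2) (L2_sqr_lty f2).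
rewrite [LHS]sum_normE cn /= sqrtr_sqr ger0_norm//; exact: L2norm_ge0.
Qed.

Lemma string_coef_graph f g : op_graph Delta f g <->
  [/\ L2 mu f, L2 mu g & op_graph D (string_coef f) (string_coef g)].
Proof.
split=> [/laplacian_graph[f2 g2 fg]|[f2 g2 /sum_graphP[_ _ fg]]].
  split=> //; apply/sum_graphP; split; [exact: string_coef_mem|exact: string_coef_mem|].
  by move=> j; have := fg (rank j); rewrite interval_length_rank.
apply/laplacian_graph; split=> // k; have := fg (interval m_gt0 k).
by rewrite !component_interval.
Qed.

Lemma string_mem_lin b c f g : op_mem D f -> op_mem D g -> op_mem D (fun x => b * f x + c * g x).
Proof.
move=> fm gm; have := sum_mem_lin b fm (sum_mem_lin (c - 1) gm gm).
rewrite (_ : (fun p => _) = fun x => b * f x + c * g x)//.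
by apply/funext => p; ring.
Qed.

Lemma string_ae_norm f g : op_mem D f -> op_mem D g -> string_ae f g ->
  op_norm D f = op_norm D g.
Proof.
move=> /sum_memP[f2 _] /sum_memP[g2 _] fg.
rewrite [LHS]sum_normE [RHS]sum_normE; congr (Num.sqrt (fine _)).
apply: eq_esum => j _; congr ((_ ^+ 2)%:E).
by apply: ae_eq_L2norm => //; [exact: L2_measurable (f2 j)|exact: L2_measurable (g2 j)].
Qed.

Lemma string_ae_graph f g f1 g1 : op_graph D f g -> op_mem D f1 -> op_mem D g1 ->
  string_ae f f1 -> string_ae g g1 -> op_graph D f1 g1.
Proof.
move=> /sum_graphP[_ _ fg] f1m g1m ff gg; apply/sum_graphP; split=> // j.
have [f12 _] := (sum_memP _ f1).1 f1m; have [g12 _] := (sum_memP _ g1).1 g1m.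
apply: (dirichlet_graph_ae (l_gt0 _) (fg j)) => //.
- exact: L2_measurable (f12 j).
- exact: L2_measurable (g12 j).
Qed.

(** The preimage is synthesised from the components; Parseval's identity shows that
    it is square integrable. *)
Lemma string_coef_onto h : op_mem D h -> exists2 f, L2 mu f & string_ae (string_coef f) h.
Proof.
move=> hm; have [h2 hn] := (sum_memP _ h).1 hm.
pose c k := component h (interval m_gt0 k).
have mc k : measurable_fun setT (c k : R -> R) by exact: L2_measurable (h2 _).
pose f := @synth R (l 0%N) len0 window_length c.
have mf := synth_measurable (len0 := len0) window_length_anti window_length_cvg mc.
have cE k : ae_eq (leb (interval_length k)) setT (coef f k) (c k).
  apply: ae_imp (leb_ae_itv (interval_length k)) => x xk _.
  apply: (coef_synth len0 window_length_anti window_length_cvg window_length_le).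
  by rewrite length_interval.
have sae : string_ae (string_coef f) h.
  move=> j; have := cE (rank j); rewrite interval_length_rank /c rankK.
  by [].
exists f => //; apply: L2P => //.
have P := coef_parseval window_length_anti window_length_cvg window_length_le mf.
rewrite length_intervalE in P.
rewrite P (nneseries_esumT); last first.
  by move=> k; apply: integral_ge0 => x _; rewrite lee_fin sqr_ge0.
move: hn; rewrite /sum_norm2.
rewrite (reindex_esum _ _ _ _ (interval_bij m_gt0)); apply: le_lt_trans.
rewrite le_eqVlt; apply/orP; left; apply/eqP; apply: eq_esum => k _.
have mck : measurable_fun setT (coef f k : R -> R).
  exact: (@coef_measurable _ _ _ _ window_length_anti window_length_cvg _ _ mf).
rewrite L2norm_sqr /Rintegral fineK; last first.
  by apply: integrable_fin_num => //; exact: L2_sqr_integrable (h2 _).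
apply: ae_eq_integral => //.
- by apply/measurable_EFinP; exact: measurable_funX mck.
- by apply/measurable_EFinP; apply: measurable_funX; exact: mc.
- by apply: ae_imp (cE k) => x /(_ I) e _; rewrite /= e.
Qed.

Theorem string_isospectral : isospectral Delta D.
Proof.
apply: (@transfer_isospectral _ _ _ Delta D string_coef string_ae).
- by move=> b c f g f2 g2; apply: L2D; exact: L2Z.
- exact: string_mem_lin.
- by move=> f g /sum_graphP[].
- move=> b c f g; apply/funext => p.
  by rewrite /string_coef (coef_linear window_length_anti window_length_cvg).
- exact: string_coef_mem.
- exact: string_coef_norm.
- exact: string_coef_graph.
- by move=> f j; apply: aeW.
- by move=> f g fg j; apply: ae_imp (fg j) => x e /e ->.
- move=> b c f f' g g' ff gg j; apply: ae_imp2 (ff j) (gg j) => x e1 e2 xT.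
  by have := e1 xT; have := e2 xT; rewrite /component => -> ->.
- exact: string_ae_norm.
- exact: string_ae_graph.
- exact: string_coef_onto.
Qed.

End string_tower.

(** * Fractal strings as Laplacians on projective limits *)

Theorem mainTheorem3 (R : realType) (l : nat -> R) (m : nat -> nat)
    (l_gt0 : forall i, 0 < l i)
    (l_decr : forall i j, (i < j)%N -> l j < l i)
    (l_cvg : l @ \oo --> (0 : R))
    (m_gt0 : forall i, (0 < m i)%N) :
  exists (be : barlow_evans R (itv0 (l_gt0 0%N)))
         (mu : {measure set (borel (projlim (be_tower be))) -> \bar R}),
    let Delta := zero_bc_laplacian be (itv0_form (l_gt0 0%N)) mu
                   (itv0_ends (l_gt0 0%N)) in
    (forall A : set (borel (itv0 (l_gt0 0%N))), measurable A ->
       be_muF be 0%N A = lebesgue_measure (set_val @` A)) /\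
    (forall i, finite_set [set: GG (be_tower be) i]) /\
    projlim_measure be mu /\
    connected [set: projlim (be_tower be)] /\
    isospectral Delta (string_laplacian l m) /\
    spectrum Delta = range (string_eigenvalue l) /\
    (forall lambda, has_multiplicity Delta lambda (string_multiplicity l m lambda)).

Proof.
have a_anti := window_length_anti l_decr m_gt0.
have a_cvg := window_length_cvg l_cvg m_gt0.
exists (haar_sequence (l_gt0 0%N) (window_length_anti l_decr m_gt0)),
  (tower_measure (l_gt0 0%N) (window_length l m_gt0)) => Delta.
have iso : isospectral Delta (string_laplacian l m) := string_isospectral l_gt0 l_decr l_cvg m_gt0.
split; first exact: base_measureE.
split.
  move=> i; have [[t [_ tP]] _] := GG_two (l_gt0 0%N) (window_length l m_gt0) i.
  by apply: (@sub_finite_set _ _ [set point; t]) => [g _|]; [exact: tP|exact: finite_set2].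
split; first exact: haar_projlim_measure.
split; first exact: (projlim_connected (len0 := l_gt0 0%N) (window_length_anti l_decr m_gt0) a_cvg).
split; first exact: iso.
split; first by rewrite iso.1; exact: string_spectrumE.
by move=> lambda; apply/iso.2; exact: string_multiplicityP.
Qed.
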